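(* Let $n\geq 2$ and consider the Ricci flow $\frac{\partial}{\partial t} g=-2\,Ric_{g(t)}$ on an $n$-dimensional Riemannian manifold $(M^n,g)$, written in local coordinates $x^1,\dots,x^n$ as the system of second-order PDEs $\partial_t g_{ij}=-2R_{ij}$ for the unknowns $g_{ij}(x,t)$, $1\le i\le j\le n$. Then the Lie algebra of its classical (Lie point) symmetries is spanned by \[ X_1=\frac{\partial}{\partial t},\qquad X_2=t\frac{\partial}{\partial t}+\sum_{i=1}^n \sum_{j\geq i}^n g_{ij}\frac{\partial}{\partial g_{ij}}, \] \[ X_{k+2}=\xi^k\frac{\partial}{\partial x^k}-\sum_{i=1}^n \sum_{j\geq i}^n \left( g_{ki}\frac{\partial\xi^k}{\partial x^j}+g_{kj}\frac{\partial\xi^k}{\partial x^i}\right)\frac{\partial}{\partial g_{ij}},\qquad k=1,\dots,n, \] (no summation over $k$ in $X_{k+2}$), where $\xi^1,\dots,\xi^n$ are arbitrary smooth functions of $x^1,\dots,x^n$ and $g_{ij}$ are the coefficients of the metric tensor $g$.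
   Context: The Ricci flow is regarded as a system of PDEs with independent variables $(x^1,\dots,x^n,t)$ and dependent variables the components $g_{ij}$, $i\le j$, of a Riemannian metric; $R_{ij}$ denotes the components of the Ricci tensor of $g(t)$. A Lie point (classical) symmetry is a vector field on the space of $(x,t,g_{ij})$ generating a local one-parameter group of point transformations mapping solutions to solutions (equivalently, satisfying the infinitesimal invariance criterion for the second prolongation). *)

(* Defs.v *)
From HB Require Import structures.
From mathcomp Require Import all_boot all_order all_algebra.
From mathcomp Require Import all_classical all_reals all_analysis.
Set Implicit Arguments. Unset Strict Implicit. Unset Printing Implicit Defensive.
Import Order.TTheory GRing.Theory Num.Theory.
Import numFieldNormedType.Exports.
Local Open Scope ring_scope.
Local Open Scope classical_set_scope.

(** Index set of the unknowns g_{ij}, 1 <= i <= j <= n. *)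
Definition Pidx (n : nat) := {p : 'I_n * 'I_n | (p.1 <= p.2)%N}.

Lemma pidx_subproof n (i j : 'I_n) :
  let p := if (i <= j)%N then (i, j) else (j, i) in (p.1 <= p.2)%N.
Proof. by rewrite /=; case: (leqP i j) => //= /ltnW. Qed.

(** the unknown g_{ij} = g_{ji} as an element of Pidx *)
Definition pidx n (i j : 'I_n) : Pidx n := exist (fun p : 'I_n * 'I_n => (p.1 <= p.2)%N) _ (pidx_subproof i j).

Definition pfst n (p : Pidx n) : 'I_n := (sval p).1.
Definition psnd n (p : Pidx n) : 'I_n := (sval p).2.

Definition mdim (n : nat) : nat := #|{: Pidx n}|.
Definition Ndim (n : nat) : nat := (n.+1 + mdim n)%N.

Section RicciFlow.
Variable R : realType.
Variable n : nat.

(** Independent variables (x^1..x^n, t) indexed by 'I_n.+1 : x^k is iv k, t is it. *)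
Definition iv (k : 'I_n) : 'I_n.+1 := widen_ord (leqnSn n) k.
Definition it : 'I_n.+1 := ord_max.

(** Coordinates of the base space {(x, t, g_{ij})} = R^(Ndim n) *)
Definition xc (k : 'I_n) : 'I_(Ndim n) := lshift (mdim n) (iv k).
Definition tc : 'I_(Ndim n) := lshift (mdim n) it.
Definition gp (p : Pidx n) : 'I_(Ndim n) := rshift n.+1 (enum_rank p).
Definition gc (i j : 'I_n) : 'I_(Ndim n) := gp (pidx i j).

Definition ecoord (c : 'I_(Ndim n)) : 'rV[R]_(Ndim n) := delta_mx 0 c.

Definition xpart (z : 'rV[R]_(Ndim n)) : 'rV[R]_n := \row_k z 0 (xc k).
Definition gmat (z : 'rV[R]_(Ndim n)) : 'M[R]_n := \matrix_(i, j) z 0 (gc i j).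

Definition posdef (A : 'M[R]_n) : Prop :=
  forall v : 'rV[R]_n, v != 0 -> 0 < (v *m A *m v^T) 0 0.

Definition Dom : set 'rV[R]_(Ndim n) := [set z | posdef (gmat z)].

End RicciFlow.

Definition pd (R : realType) (k : nat) (f : 'rV[R]_k -> R) (i : 'I_k)
  : 'rV[R]_k -> R := fun z => derive f z (delta_mx 0 i).

Definition pds (R : realType) (k : nat) (s : seq 'I_k) (f : 'rV[R]_k -> R)
  : 'rV[R]_k -> R := foldr (fun i g => pd g i) f s.

Definition smooth_on (R : realType) (k : nat) (D : set 'rV[R]_k)
  (f : 'rV[R]_k -> R) : Prop :=
  forall (s : seq 'I_k) (z : 'rV[R]_k), D z -> differentiable (pds s f) z.

Section Jets.
Variable R : realType.
Variable n : nat.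

(** 2-jets of the unknowns g_{ij}(x,t): values, first and second partial
    derivatives w.r.t. the independent variables (x, t).
    (The jet coordinates x, t are omitted since the equations do not
    involve them explicitly.) *)
Record jet := Jet {
  j0 : Pidx n -> R;
  j1 : 'I_n.+1 -> Pidx n -> R;
  j2 : 'I_n.+1 -> 'I_n.+1 -> Pidx n -> R }.

Definition jet_axpy (J : jet) (e : R) (K : jet) : jet :=
  Jet (fun p => j0 J p + e * j0 K p)
      (fun a p => j1 J a p + e * j1 K a p)
      (fun a b p => j2 J a b p + e * j2 K a b p).

Section Ric.
Variable J : jet.
Definition gJ (i j : 'I_n) : R := j0 J (pidx i j).
Definition giJ : 'M[R]_n := invmx (\matrix_(i, j) gJ i j).
Definition dg (k i j : 'I_n) : R := j1 J (iv k) (pidx i j).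
Definition ddg (k l i j : 'I_n) : R := j2 J (iv k) (iv l) (pidx i j).
(* d_a g^{kl} = - g^{kb} d_a g_{bc} g^{cl} *)
Definition dgi (a k l : 'I_n) : R :=
  - \sum_(b < n) \sum_(c < n) giJ k b * dg a b c * giJ c l.
Definition Gam (k i j : 'I_n) : R :=
  2^-1 * \sum_(l < n) giJ k l * (dg i j l + dg j i l - dg l i j).
Definition dGam (a k i j : 'I_n) : R :=
  2^-1 * \sum_(l < n) (dgi a k l * (dg i j l + dg j i l - dg l i j)
                     + giJ k l * (ddg a i j l + ddg a j i l - ddg a l i j)).
Definition Ric (i j : 'I_n) : R :=
  \sum_(k < n) dGam k k i j - \sum_(k < n) dGam j k i k
  + \sum_(k < n) \sum_(l < n) (Gam k k l * Gam l i j - Gam k j l * Gam l i k).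

Definition Delta (p : Pidx n) : R := j1 J (@it n) p + 2 * Ric (pfst p) (psnd p).
End Ric.

Definition zu (u : Pidx n -> 'rV[R]_n.+1 -> R) (y : 'rV[R]_n.+1)
  : 'rV[R]_(Ndim n) := row_mx y (\row_(c < mdim n) u (enum_val c) y).

Definition jet_of (u : Pidx n -> 'rV[R]_n.+1 -> R) (y : 'rV[R]_n.+1) : jet :=
  Jet (fun p => u p y)
      (fun a p => pd (u p) a y)
      (fun a b p => pd (pd (u p) b) a y).

Section Prolong.
(** a vector field on the space of (x, t, g): component c of V z is the
    coefficient of d/dz^c *)
Variable V : 'rV[R]_(Ndim n) -> 'rV[R]_(Ndim n).
Variable u : Pidx n -> 'rV[R]_n.+1 -> R.

Definition Vind (a : 'I_n.+1) (y : 'rV[R]_n.+1) : R := V (zu u y) 0 (lshift (mdim n) a).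
Definition Veta (p : Pidx n) (y : 'rV[R]_n.+1) : R := V (zu u y) 0 (gp p).
Definition Qc (p : Pidx n) (y : 'rV[R]_n.+1) : R :=
  Veta p y - \sum_(a < n.+1) Vind a y * pd (u p) a y.
(* prolongation coefficients (Olver, Thm 2.36): phi^J = D_J Q + xi^i u_{J,i} *)
Definition phi1 (a : 'I_n.+1) (p : Pidx n) (y : 'rV[R]_n.+1) : R :=
  pd (Qc p) a y + \sum_(i < n.+1) Vind i y * pd (pd (u p) a) i y.
Definition phi2 (a b : 'I_n.+1) (p : Pidx n) (y : 'rV[R]_n.+1) : R :=
  pd (pd (Qc p) b) a y + \sum_(i < n.+1) Vind i y * pd (pd (pd (u p) b) a) i y.
Definition prolong (y : 'rV[R]_n.+1) : jet :=
  Jet (fun p => Veta p y) (fun a p => phi1 a p y) (fun a b p => phi2 a b p y).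
End Prolong.

Definition smooth_vf (V : 'rV[R]_(Ndim n) -> 'rV[R]_(Ndim n)) : Prop :=
  forall c, smooth_on (@Dom R n) (fun z => V z 0 c).

(** Infinitesimal invariance criterion: pr^(2) V (Delta_p) = 0 at every point
    of the equation locus {Delta = 0} (every 2-jet is the 2-jet of some smooth
    u).  Since Delta does not depend on (x, t) explicitly,
    pr^(2)V(Delta_p) = d/de Delta_p(jet + e * prolong) at e = 0. *)
Definition is_symmetry (V : 'rV[R]_(Ndim n) -> 'rV[R]_(Ndim n)) : Prop :=
  forall u : Pidx n -> 'rV[R]_n.+1 -> R,
    (forall p, smooth_on setT (u p)) ->
    forall y : 'rV[R]_n.+1, Dom (zu u y) ->
    (forall p, Delta (jet_of u y) p = 0) ->
    forall p, derive1 (fun e : R => Delta (jet_axpy (jet_of u y) e (prolong V u y)) p) 0 = 0.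

Definition X1 : 'rV[R]_(Ndim n) := ecoord R (tc n).
Definition X2 (z : 'rV[R]_(Ndim n)) : 'rV[R]_(Ndim n) :=
  z 0 (tc n) *: ecoord R (tc n) + \sum_(p : Pidx n) z 0 (gp p) *: ecoord R (gp p).
(** sum over k = 1..n of the fields X_{k+2} built from xi^k = xi_k *)
Definition Xxi (xi : 'rV[R]_n -> 'rV[R]_n) (z : 'rV[R]_(Ndim n)) : 'rV[R]_(Ndim n) :=
  \sum_(k < n) xi (xpart z) 0 k *: ecoord R (xc k)
  - \sum_(p : Pidx n)
      (\sum_(k < n) (z 0 (gc k (pfst p)) * pd (fun x => xi x 0 k) (psnd p) (xpart z)
                   + z 0 (gc k (psnd p)) * pd (fun x => xi x 0 k) (pfst p) (xpart z)))
      *: ecoord R (gp p).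

Definition smooth_xi (xi : 'rV[R]_n -> 'rV[R]_n) : Prop :=
  forall k, smooth_on setT (fun x => xi x 0 k).

End Jets.

(* Main.v *)
Require Import Defs.
From HB Require Import structures.
From mathcomp Require Import all_boot all_order all_algebra.
From mathcomp Require Import all_classical all_reals all_analysis.
From mathcomp Require Import ring lra.
Import Order.TTheory GRing.Theory Num.Theory.
Import numFieldNormedType.Exports.
Local Open Scope ring_scope.
Local Open Scope classical_set_scope.
Set Implicit Arguments. Unset Strict Implicit. Unset Printing Implicit Defensive.

(** Write a symmetry as tau d/dt + xi^k d/dx^k + eta_ij d/dg_ij.  Every 2-jet on
    the locus g_t = -2 Ric is the jet of a quadratic polynomial and is freely
    parametrized by g, the spatial derivatives P = dg and H = ddg, the mixed
    derivatives W and g_tt.  The criterion is affine in W and in H, and its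
    linear parts only involve the part of Ric linear in ddg, whose value on
    H = w (x) w (x) h, contracted twice with a vector v such that w(v) = 0, is
    -|w|^2 h(v,v) / 2.
    - The W-part with W = (D tau) (x) g gives |D tau|^2 = 0, hence tau = tau(t).
    - The H-part with h = w (x) w (which is in the kernel of the symbol at w, as
      an infinitesimal diffeomorphism) shows that xi does not depend on g.
    - For an eigenvector h of the symbol at w, the unknown derivative of eta in
      the direction h cancels, and the H-part at P = 0 determines
      eta = tau' g - L_xi g.
    - For fields of this form the covariance of Ric reduces the criterion to
      tau'' g - L_(xi_t) g = 0, hence xi_t = 0 and tau'' = 0.
    The last reduction also shows that the listed fields are symmetries. *)

(** * Partial derivatives *)

(** The criterion is exploited one jet at a time: [is_symmetry] asks for the equation only at the
    point [y], so polynomials suffice and no solution of the flow has to be constructed. Subtracting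
    the criterion at two jets with the same lower-order data removes every nonlinear term of Ric, so
    the first determining equations only see [principal]. The obstacle is the unknown derivative of
    eta in metric directions, which enters the H-part both before and after the symbol is applied.
    Contracting with v produces the factor $-|w|^2/2$; for an h whose eigenvalue is that same number
    the two occurrences cancel. A nonzero v with w(v) = 0 exists because $n \ge 2$. All coefficients
    are controlled on positive definite metrics only. Openness of this set lets identities between
    coefficients be differentiated; convexity lets the dependence on g be integrated away.
    Covariance is proved infinitesimally, as an identity between a jet of g and formal derivatives
    [M], [M2], [M3] of xi, which avoids any change of variables. *)

Section PointwiseDerivatives.
Context {R : realType} {V : normedModType R}.
Implicit Types (f g : V -> R) (x v : V).

Lemma isd_add f g x v a b : is_derive x v f a -> is_derive x v g b ->
  is_derive x v (fun y => f y + g y) (a + b).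
Proof. by move=> fa gb; exact: (is_deriveD fa gb). Qed.

Lemma isd_sub f g x v a b : is_derive x v f a -> is_derive x v g b ->
  is_derive x v (fun y => f y - g y) (a - b).
Proof. by move=> fa gb; exact: (is_deriveB fa gb). Qed.

Lemma isd_opp f x v a : is_derive x v f a ->
  is_derive x v (fun y => - f y) (- a).
Proof. by move=> fa; exact: (is_deriveN fa). Qed.

Lemma isd_mul f g x v a b : is_derive x v f a -> is_derive x v g b ->
  is_derive x v (fun y => f y * g y) (a * g x + f x * b).
Proof.
move=> fa gb; have := is_deriveM fa gb.
by rewrite /GRing.scale /= addrC [g x * a]mulrC; exact.
Qed.

Lemma isd_cst x v c : is_derive x v (fun _ : V => c : R) 0.
Proof. exact: is_derive_cst. Qed.

Lemma isd_cmul f x v c a : is_derive x v f a ->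
  is_derive x v (fun y => c * f y) (c * a).
Proof.
by move=> fa; have := isd_mul (isd_cst x v c) fa; rewrite mul0r add0r.
Qed.

Lemma isd_sum (I : Type) (r : seq I) (F : I -> V -> R) (D : I -> R) x v :
  (forall i, is_derive x v (F i) (D i)) ->
  is_derive x v (fun y => \sum_(i <- r) F i y) (\sum_(i <- r) D i).
Proof.
move=> FD; elim: r => [|i r IH].
  by under eq_fun do rewrite big_nil; rewrite big_nil; exact: isd_cst.
by under eq_fun do rewrite big_cons; rewrite big_cons; apply: isd_add.
Qed.

Lemma isd_near f g x v a : (\forall y \near x, f y = g y) ->
  is_derive x v f a -> is_derive x v g a.
Proof.
by move=> fg fa; apply: (near_eq_is_derive _ fa).
Qed.

End PointwiseDerivatives.

Section PartialDerivatives.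
Context {R : realType}.

Lemma diff_pd k (f : 'rV[R]_k -> R) (z w : 'rV[R]_k) : differentiable f z ->
  'd f z w = \sum_(c < k) pd f c z * w 0 c.
Proof.
move=> df; rewrite {1}[w]row_sum_delta linear_sum; apply: eq_bigr => c _.
by rewrite linearZ /pd deriveE// mulrC.
Qed.

(** Reduces a directional derivative to an ordinary one, where derivability and differentiability
    coincide. *)
Lemma isd_line (V : normedModType R) (f : V -> R) (x v : V) (a : R) :
  is_derive x v f a <-> is_derive (0 : R) 1 (fun h : R => f (h *: v + x)) a.
Proof.
have E : 'D_v f x = 'D_1 (fun h : R => f (h *: v + x)) 0.
  rewrite /derive; set g1 := fun h => h^-1 *: _; set g2 := fun h => h^-1 *: _.
  suff -> : g1 = g2 by [].
  by rewrite funeqE /g1 /g2 => h /=; rewrite addr0 scale0r add0r [_%:A]mulr1.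
split=> -[d e]; split.
- exact: ((derivable1P f x v).1 d).
- by rewrite -E.
- exact: ((derivable1P f x v).2 d).
- by rewrite E.
Qed.

(** The inner map needs a derivative along the single direction v: restricted to that line it is a
    differentiable curve, and the usual chain rule applies to it. *)
Lemma isd_chain (V : normedModType R) k (f : 'rV[R]_k -> R) (phi : V -> 'rV[R]_k)
  (x v : V) (dphi : 'I_k -> R) :
  differentiable f (phi x) ->
  (forall c, is_derive x v (fun y => phi y 0 c) (dphi c)) ->
  is_derive x v (fun y => f (phi y)) (\sum_(c < k) pd f c (phi x) * dphi c).
Proof.
move=> df dp; apply/isd_line.
pose psi (h : R) := phi (h *: v + x).
have psi0 : psi 0 = phi x by rewrite /psi scale0r add0r.
have dpsi c : is_derive (0 : R) 1 (fun h => psi h 0 c) (dphi c).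
  exact: (isd_line (fun y => phi y 0 c) x v (dphi c)).1.
have ppsi : derivable psi 0 1.
  by apply/derivable_mxP => i c; rewrite (ord1 i); case: (dpsi c).
have dfp : differentiable psi 0 by apply/derivable1_diffP.
have dcomp : differentiable (f \o psi) 0.
  by apply: differentiable_comp => //; rewrite psi0.
apply: (@DeriveDef _ _ _ _ _ (f \o psi)); first exact: diff_derivable.
rewrite deriveE// diff_comp//; last by rewrite psi0.
rewrite /= psi0 diff_pd//; apply: eq_bigr => c _; congr (_ * _).
by rewrite -deriveE// derive_mx// mxE; apply: derive_val.
Qed.

Lemma pd_isd k (f : 'rV[R]_k -> R) i z : differentiable f z ->
  is_derive z (delta_mx 0 i) f (pd f i z).
Proof. by move=> df; apply: derivableP; exact: diff_derivable. Qed.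

Lemma isd_pd k (f : 'rV[R]_k -> R) i z a :
  is_derive z (delta_mx 0 i) f a -> pd f i z = a.
Proof. by move=> fa; rewrite /pd derive_val. Qed.

Lemma pd_near k (f g : 'rV[R]_k -> R) i z :
  (\forall y \near z, f y = g y) -> pd f i z = pd g i z.
Proof. exact: near_eq_derive. Qed.

Lemma smooth_pd k (D : set 'rV[R]_k) (f : 'rV[R]_k -> R) i :
  smooth_on D f -> smooth_on D (pd f i).
Proof. by move=> fs s z Dz; have := fs (rcons s i) z Dz; rewrite /pds foldr_rcons. Qed.

Lemma smooth_diff k (D : set 'rV[R]_k) (f : 'rV[R]_k -> R) z :
  smooth_on D f -> D z -> differentiable f z.
Proof. by move=> fs Dz; exact: (fs [::] z Dz). Qed.

Lemma isd_coord k (i c : 'I_k) (z : 'rV[R]_k) :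
  is_derive z (delta_mx 0 i) (fun y : 'rV[R]_k => y 0 c) (c == i)%:R.
Proof.
apply/isd_line.
rewrite (_ : (fun h => _) = fun h => h * (c == i)%:R + z 0 c); last first.
  by apply/funext => h; rewrite !mxE eqxx.
have := isd_add (isd_mul (is_derive_id (0 : R) (1 : R))
  (isd_cst (0 : R) 1 (c == i)%:R)) (isd_cst (0 : R) 1 (z 0 c)).
by rewrite mulr0 !addr0 mul1r.
Qed.

End PartialDerivatives.

(** * Symmetry of second derivatives *)

Section Schwarz.
Context {R : realType} {V : normedModType R}.

Lemma isd_along (f : V -> R) (x v : V) (s a : R) :
  is_derive (s *: v + x) v f a -> is_derive s 1 (fun h : R => f (h *: v + x)) a.
Proof.
move=> /isd_line fa; apply/isd_line.
by under eq_fun do rewrite [_%:A]mulr1 scalerDl -addrA.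
Qed.

(** The second difference over the parallelogram spanned by ha and hb equals $h^2\, dA(b)$ up to
    $o(h^2)$: the mean value theorem in the direction a replaces it by a first difference of [A],
    which is then linearized at y. *)
Lemma schwarz_half (f A : V -> R) (y a b : V) :
  (forall x, is_derive x a f (A x)) -> differentiable A y ->
  forall e, 0 < e -> exists2 d, 0 < d & forall h, 0 < h < d ->
    `|f (h *: a + (h *: b + y)) - f (h *: a + y) - f (h *: b + y) + f y
      - h * h * 'd A y b| <= e * (h * h).
Proof.
move=> fA dA e e0.
(* [h * C] bounds both increments at which [A] is evaluated; with the tolerance [e / (2 * C)] each
   of the two remainders is at most [e * h / 2]. *)
pose C := `|a| + `|b| + 1.
have C0 : 0 < C by rewrite ltr_wpDl// addr_ge0.
have e'0 : 0 < e / (2 * C) by rewrite divr_gt0// mulr_gt0.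
have /eqaddoP/(_ _ e'0) := diff_locally dA.
move=> /nbhs_normP[d /= d0 dP].
have rem w : `|w| < d -> `|A (w + y) - A y - 'd A y w| <= e / (2 * C) * `|w|.
  move=> wd; have := dP w; rewrite /ball_/= sub0r normrN => /(_ wd).
  by rewrite /cst /= opprD addrA.
exists (d / C); first by rewrite divr_gt0.
move=> h /andP[h0 hd].
have hC : h * C < d by rewrite -ltr_pdivlMr.
pose phi (s : R) := f (s *: a + (h *: b + y)) - f (s *: a + y).
have dphi (s : R) : is_derive s 1 phi (A (s *: a + (h *: b + y)) - A (s *: a + y)).
  by apply: isd_sub; apply: isd_along.
have cphi : {within `[0, h], continuous phi}.
  by apply: derivable_within_continuous => s _; case: (dphi s).
have [c] := MVT h0 (fun s _ => dphi s) cphi.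
rewrite in_itv /= => /andP[c0 ch] E.
have -> : f (h *: a + (h *: b + y)) - f (h *: a + y) - f (h *: b + y) + f y
    = phi h - phi 0 by rewrite /phi !scale0r !add0r opprB; ring.
rewrite E subr0.
have n1 : `|c *: a + h *: b| <= h * C.
  rewrite (le_trans (ler_normD _ _))// !normrZ !gtr0_norm// /C.
  have := normr_ge0 a; have := normr_ge0 b; nra.
have n2 : `|c *: a| <= h * C.
  rewrite normrZ gtr0_norm// /C.
  have := normr_ge0 a; have := normr_ge0 b; nra.
have /ler_normlP[r1 r1'] := rem _ (le_lt_trans n1 hC).
have /ler_normlP[r2 r2'] := rem _ (le_lt_trans n2 hC).
have L : 'd A y (c *: a + h *: b) = 'd A y (c *: a) + h * 'd A y b.
  by rewrite linearD [in X in _ + X]linearZ.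
rewrite addrA; move: r1 r1' r2 r2'; rewrite L.
set A1 := A (c *: a + h *: b + y); set A2 := A (c *: a + y).
move: n1 n2.
set m1 := `|_ + _|; set m2 := `|_ *: _|.
have E2 : e / (2 * C) * (h * C) = e * h / 2 by field; rewrite gt_eqF.
have k0 : 0 <= e / (2 * C) by rewrite ltW.
move=> /(ler_wpM2l k0) n1 /(ler_wpM2l k0) n2; rewrite !E2 in n1 n2.
move=> r1 r1' r2 r2'.
have -> : (A1 - A2) * h - h * h * 'd A y b = (A1 - A2 - h * 'd A y b) * h by ring.
rewrite normrM (gtr0_norm h0) mulrA ler_wpM2r ?(ltW h0)//.
by rewrite ler_norml; apply/andP; split; lra.
Qed.

Lemma schwarz (f A B : V -> R) (y a b : V) :
  (forall x, is_derive x a f (A x)) -> (forall x, is_derive x b f (B x)) ->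
  differentiable A y -> differentiable B y -> 'd A y b = 'd B y a.
Proof.
move=> fA fB dA dB; apply/eqP; rewrite -subr_eq0 -normr_le0.
apply/ler_addgt0Pl => e e0; rewrite addr0.
have e2 : 0 < e / 2 by rewrite divr_gt0.
have [d d0 dP] := schwarz_half b fA dA e2.
have [d' d'0 dP'] := schwarz_half a fB dB e2.
pose h := Num.min d d' / 2.
have m0 : 0 < Num.min d d' by rewrite lt_min d0.
have h0 : 0 < h by rewrite divr_gt0.
have [md md'] : h < d /\ h < d'.
  have : Num.min d d' <= d by rewrite ge_min lexx.
  have : Num.min d d' <= d' by rewrite ge_min lexx orbT.
  by rewrite /h; move: m0; set m := Num.min d d'; split; lra.
have := dP h; rewrite h0 md => /(_ isT) /ler_normlP[].
have := dP' h; rewrite h0 md' => /(_ isT) /ler_normlP[].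
(* The second difference is symmetric in a and b, so both mixed derivatives approximate the same
   number. *)
rewrite (addrCA (h *: b)) => r1 r2 r3 r4.
have hh : 0 < h * h by rewrite mulr_gt0.
rewrite -(ler_pM2r hh) -[X in _ * X <= _]gtr0_norm// -normrM.
rewrite ler_norml; apply/andP; split; lra.
Qed.

End Schwarz.

Section SmoothFunctions.
Context {R : realType}.

(** [smooth_on] only records that iterated partial derivatives are differentiable; that they commute
    comes from [schwarz]. *)
Lemma pdC k (f : 'rV[R]_k -> R) i j z : smooth_on setT f ->
  pd (pd f i) j z = pd (pd f j) i z.
Proof.
move=> fs.
have D s x : differentiable (pds s f) x by exact: fs.
rewrite /pd !deriveE; try exact: (D [:: _]).
by apply: (@schwarz _ _ f) => [x|x||]; [apply: pd_isd; exact: (D [::])..|exact: (D [:: i])|exact: (D [:: j])].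
Qed.

(** Differentiability is required on the segment only, so the lemma also applies to coefficients
    that are smooth just on the convex set [Dom]. *)
Lemma eq_on_segment k (f : 'rV[R]_k -> R) (z z' : 'rV[R]_k) :
  (forall s : R, 0 <= s <= 1 -> differentiable f (s *: (z' - z) + z)) ->
  (forall s : R, 0 <= s <= 1 ->
     \sum_c pd f c (s *: (z' - z) + z) * (z' - z) 0 c = 0) ->
  f z' = f z.
Proof.
move=> df zero.
have D (s : R) : 0 <= s <= 1 ->
    is_derive s 1 (fun h : R => f (h *: (z' - z) + z)) 0.
  move=> s01; apply: isd_along; rewrite -(zero s s01) -diff_pd; last exact: df.
  by rewrite -deriveE; [apply: derivableP; apply: diff_derivable|]; exact: df.
have cf : {within `[0, 1], continuous (fun h : R => f (h *: (z' - z) + z))}.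
  by apply: derivable_within_continuous => s; rewrite in_itv /= => /D[].
have D' (s : R) : s \in `]0, 1[%R -> is_derive s 1 (fun h : R => f (h *: (z' - z) + z)) 0.
  by rewrite in_itv /= => /andP[s0 s1]; apply: D; rewrite !ltW.
have [c _] := MVT ltr01 D' cf.
by rewrite mul0r scale1r scale0r add0r subrK => /eqP; rewrite subr_eq0 => /eqP.
Qed.

End SmoothFunctions.

(** * Metric coordinates *)

Section Metrics.
Context {R : realType} {n : nat}.
Implicit Types (z : 'rV[R]_(Ndim n)) (i j k : 'I_n) (p : Pidx n).

Lemma pidxC i j : pidx i j = pidx j i.
Proof.
apply: val_inj; rewrite /=.
by case: (ltngtP i j) => // /val_inj ->.
Qed.

Lemma pidxK p : pidx (pfst p) (psnd p) = p.
Proof.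
by apply: val_inj; case: p => -[i j] /= h; rewrite /pfst /psnd /= h.
Qed.

Lemma pidx_sym (T : Type) (S : 'I_n -> 'I_n -> T) i j :
  (forall k l, S k l = S l k) ->
  S (pfst (pidx i j)) (psnd (pidx i j)) = S i j.
Proof. by move=> SC; rewrite /pfst /psnd /=; case: ifP => _ //=. Qed.

Lemma sum_gp (F : 'I_(Ndim n) -> R) :
  \sum_(c < Ndim n) F c
  = \sum_(a < n.+1) F (lshift _ a) + \sum_(p : Pidx n) F (gp p).
Proof.
rewrite big_split_ord /=; congr (_ + _).
by rewrite (reindex enum_rank) //=; exists enum_val => ? _; rewrite ?enum_rankK ?enum_valK.
Qed.

Definition qf (A : 'M[R]_n) (v : 'rV[R]_n) : R :=
  \sum_i \sum_j v 0 i * A i j * v 0 j.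

Lemma qfE A v : (v *m A *m v^T) 0 0 = qf A v.
Proof.
rewrite mxE /qf exchange_big; apply: eq_bigr => j _.
by rewrite !mxE big_distrl.
Qed.

Lemma DomP z : Dom z <-> forall v : 'rV[R]_n, v != 0 -> 0 < qf (gmat z) v.
Proof. by split=> H v v0; [rewrite -qfE; exact: H|rewrite qfE; exact: H]. Qed.

Lemma gmatE z i j : gmat z i j = z 0 (gp (pidx i j)).
Proof. by rewrite mxE. Qed.

Lemma qfZ A c v : qf A (c *: v) = c ^+ 2 * qf A v.
Proof.
rewrite /qf mulr_sumr; apply: eq_bigr => i _; rewrite mulr_sumr.
by apply: eq_bigr => j _; rewrite !mxE; ring.
Qed.

Lemma qf_axpy A B c v : qf (A + c *: B) v = qf A v + c * qf B v.
Proof.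
rewrite /qf mulr_sumr -big_split; apply: eq_bigr => i _.
rewrite mulr_sumr -big_split; apply: eq_bigr => j _.
by rewrite !mxE /=; ring.
Qed.

Lemma gmat_axpy z z' (c : R) : gmat (z + c *: z') = gmat z + c *: gmat z'.
Proof. by apply/matrixP => i j; rewrite !mxE. Qed.

(** Allows every metric to be joined to the Euclidean one inside [Dom] when the dependence on g is
    eliminated. *)
Lemma Dom_convex z z' (s : R) : Dom z -> Dom z' -> 0 <= s <= 1 ->
  Dom (s *: (z' - z) + z).
Proof.
move=> /DomP Dz /DomP Dz' /andP[s0 s1]; apply/DomP => v v0.
have -> : s *: (z' - z) + z = (1 - s) *: z + s *: z'.
  by apply/rowP => i; rewrite !mxE; ring.
rewrite gmat_axpy qf_axpy.
have -> : gmat ((1 - s) *: z) = 0 + (1 - s) *: gmat z.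
  by apply/matrixP => i j; rewrite !mxE add0r.
rewrite qf_axpy.
have -> : qf 0 v = 0.
  by rewrite /qf big1// => i _; rewrite big1// => j _; rewrite !mxE mulr0 mul0r.
by have := Dz v v0; have := Dz' v v0; nra.
Qed.

Lemma qf_continuous A : continuous (qf A : 'rV[R]_n -> R).
Proof.
move=> v; apply: differentiable_continuous; rewrite /qf.
have -> : (fun v : 'rV[R]_n => \sum_i \sum_j v 0 i * A i j * v 0 j) =
    \sum_i (fun v : 'rV[R]_n => \sum_j v 0 i * A i j * v 0 j).
  by apply/funext => w; rewrite fct_sumE.
apply: differentiable_sum => i.
have -> : (fun v : 'rV[R]_n => \sum_j v 0 i * A i j * v 0 j) =
    \sum_j (fun v : 'rV[R]_n => v 0 i * A i j * v 0 j).
  by apply/funext => w; rewrite fct_sumE.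
apply: differentiable_sum => j.
apply: differentiableM; last exact: differentiable_coord.
apply: differentiableM; first exact: differentiable_coord.
exact: differentiable_cst.
Qed.

Lemma coord_le_norm m (v : 'rV[R]_m) (i : 'I_m) : `|v 0 i| <= `|v|.
Proof.
rewrite [leRHS]/Num.Def.normr/= mx_normrE.
exact: (le_bigmax _ (fun ij => `|v ij.1 ij.2|) (0, i)).
Qed.

(** The quadratic form of z has a positive minimum m on the compact unit sphere, and a perturbation
    of size d changes it there by at most $n^2 d$. *)
Lemma Dom_open z : Dom z -> \forall z' \near z, Dom z'.
Proof.
move=> /DomP Dz.
pose S := [set v : 'rV[R]_n | `|v| = 1].
have DS z' : (forall v, S v -> 0 < qf (gmat z') v) -> Dom z'.
  move=> H; apply/DomP => v v0.
  have nv : 0 < `|v| by rewrite normr_gt0.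
  have -> : v = `|v| *: (`|v|^-1 *: v) by rewrite scalerA divff ?scale1r ?gt_eqF.
  rewrite qfZ mulr_gt0 ?exprn_gt0//; apply: H.
  by rewrite /S /= normrZ normfV normr_id mulVf ?gt_eqF.
have [S0|S0] := pselect (S !=set0); last first.
  (* An empty unit sphere leaves nothing to check. *)
  by near=> z'; apply: DS => v Sv; case: S0; exists v.
have cS : compact S.
  apply: bounded_closed_compact.
    exists 1; split; first by rewrite num_real.
    by move=> x x1 v /= ->; rewrite ltW.
  have /continuous_closedP/(_ [set 1]) := @norm_continuous _ 'rV[R]_n.
  by apply; exact: closed_eq.
have [c cS' cmin] := EVT_min_rV S0 cS (continuous_subspaceT (@qf_continuous (gmat z))).
rewrite inE in cS'.
have m0 : 0 < qf (gmat z) c.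
  by apply: Dz; rewrite -normr_gt0 cS'.
set m := qf _ _ in m0 cmin.
(* Chosen so that $n^2 e < m$; the added 1 keeps the denominator positive. *)
pose e := m / (n%:R * n%:R + 1).
have nn : 0 < n%:R * n%:R + 1 :> R by rewrite ltr_wpDl// mulr_ge0.
have e0 : 0 < e by rewrite divr_gt0.
near=> z'; apply: DS => v Sv.
have zz : `|z - z'| < e by near: z'; exact: cvgr_dist_lt.
have -> : gmat z' = gmat z + (- 1) *: gmat (z - z').
  by rewrite -gmat_axpy; congr gmat; apply/rowP => i; rewrite !mxE; ring.
rewrite qf_axpy mulN1r subr_gt0.
apply: (@lt_le_trans _ _ m); last by apply: cmin; rewrite inE.
apply: (@le_lt_trans _ _ (n%:R * n%:R * `|z - z'|)).
  apply: le_trans (ler_norm _) _.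
  have -> : n%:R * n%:R * `|z - z'| = \sum_(i < n) \sum_(j < n) `|z - z'|.
    by rewrite !sumr_const card_ord -mulrA !mulr_natl.
  apply: le_trans (ler_norm_sum _ _ _) _; apply: ler_sum => i _.
  apply: le_trans (ler_norm_sum _ _ _) _; apply: ler_sum => j _.
  rewrite !normrM mxE.
  have Sv1 : `|v| = 1 := Sv.
  have v1 k : `|v 0 k| <= 1 by have := coord_le_norm v k; rewrite Sv1.
  rewrite -[leRHS]mul1r -[leRHS]mulr1.
  by apply: ler_pM; rewrite ?mulr_ge0//; apply: ler_pM => //; exact: coord_le_norm.
have : `|z - z'| * (n%:R * n%:R + 1) < m by rewrite -ltr_pdivlMr.
by have := normr_ge0 (z - z'); set w := `|_|; nra.
Unshelve. all: by end_near. Qed.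

Lemma Dom_unit z : Dom z -> gmat z \in unitmx.
Proof.
move=> /DomP Dz; rewrite -row_free_unit -kermx_eq0; apply/rowV0P => v /sub_kermxP vz.
apply/eqP; apply/negP => /negP /Dz; rewrite -qfE vz mul0mx mxE ltxx.
by [].
Qed.

Lemma gmat_sym z : (gmat z)^T = gmat z.
Proof. by apply/matrixP => i j; rewrite !mxE /gc pidxC. Qed.

End Metrics.

(** * Prolongation *)

Section Quadratics.
Context {R : realType} {m : nat} (y0 : 'rV[R]_m).

Lemma differentiable_sumf (V : normedModType R) k (F : 'I_k -> V -> R) x :
  (forall i, differentiable (F i) x) ->
  differentiable (fun y => \sum_(i < k) F i y) x.
Proof.
move=> dF; rewrite (_ : (fun y => _) = \sum_(i < k) F i).
  exact: differentiable_sum.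
by apply/funext => y; rewrite fct_sumE.
Qed.

(** Taylor polynomial at [y0] with value a, gradient b and Hessian c. The family is stable under
    partial derivatives, which is what makes smoothness provable by induction. *)
Definition quad (a : R) (b : 'I_m -> R) (c : 'I_m -> 'I_m -> R)
    (y : 'rV[R]_m) : R :=
  a + \sum_i b i * (y 0 i - y0 0 i)
    + 2^-1 * \sum_i \sum_j c i j * ((y 0 i - y0 0 i) * (y 0 j - y0 0 j)).

Lemma quad_differentiable a b c y : differentiable (quad a b c) y.
Proof.
have dc i : differentiable (fun y : 'rV[R]_m => y 0 i - y0 0 i) y.
  apply: differentiableB; first exact: differentiable_coord.
  exact: differentiable_cst.
apply: differentiableD.
  apply: differentiableD; first exact: differentiable_cst.
  by apply: differentiable_sumf => i; apply: differentiableM.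
apply: differentiableM; first exact: differentiable_cst.
apply: differentiable_sumf => i; apply: differentiable_sumf => j.
by apply: differentiableM => //; apply: differentiableM.
Qed.

Lemma pd_quad a b c i : (forall i j, c i j = c j i) ->
  pd (quad a b c) i = quad (b i) (c i) (fun _ _ => 0).
Proof.
move=> cC; apply/funext => y; apply: isd_pd.
have dc j : is_derive y (delta_mx 0 i) (fun y : 'rV[R]_m => y 0 j - y0 0 j)
    ((j == i)%:R - 0).
  exact: (isd_sub (isd_coord i j y) (isd_cst y (delta_mx 0 i) (y0 0 j))).
have := isd_add (isd_add (isd_cst y (delta_mx 0 i) a)
   (isd_sum (index_enum _) (fun j => isd_cmul (b j) (dc j))))
   (isd_cmul 2^-1 (isd_sum (index_enum _) (fun j => isd_sum (index_enum _)
      (fun k => isd_cmul (c j k) (isd_mul (dc j) (dc k)))))).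
set d := (X in is_derive _ _ _ X -> _) => D.
suff <- : d = quad (b i) (c i) (fun _ _ => 0) y by exact: D.
rewrite /d /quad add0r.
have -> : \sum_j \sum_k 0 * ((y 0 j - y0 0 j) * (y 0 k - y0 0 k)) = 0.
  by rewrite big1// => j _; rewrite big1// => k _; rewrite mul0r.
rewrite mulr0 addr0; congr (_ + _).
  rewrite (bigD1 i) //= eqxx subr0 mulr1 big1 ?addr0 // => j /negbTE ->.
  by rewrite subr0 mulr0.
under eq_bigr => j _ do under eq_bigr => k _ do rewrite !subr0 mulrDr.
under eq_bigr => j _ do rewrite big_split.
rewrite big_split /= (bigD1 i) //= [X in _ + X + _]big1 ?addr0; last first.
  by move=> j /negbTE ->; rewrite big1// => k _; rewrite mul0r mulr0.
rewrite [X in _ + X]exchange_big /= [X in _ + X](bigD1 i) //=.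
rewrite [X in _ + (_ + X)]big1 ?addr0; last first.
  by move=> j /negbTE ->; rewrite big1// => k _; rewrite !mulr0.
rewrite eqxx -big_split mulr_sumr; apply: eq_bigr => j _ /=.
by rewrite (cC j i) mul1r mulr1; field.
Qed.

Lemma quad_smooth a b c : (forall i j, c i j = c j i) ->
  smooth_on setT (quad a b c).
Proof.
move=> cC s y _; suff [a' [b' [c' [_ ->]]]] : exists a' b' c',
  (forall i j, c' i j = c' j i) /\ pds s (quad a b c) = quad a' b' c'.
  exact: quad_differentiable.
elim: s => [|i s [a' [b' [c' [c'C E]]]]] /=; first by exists a, b, c.
rewrite E pd_quad//.
by exists (b' i), (c' i), (fun _ _ => 0).
Qed.

Lemma quad_at a b c : quad a b c y0 = a.
Proof.
rewrite /quad !big1 ?mulr0 ?addr0 // => i _; last by rewrite subrr mulr0.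
by rewrite big1// => j _; rewrite subrr mul0r mulr0.
Qed.

End Quadratics.

(** * Total derivatives along the graph of u *)

Section TotalDerivatives.
Context {R : realType} {n : nat}.
Implicit Types (u : Pidx n -> 'rV[R]_n.+1 -> R) (y : 'rV[R]_n.+1).

Lemma zu_ind u y a : zu u y 0 (lshift _ a) = y 0 a.
Proof. by rewrite /zu row_mxEl. Qed.

Lemma zu_gp u y p : zu u y 0 (gp p) = u p y.
Proof. by rewrite /zu /gp row_mxEr mxE enum_rankK. Qed.

Lemma Ndim_ind (P : 'I_(Ndim n) -> Prop) :
  (forall a, P (lshift _ a)) -> (forall p, P (gp p)) -> forall c, P c.
Proof.
move=> Pl Pr c; rewrite -(@splitK n.+1 (mdim n) c).
case: (@fintype.split n.+1 (mdim n) c) => [a|q] /=; first exact: Pl.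
by have := Pr (enum_val q); rewrite /gp enum_valK.
Qed.

(** The value is the total derivative $D_a f$ of the jet calculus. *)
Lemma isd_zu (f : 'rV[R]_(Ndim n) -> R) u y a :
  differentiable f (zu u y) -> (forall p, differentiable (u p) y) ->
  is_derive y (delta_mx 0 a) (fun y => f (zu u y))
   (pd f (lshift _ a) (zu u y)
     + \sum_(p : Pidx n) pd f (gp p) (zu u y) * pd (u p) a y).
Proof.
move=> df du.
have Dl b : is_derive y (delta_mx 0 a) (fun y => zu u y 0 (lshift _ b)) (b == a)%:R.
  by under eq_fun do rewrite zu_ind; exact: isd_coord.
have Dr p : is_derive y (delta_mx 0 a) (fun y => zu u y 0 (gp p)) (pd (u p) a y).
  by under eq_fun do rewrite zu_gp; exact: pd_isd.
have := @isd_chain R _ _ f (zu u) y (delta_mx 0 a)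
  (fun c => derive (fun y => zu u y 0 c) y (delta_mx 0 a)) df.
move=> D; apply: is_derive_eq.
  by apply: D; apply: Ndim_ind => [b|p]; [case: (Dl b)|case: (Dr p)] => ? ?; exact: derivableP.
rewrite sum_gp; congr (_ + _).
  rewrite (bigD1 a) //= big1; last first.
    by move=> b /negbTE ba; rewrite (@derive_val _ _ _ _ _ _ _ (Dl b)) ba mulr0.
  by rewrite (@derive_val _ _ _ _ _ _ _ (Dl a)) eqxx mulr1 addr0.
by apply: eq_bigr => p _; rewrite (@derive_val _ _ _ _ _ _ _ (Dr p)).
Qed.

(** Positivity persists near y, so formulas for the field that hold only on [Dom] can be
    differentiated along the graph. *)
Lemma zu_Dom_near u y : (forall p, differentiable (u p) y) -> Dom (zu u y) ->
  \forall y' \near y, Dom (zu u y').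
Proof.
move=> du /Dom_open /nbhs_normP[e /= e0 eP].
have cc c : {for y, continuous (fun y => zu u y 0 c)}.
  apply: differentiable_continuous; move: c; apply: Ndim_ind => [b|p].
    by under eq_fun do rewrite zu_ind; exact: differentiable_coord.
  by under eq_fun do rewrite zu_gp; exact: du.
have cN c : \forall y' \near y, `|zu u y 0 c - zu u y' 0 c| < e.
  by move/cvgrPdist_lt : (cc c) => /(_ e e0).
have N := @filter_forall _ 'I_(Ndim n)
  (fun c y' => `|zu u y 0 c - zu u y' 0 c| < e) (nbhs y) (nbhs_filter y) cN.
apply: (@filterS _ _ (nbhs_filter y) _ _ _ N) => y' H; apply: eP; rewrite /ball_ /=.
rewrite [ltLHS]/Num.Def.normr/= mx_normrE; apply/bigmax_ltP; split=> //= -[i c] _.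
by have := H c; rewrite (ord1 i) /= !mxE.
Qed.

End TotalDerivatives.

(** * Prolongation coefficients from derivatives of the components *)

Section Prolongation.
Context {R : realType} {n : nat}.
Variables (V : 'rV[R]_(Ndim n) -> 'rV[R]_(Ndim n)) (u : Pidx n -> 'rV[R]_n.+1 -> R).
Variable (y : 'rV[R]_n.+1).
Hypothesis us : forall p, smooth_on setT (u p).
Variables (dX : 'I_n.+1 -> 'I_n.+1 -> 'rV[R]_n.+1 -> R)
          (ddX : 'I_n.+1 -> 'I_n.+1 -> 'I_n.+1 -> R)
          (dE : Pidx n -> 'I_n.+1 -> 'rV[R]_n.+1 -> R)
          (ddE : Pidx n -> 'I_n.+1 -> 'I_n.+1 -> R).
Hypothesis XdX : forall i b,
  \forall y' \near y, is_derive y' (delta_mx 0 b) (Vind V u i) (dX i b y').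
Hypothesis dXddX : forall i a b, is_derive y (delta_mx 0 a) (dX i b) (ddX i a b).
Hypothesis EdE : forall p b,
  \forall y' \near y, is_derive y' (delta_mx 0 b) (Veta V u p) (dE p b y').
Hypothesis dEddE : forall p a b, is_derive y (delta_mx 0 a) (dE p b) (ddE p a b).

Let udiff p s y' : differentiable (pds s (u p)) y'.
Proof. exact: us. Qed.

Lemma isd_Qc p b : \forall y' \near y, is_derive y' (delta_mx 0 b) (Qc V u p)
  (dE p b y' - \sum_i (dX i b y' * pd (u p) i y'
                       + Vind V u i y' * pd (pd (u p) i) b y')).
Proof.
have N := @filter_forall _ 'I_n.+1 (fun i y' => is_derive y' (delta_mx 0 b)
  (Vind V u i) (dX i b y')) (nbhs y) (nbhs_filter y) (fun i => XdX i b).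
apply: (@filterS2 _ _ (nbhs_filter y) _ _ _ _ (EdE p b) N) => y' De Dx.
apply: isd_sub => //; apply: isd_sum => i; apply: isd_mul => //.
by apply: pd_isd; exact: (udiff p [:: i]).
Qed.

(** The second derivatives of u produced by differentiating the characteristic cancel, by Schwarz,
    against the transport term of [phi1]. *)
Lemma prolong_j1 a p : j1 (prolong V u y) a p =
  dE p a y - \sum_i dX i a y * j1 (jet_of u y) i p.
Proof.
rewrite /= /phi1 (isd_pd (nbhs_singleton (isd_Qc p a))).
rewrite big_split /= opprD -!addrA; congr (_ + _).
rewrite -[RHS]addr0; congr (_ + _).
apply/eqP; rewrite addrC subr_eq0; apply/eqP; apply: eq_bigr => i _.
by rewrite pdC.
Qed.

Lemma prolong_j2 a b p : j2 (prolong V u y) a b p =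
  ddE p a b - \sum_i (ddX i a b * j1 (jet_of u y) i p
     + dX i b y * j2 (jet_of u y) a i p + dX i a y * j2 (jet_of u y) b i p).
Proof.
rewrite /= /phi2.
have -> : pd (pd (Qc V u p) b) a y = pd (fun y' => dE p b y' -
   \sum_i (dX i b y' * pd (u p) i y' + Vind V u i y' * pd (pd (u p) i) b y')) a y.
  by apply: pd_near; apply: filterS (isd_Qc p b) => y' D; rewrite (isd_pd D).
have D i : is_derive y (delta_mx 0 a)
   (fun y' => dX i b y' * pd (u p) i y' + Vind V u i y' * pd (pd (u p) i) b y')
   ((ddX i a b * pd (u p) i y + dX i b y * pd (pd (u p) i) a y) +
    (dX i a y * pd (pd (u p) i) b y + Vind V u i y * pd (pd (pd (u p) i) b) a y)).
  apply: isd_add; apply: isd_mul => //.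
  - by apply: pd_isd; exact: (udiff p [:: i]).
  - exact: nbhs_singleton (XdX i a).
  - by apply: pd_isd; exact: (udiff p [:: b; i]).
rewrite (isd_pd (isd_sub (dEddE p a b) (isd_sum (index_enum _) D))).
rewrite -!addrA; congr (_ + _); rewrite -!sumrN -big_split.
apply: eq_bigr => i _; rewrite [LHS]/=.
have e1 := @pdC R _ (pd (u p) b) a i y (smooth_pd b (us p)).
have e2 : pd (pd (u p) b) i = pd (pd (u p) i) b.
  by apply/funext => y'; exact: (@pdC R _ (u p) b i y' (us p)).
rewrite e2 in e1.
move: e1; generalize (pd (pd (pd (u p) b) a) i y) => x1 ->.
generalize (pd (pd (pd (u p) i) b) a y) (pd (pd (u p) i) a y) (pd (pd (u p) i) b y)
  (pd (u p) i y) => x2 x3 x4 x5.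
by clear; ring.
Qed.

End Prolongation.

(** * Variation and covariance of the Ricci tensor *)

Section InverseDerivative.
Context {R : realType}.

Lemma det_axpy m (A B : 'M[R]_m) : exists p : {poly R},
  forall e, \det (A + e *: B) = p.[e].
Proof.
exists (\det (map_mx polyC A + 'X *: map_mx polyC B)) => e.
rewrite -[RHS]/(horner_eval e _) -det_map_mx; congr (\det _).
by apply/matrixP => i j; rewrite !mxE /= /horner_eval !hornerE.
Qed.

Lemma isd_invmx m (A B : 'M[R]_m) i j : A \in unitmx ->
  is_derive (0 : R) 1 (fun e : R => invmx (A + e *: B) i j)
    (- (invmx A *m B *m invmx A) i j).
Proof.
move=> Au.
have [p pE] := det_axpy A B.
have p0 : p.[0] != 0.
  by rewrite -pE scale0r addr0 -unitfE -unitmxE.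
have un : \forall e \near (0 : R), A + e *: B \in unitmx.
  have cp : {for (0 : R), continuous (horner p)} by exact: continuous_horner.
  have H := @cvgr_neq0 _ _ _ _ (nbhs_filter (0 : R)) _ _ cp p0.
  apply: (@filterS _ _ (nbhs_filter (0 : R)) _ _ _ H) => e.
  by rewrite unitmxE unitfE pE.
(* Cramer's rule: near e = 0 the entry is a cofactor over the determinant, a quotient of polynomials
   in e. *)
have der k l : derivable (fun e : R => invmx (A + e *: B) k l) 0 1.
  have [q qE] := det_axpy (row' l (col' k A)) (row' l (col' k B)).
  have : derivable (fun e : R => (p.[e])^-1 * ((-1) ^+ (l + k) * q.[e])) 0 1.
    apply: (@derivableM _ _ (fun e => (p.[e])^-1) (fun e => (-1) ^+ (l + k) * q.[e])).
      by apply: derivableV => //; exact: derivable_horner.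
    apply: (@derivableM _ _ (cst ((-1) ^+ (l + k))) (horner q)); first exact: derivable_cst.
    exact: derivable_horner.
  apply: near_eq_derivable; apply: filterS un => e eu.
  rewrite /invmx eu mxE pE mxE /cofactor -qE; congr (_ * (_ * \det _)).
  by apply/matrixP => i' j'; rewrite !mxE.
pose D k l := 'D_1 (fun e : R => invmx (A + e *: B) k l) 0.
have isD k l : is_derive (0 : R) 1 (fun e : R => invmx (A + e *: B) k l) (D k l).
  exact: derivableP.
suff -> : - (invmx A *m B *m invmx A) i j = D i j by exact: isD.
pose DM := \matrix_(k, l) D k l.
(* Obtained by differentiating $(A+eB)(A+eB)^{-1} = 1$ at e = 0; solving for [DM] gives the
   formula. *)
have E : B *m invmx A + A *m DM = 0.
  apply/matrixP => k l.
  have isA s : is_derive (0 : R) 1 (fun e : R => (A + e *: B) k s) (B k s).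
    have := isd_add (isd_cst (0 : R) 1 (A k s))
      (isd_mul (is_derive_id (0 : R) (1 : R)) (isd_cst (0 : R) 1 (B k s))).
    rewrite mulr0 addr0 add0r mul1r.
    rewrite (_ : (fun e => A k s + id e * B k s) = fun e => (A + e *: B) k s) //.
    by apply/funext => e; rewrite !mxE.
  have H := isd_sum (index_enum _) (fun s => isd_mul (isA s) (isD s l)).
  have H1 : is_derive (0 : R) 1
      (fun e : R => \sum_(s < m) (A + e *: B) k s * invmx (A + e *: B) s l) 0.
    apply: (isd_near _ (isd_cst (0 : R) 1 ((1%:M : 'M[R]_m) k l))).
    by apply: filterS un => e eu; rewrite -(mulmxV eu) mxE.
  have := @derive_val _ _ _ _ _ _ _ H; rewrite (@derive_val _ _ _ _ _ _ _ H1) => /esym.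
  rewrite scale0r addr0 big_split /= => E; rewrite !mxE -[RHS]E.
  by congr (_ + _); apply: eq_bigr => s _; rewrite !mxE.
have /(congr1 (mulmx (invmx A))) := E.
rewrite mulmxDr mulKmx// mulmx0 mulmxA => /eqP; rewrite addrC addr_eq0 => /eqP DE.
by have := congr1 (fun M : 'M[R]_m => M i j) DE; rewrite /DM !mxE => ->.
Qed.

End InverseDerivative.

Section RicciDerivative.
Context {R : realType} {n : nat}.
Implicit Types (J K : jet R n) (a b i j k l : 'I_n).

Lemma jet_axpy0 J K : jet_axpy J 0 K = J.
Proof.
case: J => a b c; rewrite /jet_axpy /=.
by congr Jet; do 1?[apply/funext => p]; rewrite ?mul0r ?addr0 //;
  apply/funext => q; rewrite ?mul0r ?addr0 //; apply/funext => r;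
  rewrite mul0r addr0.
Qed.

Definition gmx J : 'M[R]_n := \matrix_(i, j) gJ J i j.
Definition dgmx J a : 'M[R]_n := \matrix_(i, j) dg J a i j.

(* [chr] is twice the Christoffel symbol of the first kind. *)
Definition chr J i j l := dg J i j l + dg J j i l - dg J l i j.
Definition dchr J a i j l := ddg J a i j l + ddg J a j i l - ddg J a l i j.

Lemma dgiE J a k l : dgi J a k l = (- (giJ J *m dgmx J a *m giJ J)) k l.
Proof.
rewrite /dgi !mxE; congr (- _).
under [RHS]eq_bigr => c _ do rewrite !mxE big_distrl.
rewrite exchange_big; apply: eq_bigr => b _; apply: eq_bigr => c _.
by rewrite !mxE.
Qed.

Section Direction.
Variables (J K : jet R n).
Let G := giJ J.

(* The quantities prefixed by D are the variations, in the direction K, of the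
   quantities built from J. *)
Definition DG : 'M[R]_n := - (G *m gmx K *m G).
Definition Ddgi a : 'M[R]_n :=
  - (DG *m dgmx J a *m G + G *m dgmx K a *m G + G *m dgmx J a *m DG).
Definition DGam k i j : R :=
  2^-1 * \sum_(l < n) (DG k l * chr J i j l + G k l * chr K i j l).
Definition DdGam a k i j : R :=
  2^-1 * \sum_(l < n) (Ddgi a k l * chr J i j l + dgi J a k l * chr K i j l
    + (DG k l * dchr J a i j l + G k l * dchr K a i j l)).
Definition DRic i j : R :=
  \sum_(k < n) DdGam k k i j - \sum_(k < n) DdGam j k i k
  + \sum_(k < n) \sum_(l < n)
     ((DGam k k l * Gam J l i j + Gam J k k l * DGam l i j)
      - (DGam k j l * Gam J l i k + Gam J k j l * DGam l i k)).

Hypothesis Ju : gmx J \in unitmx.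

Let isdc (A B : R) : is_derive (0 : R) 1 (fun e : R => A + e * B) B.
Proof.
have := isd_add (isd_cst (0 : R) 1 A)
  (isd_mul (is_derive_id (0 : R) (1 : R)) (isd_cst (0 : R) 1 B)).
by rewrite mulr0 addr0 add0r mul1r.
Qed.

Let isdG k l : is_derive (0 : R) 1 (fun e : R => giJ (jet_axpy J e K) k l) (DG k l).
Proof.
rewrite (_ : (fun e => _) = fun e => invmx (gmx J + e *: gmx K) k l).
  by rewrite /DG mxE; exact: isd_invmx.
apply/funext => e; congr (invmx _ k l).
by apply/matrixP => i j; rewrite !mxE.
Qed.

Let isd_chr i j l : is_derive (0 : R) 1 (fun e : R => chr (jet_axpy J e K) i j l)
  (chr K i j l).
Proof. exact: (isd_sub (isd_add (isdc _ _) (isdc _ _)) (isdc _ _)). Qed.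

Let isd_dchr a i j l : is_derive (0 : R) 1
  (fun e : R => dchr (jet_axpy J e K) a i j l) (dchr K a i j l).
Proof. exact: (isd_sub (isd_add (isdc _ _) (isdc _ _)) (isdc _ _)). Qed.

Lemma isd_Gam k i j : is_derive (0 : R) 1
  (fun e : R => Gam (jet_axpy J e K) k i j) (DGam k i j).
Proof.
have := isd_cmul 2^-1 (isd_sum (index_enum _)
  (fun l => isd_mul (isdG k l) (isd_chr i j l))).
by rewrite jet_axpy0.
Qed.

Lemma isd_dgi a k l : is_derive (0 : R) 1
  (fun e : R => dgi (jet_axpy J e K) a k l) (Ddgi a k l).
Proof.
have := isd_opp (isd_sum (index_enum _) (fun b => isd_sum (index_enum _)
  (fun c => isd_mul (isd_mul (isdG k b) (isdc (dg J a b c) (dg K a b c)))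
                    (isdG c l)))).
rewrite jet_axpy0 -/G; set d := (X in is_derive _ _ _ X -> _) => H.
suff -> : Ddgi a k l = d by exact: H.
rewrite /d /Ddgi 4!mxE; congr (- _).
rewrite exchange_big /= [in RHS]exchange_big /= exchange_big /=.
rewrite !mxE -!big_split; apply: eq_bigr => c _ /=.
rewrite !mxE !big_distrl -!big_split; apply: eq_bigr => b _ /=.
rewrite !mxE mul0r addr0; ring.
Qed.

Lemma isd_dGam a k i j : is_derive (0 : R) 1
  (fun e : R => dGam (jet_axpy J e K) a k i j) (DdGam a k i j).
Proof.
have := isd_cmul 2^-1 (isd_sum (index_enum _) (fun l =>
  isd_add (isd_mul (isd_dgi a k l) (isd_chr i j l))
          (isd_mul (isdG k l) (isd_dchr a i j l)))).
by rewrite jet_axpy0.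
Qed.

Lemma isd_Ric i j : is_derive (0 : R) 1
  (fun e : R => Ric (jet_axpy J e K) i j) (DRic i j).
Proof.
have := isd_add (isd_sub (isd_sum (index_enum _) (fun k => isd_dGam k k i j))
                         (isd_sum (index_enum _) (fun k => isd_dGam j k i k)))
  (isd_sum (index_enum _) (fun k => isd_sum (index_enum _) (fun l =>
    isd_sub (isd_mul (isd_Gam k k l) (isd_Gam l i j))
            (isd_mul (isd_Gam k j l) (isd_Gam l i k))))).
by rewrite jet_axpy0.
Qed.

(** Makes the infinitesimal criterion purely algebraic in the jets [J] and [K]. *)
Lemma derive1_Delta p :
  derive1 (fun e : R => Delta (jet_axpy J e K) p) 0
  = j1 K (@it n) p + 2 * DRic (pfst p) (psnd p).
Proof.
rewrite derive1E; apply: derive_val.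
exact: (isd_add (isdc _ _) (isd_cmul 2 (isd_Ric (pfst p) (psnd p)))).
Qed.

End Direction.
End RicciDerivative.

(** * Covariance of the Christoffel symbols and their derivatives *)

Section Covariance.
Context {R : realType} {n : nat}.
Variables (J K : jet R n) (lam : R) (M : 'M[R]_n).
Variables (M2 : 'I_n -> 'I_n -> 'I_n -> R) (M3 : 'I_n -> 'I_n -> 'I_n -> 'I_n -> R).
Implicit Types a b i j k l m : 'I_n.
Hypothesis Ju : gmx J \in unitmx.
Hypothesis M2C : forall m i j, M2 m i j = M2 m j i.
Hypothesis M3C : forall m a i j, M3 m a i j = M3 m i a j.
Hypothesis M3C' : forall m a i j, M3 m a i j = M3 m a j i.
Hypothesis K0 : forall i j, gJ K i j =
  lam * gJ J i j - \sum_m (gJ J m i * M m j + gJ J m j * M m i).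
Hypothesis K1 : forall a i j, dg K a i j =
  lam * dg J a i j - \sum_m (M m a * dg J m i j
    + (dg J a m i * M m j + dg J a m j * M m i)
    + (gJ J m i * M2 m a j + gJ J m j * M2 m a i)).
Hypothesis K2 : forall a b i j, ddg K a b i j =
  lam * ddg J a b i j - \sum_m (M m a * ddg J m b i j + M m b * ddg J a m i j
    + (ddg J a b m i * M m j + ddg J a b m j * M m i)
    + (dg J a m i * M2 m b j + dg J a m j * M2 m b i)
    + (dg J b m i * M2 m a j + dg J b m j * M2 m a i)
    + M2 m a b * dg J m i j
    + (gJ J m i * M3 m a b j + gJ J m j * M3 m a b i)).

Let G := giJ J.
Let gC i j : gJ J i j = gJ J j i. Proof. by rewrite /gJ pidxC. Qed.
Let dgC a i j : dg J a i j = dg J a j i. Proof. by rewrite /dg pidxC. Qed.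
Let ddgC a b i j : ddg J a b i j = ddg J a b j i. Proof. by rewrite /ddg pidxC. Qed.

(* K is the direction lam g - L_xi g together with its prolongation, where M, M2
   and M3 stand for the first, second and third derivatives of xi; the transport
   terms along xi are cancelled by those of the prolongation formula. *)
Lemma cov_chr i j l : chr K i j l = lam * chr J i j l
  - \sum_m (M m i * chr J m j l + M m j * chr J i m l + M m l * chr J i j m
            + 2 * gJ J l m * M2 m i j).
Proof.
rewrite /chr !K1.
set S1 : R := \sum_m _; set S2 : R := \sum_m _; set S3 : R := \sum_m _;
set S4 : R := \sum_m _.
suff -> : S4 = S1 + S2 - S3 by ring.
rewrite /S1 /S2 /S3 /S4 -big_split /= -sumrB; apply: eq_bigr => m _.
rewrite (M2C m l j) (M2C m l i) (M2C m j i) (dgC i m j) (dgC j m i) (gC l m).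
by rewrite (dgC l i m); ring.
Qed.

Lemma cov_dchr a i j l : dchr K a i j l = lam * dchr J a i j l
  - \sum_m (M m a * dchr J m i j l + M m i * dchr J a m j l
            + M m j * dchr J a i m l + M m l * dchr J a i j m
            + M2 m a i * chr J m j l + M2 m a j * chr J i m l
            + M2 m a l * chr J i j m
            + 2 * dg J a l m * M2 m i j + 2 * gJ J l m * M3 m a i j).
Proof.
rewrite /dchr !K2.
set S1 : R := \sum_m _; set S2 : R := \sum_m _; set S3 : R := \sum_m _;
set S4 : R := \sum_m _.
suff -> : S4 = S1 + S2 - S3 by ring.
rewrite /S1 /S2 /S3 /S4 -big_split /= -sumrB; apply: eq_bigr => m _.
rewrite /chr (M2C m l j) (M2C m l i) (M2C m j i) (gC l m).
rewrite (M3C' m a j i) (M3C' m a l i) (M3C' m a l j) (dgC a l m).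
rewrite (dgC l i m) (dgC i m j) (dgC j m i).
rewrite (ddgC a i m j) (ddgC a j m i) (ddgC a l i m).
by ring.
Qed.

Let vchr i j : 'cV[R]_n := \col_l chr J i j l.
Let vdchr a i j : 'cV[R]_n := \col_l dchr J a i j l.
Let vGam i j : 'cV[R]_n := \col_k Gam J k i j.
Let vdGam a i j : 'cV[R]_n := \col_k dGam J a k i j.
Let D a : 'M[R]_n := - (G *m dgmx J a *m G).
Let N a : 'M[R]_n := \matrix_(k, i) M2 k a i.
Let mu i j : 'cV[R]_n := \col_m M2 m i j.
Let nu a i j : 'cV[R]_n := \col_m M3 m a i j.

Let GammaE i j : vGam i j = 2^-1 *: (G *m vchr i j).
Proof.
by apply/colP => k; rewrite !mxE; congr (_ * _); apply: eq_bigr => l _; rewrite mxE.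
Qed.

Let dGammaE a i j : vdGam a i j = 2^-1 *: (D a *m vchr i j + G *m vdchr a i j).
Proof.
apply/colP => k; rewrite !mxE; congr (_ * _); rewrite -big_split /=.
by apply: eq_bigr => l _; rewrite dgiE [vchr _ _ _ _]mxE [vdchr _ _ _ _ _]mxE.
Qed.

Let gG : gmx J *m G = 1%:M. Proof. exact: mulmxV. Qed.
Let Gg : G *m gmx J = 1%:M. Proof. exact: mulVmx. Qed.

Let gmxK : gmx K = lam *: gmx J - (gmx J *m M + M^T *m gmx J).
Proof.
apply/matrixP => i j; rewrite !mxE K0; congr (_ - _); rewrite big_split.
congr (_ + _); apply: eq_bigr => m _; rewrite !mxE; first by rewrite gC.
by rewrite mulrC.
Qed.

Let dgmxK a : dgmx K a = lam *: dgmx J a - (\sum_m M m a *: dgmx J m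
  + (dgmx J a *m M + M^T *m dgmx J a) + (gmx J *m N a + (N a)^T *m gmx J)).
Proof.
apply/matrixP => i j; rewrite !mxE K1; congr (_ - _); rewrite summxE !big_split.
congr (_ + (_ + _) + (_ + _)); apply: eq_bigr => m _; rewrite !mxE //.
- by rewrite dgC.
- by rewrite mulrC.
- by rewrite gC.
- by rewrite mulrC.
Qed.

(** The inverse metric is contravariant: compared with the metric, both the Lie derivative terms and
    the scaling weight change sign. *)
Lemma cov_DG : DG J K = M *m G + G *m M^T - lam *: G.
Proof.
rewrite /DG gmxK -/G mulmxBr mulmxBl opprB -scalemxAr Gg -scalemxAl mul1mx.
congr (_ - _); rewrite mulmxDr mulmxDl mulmxA Gg mul1mx; congr (_ + _).
by rewrite -!mulmxA gG mulmx1.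
Qed.

Lemma cov_Ddgi a : Ddgi J K a = M *m D a + D a *m M^T - lam *: D a
  - \sum_m M m a *: D m + N a *m G + G *m (N a)^T.
Proof.
rewrite /Ddgi cov_DG dgmxK -/G.
have -> : \sum_m M m a *: D m = - (G *m (\sum_m M m a *: dgmx J m) *m G).
  rewrite mulmx_sumr mulmx_suml -sumrN; apply: eq_bigr => m _.
  by rewrite /D scalerN -scalemxAr -scalemxAl.
set S := \sum_m _; set P := dgmx J a; rewrite /D -/P.
have E1 : G *m (gmx J *m N a) *m G = N a *m G by rewrite mulmxA Gg mul1mx.
have E2 : G *m ((N a)^T *m gmx J) *m G = G *m (N a)^T.
  by rewrite -!mulmxA gG mulmx1.
rewrite !(mulmxDl, mulmxDr, mulmxN, mulNmx, mulmxBl, mulmxBr) E1 E2.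
rewrite -!(scalemxAl, scalemxAr) -!mulmxA.
move: (M *m _) (N a *m _) (G *m (N a)^T) => A B C.
apply/matrixP => i j; rewrite !mxE; ring.
Qed.

(** The scaling weight [lam] drops out because a connection does not see constant rescalings of the
    metric. The term [M2 k i j] is the inhomogeneous part in the transformation of a connection. *)
Lemma cov_Gam k i j : DGam J K k i j =
  \sum_m (M k m * Gam J m i j - M m i * Gam J k m j - M m j * Gam J k i m)
  - M2 k i j.
Proof.
have vK : \col_l chr K i j l = lam *: vchr i j
    - (\sum_m M m i *: vchr m j + \sum_m M m j *: vchr i m + M^T *m vchr i j
       + 2 *: (gmx J *m mu i j)).
  apply/colP => l; rewrite !mxE cov_chr !summxE; congr (_ - _).
  rewrite mulr_sumr -!big_split /=; apply: eq_bigr => m _; rewrite !mxE.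
  by ring.
have E : \col_k DGam J K k i j = 2^-1 *: (DG J K *m vchr i j + G *m \col_l chr K i j l).
  apply/colP => k'; rewrite !mxE; congr (_ * _); rewrite -big_split /=.
  by apply: eq_bigr => l _; rewrite [vchr _ _ _ _]mxE [(\col__ _) _ _]mxE.
have := congr1 (fun v : 'cV[R]_n => v k 0) E; rewrite mxE => ->.
suff -> : 2^-1 *: (DG J K *m vchr i j + G *m \col_l chr K i j l)
  = M *m vGam i j - \sum_m M m i *: vGam m j - \sum_m M m j *: vGam i m - mu i j.
  rewrite !mxE !summxE !sumrB; congr (_ - _ - _ - _);
  by apply: eq_bigr => m _; rewrite !mxE.
rewrite cov_DG vK.
have sG (x : 'I_n -> R) (w v : 'I_n -> 'cV[R]_n) : (forall m, v m = 2^-1 *: (G *m w m)) ->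
    \sum_m x m *: v m = 2^-1 *: (G *m \sum_m x m *: w m).
  move=> H; rewrite mulmx_sumr scaler_sumr; apply: eq_bigr => m _.
  by rewrite H -scalemxAr !scalerA mulrC.
rewrite (sG (M^~ i) (vchr^~ j) (vGam^~ j)); last by move=> m; exact: GammaE.
rewrite (sG (M^~ j) (vchr i) (vGam i)); last by move=> m; exact: GammaE.
rewrite GammaE.
rewrite !(mulmxDl, mulmxDr, mulmxN, mulNmx, mulmxBl, mulmxBr).
rewrite -!(scalemxAl, scalemxAr) -!mulmxA (mulmxA G (gmx J)) Gg mul1mx.
by apply/colP => l; rewrite !mxE; field.
Qed.

(** Formally this is [cov_Gam] differentiated along $x^a$, the term in [M m a] coming from the
    prolongation formula. *)
Lemma cov_dGam a k i j : DdGam J K a k i j =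
  \sum_m (M k m * dGam J a m i j - M m a * dGam J m k i j
     - M m i * dGam J a k m j - M m j * dGam J a k i m
     + M2 k a m * Gam J m i j - M2 m a i * Gam J k m j - M2 m a j * Gam J k i m)
  - M3 k a i j.
Proof.
have vK : \col_l chr K i j l = lam *: vchr i j
    - (\sum_m M m i *: vchr m j + \sum_m M m j *: vchr i m + M^T *m vchr i j
       + 2 *: (gmx J *m mu i j)).
  apply/colP => l; rewrite !mxE cov_chr !summxE; congr (_ - _).
  rewrite mulr_sumr -!big_split /=; apply: eq_bigr => m _; rewrite !mxE.
  by ring.
have vdK : \col_l dchr K a i j l = lam *: vdchr a i j
    - (\sum_m M m a *: vdchr m i j + \sum_m M m i *: vdchr a m j
       + \sum_m M m j *: vdchr a i m + M^T *m vdchr a i j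
       + \sum_m M2 m a i *: vchr m j + \sum_m M2 m a j *: vchr i m
       + (N a)^T *m vchr i j + 2 *: (dgmx J a *m mu i j) + 2 *: (gmx J *m nu a i j)).
  apply/colP => l; rewrite !mxE cov_dchr !summxE; congr (_ - _).
  rewrite !mulr_sumr -!big_split /=; apply: eq_bigr => m _; rewrite !mxE.
  by ring.
have E : \col_k DdGam J K a k i j = 2^-1 *: (Ddgi J K a *m vchr i j
    + D a *m \col_l chr K i j l
    + (DG J K *m vdchr a i j + G *m \col_l dchr K a i j l)).
  apply/colP => k'; rewrite !mxE; congr (_ * _); rewrite -!big_split /=.
  by apply: eq_bigr => l _; rewrite dgiE [vchr _ _ _ _]mxE [vdchr _ _ _ _ _]mxE
    ![(\col__ _) _ _]mxE.
have := congr1 (fun v : 'cV[R]_n => v k 0) E; rewrite mxE => ->.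
pose L : 'cV[R]_n := 2^-1 *: (Ddgi J K a *m vchr i j
    + D a *m \col_l chr K i j l
    + (DG J K *m vdchr a i j + G *m \col_l dchr K a i j l)).
rewrite -/L.
suff -> : L = M *m vdGam a i j - \sum_m M m a *: vdGam m i j
    - \sum_m M m i *: vdGam a m j - \sum_m M m j *: vdGam a i m
    + N a *m vGam i j - \sum_m M2 m a i *: vGam m j
    - \sum_m M2 m a j *: vGam i m - nu a i j.
  rewrite !mxE !summxE !(sumrB, big_split) /=.
  congr (_ - _ - _ - _ + _ - _ - _ - _);
  by apply: eq_bigr => m _; rewrite !mxE.
rewrite /L cov_DG cov_Ddgi vK vdK; apply/colP => l.
have sG (x : 'I_n -> R) (w v : 'I_n -> 'cV[R]_n) : (forall m, v m = 2^-1 *: (G *m w m)) ->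
    \sum_m x m *: v m = 2^-1 *: (G *m \sum_m x m *: w m).
  move=> H; rewrite mulmx_sumr scaler_sumr; apply: eq_bigr => m _.
  by rewrite H -scalemxAr !scalerA mulrC.
have sDG (x : 'I_n -> R) (d : 'I_n -> 'M[R]_n) (w w' v : 'I_n -> 'cV[R]_n) :
    (forall m, v m = 2^-1 *: (d m *m w m + G *m w' m)) ->
    \sum_m x m *: v m
    = 2^-1 *: (\sum_m x m *: (d m *m w m) + G *m \sum_m x m *: w' m).
  move=> H; rewrite mulmx_sumr -big_split scaler_sumr; apply: eq_bigr => m _ /=.
  by rewrite H -scalemxAr -scalerDr !scalerA mulrC.
rewrite (sG (fun m => M2 m a i) (vchr^~ j) (vGam^~ j)); last by move=> m; exact: GammaE.
rewrite (sG (fun m => M2 m a j) (vchr i) (vGam i)); last by move=> m; exact: GammaE.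
rewrite (sDG (M^~ a) D (fun _ => vchr i j) (fun m => vdchr m i j) (fun m => vdGam m i j));
  last by move=> m; exact: dGammaE.
rewrite (sDG (M^~ i) (fun _ => D a) (vchr^~ j) (vdchr a ^~ j) (vdGam a ^~ j));
  last by move=> m; exact: dGammaE.
rewrite (sDG (M^~ j) (fun _ => D a) (vchr i) (vdchr a i) (vdGam a i));
  last by move=> m; exact: dGammaE.
have sD (x : 'I_n -> R) (w : 'I_n -> 'cV[R]_n) :
    \sum_m x m *: (D a *m w m) = D a *m \sum_m x m *: w m.
  by rewrite mulmx_sumr; apply: eq_bigr => m _; rewrite -scalemxAr.
have sD' (x : 'I_n -> R) (v : 'cV[R]_n) :
    \sum_m x m *: (D m *m v) = (\sum_m x m *: D m) *m v.
  by rewrite mulmx_suml; apply: eq_bigr => m _; rewrite -scalemxAl.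
rewrite GammaE dGammaE !sD sD'.
(* Since [D a] is the derivative of the inverse metric, $D_a\, g = -G\, \partial_a g$. The [mu]
   terms of the varied first and second derivatives thereby cancel. *)
have Dg : D a *m (gmx J *m mu i j) = - (G *m (dgmx J a *m mu i j)).
  by rewrite mulmxA mulNmx -(mulmxA _ G) Gg mulmx1 mulNmx -mulmxA.
move: Dg; generalize D => D0 Dg.
rewrite !(mulmxDl, mulmxDr, mulmxN, mulNmx, mulmxBl, mulmxBr).
rewrite -!(scalemxAl, scalemxAr) Dg -!mulmxA (mulmxA G (gmx J)) Gg mul1mx.
by rewrite (mulmxDr M) !mxE; field.
Qed.

End Covariance.

(** * From connection coefficients to the Ricci tensor *)

Section RicciContraction.
Context {R : comRingType} {n : nat}.
Variables (Ga DGa : 'I_n -> 'I_n -> 'I_n -> R) (dGa DdGa : 'I_n -> 'I_n -> 'I_n -> 'I_n -> R).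
Variables (M : 'I_n -> 'I_n -> R) (M2 : 'I_n -> 'I_n -> 'I_n -> R).
Variable M3 : 'I_n -> 'I_n -> 'I_n -> 'I_n -> R.
Implicit Types a i j k l m : 'I_n.
Hypothesis GaC : forall k i j, Ga k i j = Ga k j i.
Hypothesis M2C : forall m i j, M2 m i j = M2 m j i.
Hypothesis M3C : forall m a i j, M3 m a i j = M3 m i a j.
Hypothesis M3C' : forall m a i j, M3 m a i j = M3 m a j i.
Hypothesis DGaE : forall k i j, DGa k i j =
  \sum_m (M k m * Ga m i j - M m i * Ga k m j - M m j * Ga k i m) - M2 k i j.
Hypothesis DdGaE : forall a k i j, DdGa a k i j =
  \sum_m (M k m * dGa a m i j - M m a * dGa m k i j
     - M m i * dGa a k m j - M m j * dGa a k i m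
     + M2 k a m * Ga m i j - M2 m a i * Ga k m j - M2 m a j * Ga k i m)
  - M3 k a i j.

Let t l := \sum_k Ga k k l.
Let dv i j := \sum_k dGa k k i j.
Let dt j i := \sum_k dGa j k i k.
Let Gm j : 'M[R]_n := \matrix_(k, l) Ga k j l.
Let N j : 'M[R]_n := \matrix_(k, l) M2 k j l.
Let Mm : 'M[R]_n := \matrix_(k, l) M k l.

(** Contracting an upper with a lower index makes their two [M] terms cancel. This zero sum is
    subtracted below so that the cancellation can be seen summand by summand. *)
Let sumC (F : 'I_n -> 'I_n -> R) : \sum_k \sum_m (F k m - F m k) = 0.
Proof.
under eq_bigr => k _ do rewrite sumrB.
by rewrite sumrB [X in _ - X]exchange_big subrr.
Qed.

Let Dt l : \sum_k DGa k k l = - (\sum_m M m l * t m) - \sum_k M2 k k l.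
Proof.
under eq_bigr => k _ do rewrite DGaE.
rewrite sumrB; congr (_ - _).
have -> : \sum_m M m l * t m = \sum_k \sum_m M m l * Ga k k m.
  by rewrite exchange_big; apply: eq_bigr => m _; rewrite mulr_sumr.
rewrite -[LHS]subr0 -[X in _ - X = _](sumC (fun k m => M k m * Ga m k l)) -!sumrN -!big_split /=.
apply: eq_bigr => k _; rewrite -!sumrN -!big_split /=; apply: eq_bigr => m _.
by ring.
Qed.

Let Ddv i j : \sum_k DdGa k k i j =
  - (\sum_m (M m i * dv m j + M m j * dv i m))
  + \sum_k \sum_m (M2 k k m * Ga m i j - M2 m k i * Ga k m j - M2 m k j * Ga k i m)
  - \sum_k M3 k k i j.
Proof.
under eq_bigr => k _ do rewrite DdGaE.
rewrite sumrB; congr (_ - _).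
have -> : \sum_m (M m i * dv m j + M m j * dv i m) =
    \sum_k \sum_m (M m i * dGa k k m j + M m j * dGa k k i m).
  rewrite exchange_big; apply: eq_bigr => m _.
  by rewrite big_split !mulr_sumr.
rewrite -[LHS]subr0 -[X in _ - X = _](sumC (fun k m => M k m * dGa k m i j)) -!sumrN -!big_split /=.
apply: eq_bigr => k _; rewrite -!sumrN -!big_split /=; apply: eq_bigr => m _.
by ring.
Qed.

Let Ddt i j : \sum_k DdGa j k i k =
  - (\sum_m (M m j * dt m i + M m i * dt j m)) - \sum_m M2 m j i * t m
  - \sum_k M3 k k i j.
Proof.
under eq_bigr => k _ do rewrite DdGaE.
rewrite sumrB; congr (_ - _); last first.
  by apply: eq_bigr => k _; rewrite M3C' M3C M3C' (M3C' k k).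
have -> : \sum_m (M m j * dt m i + M m i * dt j m) =
    \sum_k \sum_m (M m j * dGa m k i k + M m i * dGa j k m k).
  rewrite exchange_big; apply: eq_bigr => m _.
  by rewrite big_split !mulr_sumr.
have -> : \sum_m M2 m j i * t m = \sum_k \sum_m M2 m j i * Ga k k m.
  by rewrite exchange_big; apply: eq_bigr => m _; rewrite mulr_sumr.
rewrite -[LHS]subr0 -[X in _ - X = _](sumC (fun k m => M k m * dGa j m i k + M2 k j m * Ga m i k)).
rewrite -!sumrN -!big_split /=.
apply: eq_bigr => k _; rewrite -!sumrN -!big_split /=; apply: eq_bigr => m _.
by rewrite (GaC k m k); ring.
Qed.

Let quadAB i j : \sum_k \sum_l (DGa k k l * Ga l i j + Ga k k l * DGa l i j) =
  - (\sum_m (M m i * (\sum_l t l * Ga l m j) + M m j * (\sum_l t l * Ga l i m)))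
  - \sum_k \sum_m M2 k k m * Ga m i j - \sum_m M2 m j i * t m.
Proof.
have -> : \sum_k \sum_l (DGa k k l * Ga l i j + Ga k k l * DGa l i j) =
    \sum_l (- (\sum_m M m l * t m * Ga l i j) - \sum_k M2 k k l * Ga l i j
      + \sum_m t l * (M l m * Ga m i j - M m i * Ga l m j - M m j * Ga l i m)
      - M2 l j i * t l).
  rewrite exchange_big; apply: eq_bigr => l _.
  rewrite big_split /= -!mulr_suml Dt -mulr_sumr DGaE (M2C l i j).
  by rewrite /t; ring.
have -> : \sum_m (M m i * (\sum_l t l * Ga l m j) + M m j * (\sum_l t l * Ga l i m)) =
    \sum_l \sum_m (M m i * (t l * Ga l m j) + M m j * (t l * Ga l i m)).
  rewrite exchange_big; apply: eq_bigr => m _.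
  by rewrite big_split !mulr_sumr.
have -> : \sum_k \sum_m M2 k k m * Ga m i j = \sum_l \sum_k M2 k k l * Ga l i j.
  by rewrite exchange_big.
rewrite -[LHS]subr0 -[X in _ - X = _](sumC (fun l m => t l * M l m * Ga m i j)) -!sumrN -!big_split /=.
apply: eq_bigr => l _.
have -> : \sum_m (M m i * (t l * Ga l m j) + M m j * (t l * Ga l i m)) =
    \sum_m M m l * t m * Ga l i j
    - \sum_m t l * (M l m * Ga m i j - M m i * Ga l m j - M m j * Ga l i m)
    + \sum_m (t l * M l m * Ga m i j - t m * M m l * Ga l i j).
  by rewrite -sumrB -big_split; apply: eq_bigr => m _ /=; ring.
by ring.
Qed.

Let DGm : 'I_n -> 'M[R]_n := fun j => \matrix_(k, l) DGa k j l.

Let DGmE j : DGm j = Mm *m Gm j - Gm j *m Mm - \sum_m M m j *: Gm m - N j.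
Proof.
apply/matrixP => k l; rewrite !mxE DGaE summxE -!sumrB; congr (_ - _).
by apply: eq_bigr => m _; rewrite !mxE; ring.
Qed.

(** As a trace, the contraction of two connection matrices can be rearranged by cyclicity. *)
Let trE (A B : 'I_n -> 'I_n -> 'I_n -> R) i j :
  \sum_k \sum_l A k j l * B l i k
  = \tr ((\matrix_(k, l) A k j l) *m (\matrix_(k, l) B k i l)).
Proof.
rewrite /mxtrace; apply: eq_bigr => k _; rewrite !mxE; apply: eq_bigr => l _.
by rewrite !mxE.
Qed.

Let quadC i j : \sum_k \sum_l (DGa k j l * Ga l i k + Ga k j l * DGa l i k) =
  - (\sum_m (M m i * (\sum_k \sum_l Ga k j l * Ga l m k)
            + M m j * (\sum_k \sum_l Ga k m l * Ga l i k)))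
  - \sum_k \sum_m (M2 m k i * Ga k m j + M2 m k j * Ga k i m).
Proof.
have -> : \sum_k \sum_m (M2 m k i * Ga k m j + M2 m k j * Ga k i m)
    = \tr (Gm j *m N i) + \tr (N j *m Gm i).
  rewrite -!trE [X in _ + X]exchange_big -big_split; apply: eq_bigr => k _ /=.
  rewrite -big_split; apply: eq_bigr => m _ /=.
  by rewrite (M2C m k i) (M2C m k j) (GaC k m j) mulrC.
have -> : \sum_k \sum_l (DGa k j l * Ga l i k + Ga k j l * DGa l i k)
    = \tr (DGm j *m Gm i) + \tr (Gm j *m DGm i).
  rewrite -!trE -big_split; apply: eq_bigr => k _ /=.
  by rewrite -big_split.
under [X in _ = - X - _]eq_bigr => m _ do rewrite !trE -/(Gm m) -/(Gm i) -/(Gm j).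
have trN (A : 'M[R]_n) : \tr (- A) = - \tr A by rewrite raddfN.
have trS (F : 'I_n -> 'M[R]_n) : \tr (\sum_m F m) = \sum_m \tr (F m).
  by rewrite raddf_sum.
rewrite !DGmE !(mulmxDl, mulmxDr, mulNmx, mulmxN) !(mxtraceD, trN).
rewrite mulmx_suml mulmx_sumr !trS big_split /=.
under eq_bigr => m _ do rewrite -scalemxAl linearZ /=.
under [X in _ + (_ - X - _)]eq_bigr => m _ do rewrite -scalemxAr linearZ /=.
have -> : \tr (Mm *m Gm j *m Gm i) = \tr (Gm j *m (Gm i *m Mm)).
  by rewrite -mulmxA mxtrace_mulC mulmxA.
by rewrite (mulmxA (Gm j) Mm); ring.
Qed.

Let Rc i j := \sum_k dGa k k i j - \sum_k dGa j k i k
  + \sum_k \sum_l (Ga k k l * Ga l i j - Ga k j l * Ga l i k).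

(** This is why Ric is a tensor: the [M3] terms of the two derivative contractions agree, and their
    [M2] terms are compensated by those of the two quadratic contractions. Only the first
    derivatives of xi remain. *)
Lemma ricci_contraction i j :
  \sum_k DdGa k k i j - \sum_k DdGa j k i k
  + \sum_k \sum_l ((DGa k k l * Ga l i j + Ga k k l * DGa l i j)
                   - (DGa k j l * Ga l i k + Ga k j l * DGa l i k))
  = - (\sum_m (M m i * Rc m j + M m j * Rc i m)).
Proof.
under [X in _ + X]eq_bigr => k _ do rewrite sumrB.
rewrite sumrB Ddv Ddt quadAB quadC.
have RcE i' j' : Rc i' j' = dv i' j' - dt j' i' + \sum_l t l * Ga l i' j'
    - \sum_k \sum_l Ga k j' l * Ga l i' k.
  rewrite /Rc -[RHS]addrA; congr (_ + _).
  have -> : \sum_l t l * Ga l i' j' = \sum_k \sum_l Ga k k l * Ga l i' j'.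
    by rewrite exchange_big; apply: eq_bigr => l _; rewrite mulr_suml.
  by rewrite -sumrB; apply: eq_bigr => k _; rewrite sumrB.
have -> : \sum_m (M m i * Rc m j + M m j * Rc i m) =
    \sum_m (M m i * dv m j + M m j * dv i m)
    - \sum_m (M m j * dt m i + M m i * dt j m)
    + \sum_m (M m i * (\sum_l t l * Ga l m j) + M m j * (\sum_l t l * Ga l i m))
    - \sum_m (M m i * (\sum_k \sum_l Ga k j l * Ga l m k)
            + M m j * (\sum_k \sum_l Ga k m l * Ga l i k)).
  rewrite -sumrB -big_split -sumrB; apply: eq_bigr => m _ /=.
  by rewrite !RcE; ring.
have -> : \sum_k \sum_m (M2 k k m * Ga m i j - M2 m k i * Ga k m j - M2 m k j * Ga k i m)
   = \sum_k \sum_m M2 k k m * Ga m i j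
     - \sum_k \sum_m (M2 m k i * Ga k m j + M2 m k j * Ga k i m).
  rewrite -sumrB; apply: eq_bigr => k _; rewrite -sumrB; apply: eq_bigr => m _.
  by ring.
by ring.
Qed.

End RicciContraction.

Section RicciSymmetry.
Context {R : realType} {n : nat}.
Variable J : jet R n.
Implicit Types a i j k l : 'I_n.

Lemma giJ_sym k l : giJ J k l = giJ J l k.
Proof.
have -> : giJ J l k = (giJ J)^T k l by rewrite mxE.
rewrite /giJ trmx_inv; congr (invmx _ k l).
by apply/matrixP => i j; rewrite !mxE /gJ pidxC.
Qed.

Lemma dgi_sym a k l : dgi J a k l = dgi J a l k.
Proof.
rewrite /dgi exchange_big; congr (- _); apply: eq_bigr => c _; apply: eq_bigr => b _.
by rewrite /dg (pidxC b c) (giJ_sym c l) (giJ_sym k b); ring.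
Qed.

Lemma Gam_sym k i j : Gam J k i j = Gam J k j i.
Proof.
rewrite /Gam; congr (_ * _); apply: eq_bigr => l _; congr (_ * _).
by rewrite /dg (pidxC i j); ring.
Qed.

(** Derivative of $\Gamma^k_{ik} = \frac12 g^{kl}\partial_i g_{kl}$: the other two terms are
    antisymmetric in k, l and vanish against the symmetric inverse metric. *)
Lemma dGam_trace j i : \sum_k dGam J j k i k =
  2^-1 * \sum_k \sum_l (dgi J j k l * dg J i k l + giJ J k l * ddg J j i k l).
Proof.
rewrite /dGam -mulr_sumr; congr (_ * _).
have A : \sum_k \sum_l (dgi J j k l * (dg J k i l - dg J l i k)
     + giJ J k l * (ddg J j k i l - ddg J j l i k)) = 0.
  set S := \sum_k _; have : S = - S.
    rewrite {1}/S exchange_big -sumrN; apply: eq_bigr => k _; rewrite -sumrN.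
    by apply: eq_bigr => l _; rewrite (dgi_sym j l k) (giJ_sym l k); ring.
  by move/eqP; rewrite -addr_eq0 -mulr2n mulrn_eq0 /= => /eqP.
rewrite -[LHS]subr0 -[X in _ - X = _]A -sumrB; apply: eq_bigr => k _.
by rewrite -sumrB; apply: eq_bigr => l _; ring.
Qed.

(** The equation is imposed for $i \le j$ only, while covariance sums over all index pairs. The one
    term that is not visibly symmetric is $\partial_j\Gamma^k_{ik}$, handled by [dGam_trace] and
    cyclicity of the trace. *)
Lemma Ric_sym i j : (forall c d p, j2 J c d p = j2 J d c p) ->
  Ric J i j = Ric J j i.
Proof.
move=> JC; rewrite /Ric !dGam_trace; congr (_ - _ + _).
- apply: eq_bigr => k _; rewrite /dGam; congr (_ * _); apply: eq_bigr => l _.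
  by rewrite /dg /ddg (pidxC i j); ring.
- congr (_ * _); under eq_bigr => k _ do rewrite big_split.
  under [RHS]eq_bigr => k _ do rewrite big_split.
  rewrite !big_split; congr (_ + _); last first.
    by apply: eq_bigr => k _; apply: eq_bigr => l _; rewrite /ddg JC.
  have E a b : \sum_k \sum_l dgi J a k l * dg J b k l
      = - \tr (giJ J *m dgmx J a *m (giJ J *m dgmx J b)).
    rewrite mulmxA -raddfN /mxtrace; apply: eq_bigr => k _; rewrite -mulNmx mxE.
    by apply: eq_bigr => l _; rewrite dgiE; congr (_ * _); rewrite mxE /dg (pidxC l k).
  by rewrite !E mxtrace_mulC.
- rewrite -[RHS]addr0.
  under eq_bigr => k _ do rewrite sumrB.
  under [X in _ = X + _]eq_bigr => k _ do rewrite sumrB.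
  rewrite !sumrB addr0; congr (_ - _).
    by apply: eq_bigr => k _; apply: eq_bigr => l _; rewrite (Gam_sym l i j).
  rewrite exchange_big; apply: eq_bigr => k _; apply: eq_bigr => l _.
  by rewrite mulrC.
Qed.

End RicciSymmetry.

Section RicciCovariance.
Context {R : realType} {n : nat}.
Variables (J K : jet R n) (lam : R) (M : 'M[R]_n).
Variables (M2 : 'I_n -> 'I_n -> 'I_n -> R) (M3 : 'I_n -> 'I_n -> 'I_n -> 'I_n -> R).
Implicit Types a b i j k l m : 'I_n.

Lemma cov_Ric i j : gmx J \in unitmx ->
  (forall m i j, M2 m i j = M2 m j i) ->
  (forall m a i j, M3 m a i j = M3 m i a j) ->
  (forall m a i j, M3 m a i j = M3 m a j i) ->
  (forall i j, gJ K i j =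
    lam * gJ J i j - \sum_m (gJ J m i * M m j + gJ J m j * M m i)) ->
  (forall a i j, dg K a i j =
    lam * dg J a i j - \sum_m (M m a * dg J m i j
      + (dg J a m i * M m j + dg J a m j * M m i)
      + (gJ J m i * M2 m a j + gJ J m j * M2 m a i))) ->
  (forall a b i j, ddg K a b i j =
    lam * ddg J a b i j - \sum_m (M m a * ddg J m b i j + M m b * ddg J a m i j
      + (ddg J a b m i * M m j + ddg J a b m j * M m i)
      + (dg J a m i * M2 m b j + dg J a m j * M2 m b i)
      + (dg J b m i * M2 m a j + dg J b m j * M2 m a i)
      + M2 m a b * dg J m i j
      + (gJ J m i * M3 m a b j + gJ J m j * M3 m a b i))) ->
  DRic J K i j = - \sum_m (M m i * Ric J m j + M m j * Ric J i m).
Proof.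
move=> Ju M2C M3C M3C' K0 K1 K2.
apply: (ricci_contraction (Ga := Gam J) (dGa := dGam J) (M2 := M2) (M3 := M3)) => //.
- exact: Gam_sym.
- by move=> k i' j'; exact: (cov_Gam (lam := lam)).
- by move=> a k i' j'; exact: (cov_dGam (lam := lam)).
Qed.

End RicciCovariance.

(** * Fields projectable to (x, t) *)

Section ProjectableJets.
Context {R : realType} {n : nat}.
Variable J : jet R n.
Variables (l : R) (l1 : 'I_n.+1 -> R) (l2 : 'I_n.+1 -> 'I_n.+1 -> R).
Variables (X1 : 'I_n.+1 -> 'I_n.+1 -> R) (X2 : 'I_n.+1 -> 'I_n.+1 -> 'I_n.+1 -> R).
Variables (M0 : 'I_n -> 'I_n -> R) (M1 : 'I_n -> 'I_n -> 'I_n.+1 -> R)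
  (M2 : 'I_n -> 'I_n -> 'I_n.+1 -> 'I_n.+1 -> R).
Implicit Types (i j k m : 'I_n) (c d : 'I_n.+1) (p : Pidx n).

(** The k-th summand of the part of $L_\xi g$ without transport; [pF1] and [pF2] are its derivatives
    by the Leibniz rule. *)
Definition pF k i j : R :=
  j0 J (pidx k i) * M0 k j + j0 J (pidx k j) * M0 k i.
Definition pF1 c k i j : R :=
  (j1 J c (pidx k i) * M0 k j + j0 J (pidx k i) * M1 k j c)
  + (j1 J c (pidx k j) * M0 k i + j0 J (pidx k j) * M1 k i c).
Definition pF2 c d k i j : R :=
  ((j2 J c d (pidx k i) * M0 k j + j1 J d (pidx k i) * M1 k j c)
   + (j1 J c (pidx k i) * M1 k j d + j0 J (pidx k i) * M2 k j c d))
  + ((j2 J c d (pidx k j) * M0 k i + j1 J d (pidx k j) * M1 k i c)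
   + (j1 J c (pidx k j) * M1 k i d + j0 J (pidx k j) * M2 k i c d)).

(* The prolongation at J of a field whose (x, t)-components have first and second
   derivatives X1 and X2 and whose g-components are l g_ij - sum_k pF k i j;
   M1, M2 (resp. l1, l2) are the derivatives of M0 (resp. l). *)
Definition proj_jet : jet R n := Jet
  (fun p => l * j0 J p - \sum_k pF k (pfst p) (psnd p))
  (fun c p => (l1 c * j0 J p + l * j1 J c p) - \sum_k pF1 c k (pfst p) (psnd p)
     - \sum_e X1 e c * j1 J e p)
  (fun c d p => ((l2 c d * j0 J p + l1 d * j1 J c p) + (l1 c * j1 J d p + l * j2 J c d p))
     - \sum_k pF2 c d k (pfst p) (psnd p)
     - \sum_e (X2 e c d * j1 J e p + X1 e d * j2 J c e p + X1 e c * j2 J d e p)).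

Hypothesis Ju : gmx J \in unitmx.
Hypothesis J2C : forall c d p, j2 J c d p = j2 J d c p.
Hypothesis JD : forall p, Delta J p = 0.
Hypothesis l1x : forall k, l1 (iv k) = 0.
Hypothesis l2x : forall i j, l2 (iv i) (iv j) = 0.
Hypothesis X1tx : forall k, X1 (@it n) (iv k) = 0.
Hypothesis X1tt : X1 (@it n) (@it n) = l.
Hypothesis X2tx : forall i j, X2 (@it n) (iv i) (iv j) = 0.
Hypothesis X1x : forall k i, X1 (iv k) (iv i) = M0 k i.
Hypothesis X2x : forall k i j, X2 (iv k) (iv i) (iv j) = M1 k j (iv i).
Hypothesis M1C : forall k i j, M1 k j (iv i) = M1 k i (iv j).
Hypothesis M2C : forall k a i j, M2 k j (iv a) (iv i) = M2 k j (iv i) (iv a).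
Hypothesis M2C' : forall k a i j, M2 k j (iv a) (iv i) = M2 k i (iv a) (iv j).

Let sumX (f g : 'I_n.+1 -> R) : f (@it n) = 0 ->
  \sum_e f e * g e = \sum_k f (iv k) * g (iv k).
Proof. by move=> f0; rewrite big_ord_recr /= -/(@it n) f0 mul0r addr0. Qed.

Let subrBB (a b c : R) : a - b - c = a - (b + c). Proof. by ring. Qed.

Lemma proj_jet_DRic i j : DRic J proj_jet i j
  = - \sum_m (M0 m i * Ric J m j + M0 m j * Ric J i m).
Proof.
pose M := \matrix_(k, i) M0 k i.
have ME k i' : M k i' = M0 k i' by rewrite mxE.
have -> : \sum_m (M0 m i * Ric J m j + M0 m j * Ric J i m) =
    \sum_m (M m i * Ric J m j + M m j * Ric J i m).
  by apply: eq_bigr => m _; rewrite !ME.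
apply: (cov_Ric (lam := l) (M2 := fun k a i => M1 k i (iv a))
  (M3 := fun k a i j => M2 k j (iv a) (iv i))) => //.
- move=> i' j'; rewrite /gJ /=; congr (_ - _).
  rewrite (pidx_sym (S := fun i j => \sum_k pF k i j)); last first.
    by move=> ? ?; apply: eq_bigr => k _; rewrite /pF addrC.
  by apply: eq_bigr => m _; rewrite /pF !ME.
- move=> a i' j'; rewrite /dg /gJ /= l1x mul0r add0r.
  rewrite (pidx_sym (S := fun i j => \sum_k pF1 (iv a) k i j)); last first.
    by move=> ? ?; apply: eq_bigr => k _; rewrite /pF1 addrC.
  rewrite (@sumX (fun e => X1 e (iv a)) (fun e => j1 J e (pidx i' j')))//.
  rewrite subrBB -big_split; congr (_ - _); apply: eq_bigr => m _ /=.
  by rewrite /pF1 !ME X1x; ring.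
- move=> a b i' j'; rewrite /ddg /dg /gJ /= !l1x l2x !mul0r !add0r.
  rewrite (pidx_sym (S := fun i j => \sum_k pF2 (iv a) (iv b) k i j)); last first.
    by move=> ? ?; apply: eq_bigr => k _; rewrite /pF2 addrC.
  rewrite !big_split /= (@sumX (fun e => X2 e (iv a) (iv b)) (fun e => j1 J e (pidx i' j')))//.
  rewrite (@sumX (fun e => X1 e (iv b)) (fun e => j2 J (iv a) e (pidx i' j')))//.
  rewrite (@sumX (fun e => X1 e (iv a)) (fun e => j2 J (iv b) e (pidx i' j')))//.
  rewrite subrBB -!big_split; congr (_ - _); apply: eq_bigr => m _ /=.
  rewrite /pF2 !ME !X1x X2x (J2C (iv b) (iv m)).
  by ring.
Qed.

(** On the locus $g_t = -2\,Ric$, the Lie derivative of Ric cancels the terms in [M0], and the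
    weight l of eta cancels $\tau_t$ by [X1tt]. The remainder is $\tau'' g - L_{\xi_t} g$. *)
Lemma proj_jet_Delta p :
  j1 proj_jet (@it n) p + 2 * DRic J proj_jet (pfst p) (psnd p) =
  l1 (@it n) * j0 J p
  - \sum_k (j0 J (pidx k (pfst p)) * M1 k (psnd p) (@it n)
            + j0 J (pidx k (psnd p)) * M1 k (pfst p) (@it n))
  - \sum_k X1 (iv k) (@it n) * j1 J (iv k) p.
Proof.
have Jt i j : j1 J (@it n) (pidx i j) = - (2 * Ric J i j).
  have /eqP := JD (pidx i j); rewrite /Delta addr_eq0 => /eqP ->.
  rewrite (pidx_sym (S := fun i j => Ric J i j))// => k' l'.
  exact: Ric_sym.
rewrite proj_jet_DRic /= [\sum_(e < n.+1) _]big_ord_recr /= -/(@it n) X1tt.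
set S1 := \sum_k pF1 _ _ _ _.
have -> : S1 = \sum_k (j0 J (pidx k (pfst p)) * M1 k (psnd p) (@it n)
            + j0 J (pidx k (psnd p)) * M1 k (pfst p) (@it n))
    - 2 * \sum_m (M0 m (pfst p) * Ric J m (psnd p) + M0 m (psnd p) * Ric J (pfst p) m).
  rewrite mulr_sumr -sumrB; apply: eq_bigr => k _; rewrite /pF1 !Jt.
  by rewrite (Ric_sym (pfst p) k J2C); ring.
by ring.
Qed.

End ProjectableJets.

Section ProjectableFields.
Context {R : realType} {n : nat}.
Implicit Types (i j k : 'I_n) (c d : 'I_n.+1) (p : Pidx n).

Definition ypart (z : 'rV[R]_(Ndim n)) : 'rV[R]_n.+1 := \row_a z 0 (lshift _ a).

Variable X : 'I_n.+1 -> 'rV[R]_n.+1 -> R.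
Let lamf := pd (X (@it n)) (@it n).
Let Mf k i := pd (X (iv k)) (iv i).

(** The form $\eta = \tau_t g - L_\xi g$ with tau and xi read from functions [X] of (x, t). That tau
    depends on t alone is the separate assumption [Xt]. *)
Definition projectable (V : 'rV[R]_(Ndim n) -> 'rV[R]_(Ndim n)) : Prop :=
  forall z, Dom z ->
    (forall c, V z 0 (lshift _ c) = X c (ypart z)) /\
    (forall p, V z 0 (gp p) = lamf (ypart z) * z 0 (gp p)
      - \sum_k (z 0 (gc k (pfst p)) * Mf k (psnd p) (ypart z)
                + z 0 (gc k (psnd p)) * Mf k (pfst p) (ypart z))).

Variable V : 'rV[R]_(Ndim n) -> 'rV[R]_(Ndim n).
Hypothesis VX : projectable V.
Hypothesis Xs : forall c, smooth_on setT (X c).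
Hypothesis Xt : forall k y, pd (X (@it n)) (iv k) y = 0.
Variable u : Pidx n -> 'rV[R]_n.+1 -> R.
Hypothesis us : forall p, smooth_on setT (u p).
Variable y : 'rV[R]_n.+1.
Hypothesis Dy : Dom (zu u y).

Let lams : smooth_on setT lamf. Proof. exact: smooth_pd. Qed.
Let Ms k i : smooth_on setT (Mf k i). Proof. exact: smooth_pd. Qed.

Let sd (f : 'rV[R]_n.+1 -> R) (fs : smooth_on setT f) c y' :
  is_derive y' (delta_mx 0 c) f (pd f c y').
Proof. by apply: pd_isd; exact: (@fs [::] _ I). Qed.

Lemma ypart_zu y' : ypart (zu u y') = y'.
Proof. by apply/rowP => c; rewrite mxE zu_ind. Qed.

Let near_Dom : \forall y' \near y, Dom (zu u y').
Proof. by apply: zu_Dom_near => // p; exact: (@us p [::] _ I). Qed.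

(** The formulas for [V] hold only on [Dom]; to differentiate them at every point close to y, each
    such point needs its own neighbourhood inside [Dom]. *)
Let near_Dom2 : \forall y' \near y, \forall y'' \near y', Dom (zu u y'').
Proof.
apply: (@filterS _ _ (nbhs_filter y) _ _ _ near_Dom) => y' Dy'.
by apply: zu_Dom_near => // p; exact: (@us p [::] _ I).
Qed.

Let F k i j y' : R := u (pidx k i) y' * Mf k j y' + u (pidx k j) y' * Mf k i y'.
Let F1 c k i j y' : R :=
  (pd (u (pidx k i)) c y' * Mf k j y' + u (pidx k i) y' * pd (Mf k j) c y')
  + (pd (u (pidx k j)) c y' * Mf k i y' + u (pidx k j) y' * pd (Mf k i) c y').
Let dE p c y' : R := (pd lamf c y' * u p y' + lamf y' * pd (u p) c y')
   - \sum_k F1 c k (pfst p) (psnd p) y'.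
Let J := jet_of u y.
Let X1 c d := pd (X c) d y.
Let X2 e c d := pd (pd (X e) d) c y.
Let l1 c := pd lamf c y.
Let l2 c d := pd (pd lamf d) c y.
Let M0 k i := Mf k i y.
Let M1 k i c := pd (Mf k i) c y.
Let M2 k i c d := pd (pd (Mf k i) d) c y.
Let F2 c d k i j : R := pF2 J M0 M1 M2 c d k i j.
Let ddE p c d : R :=
  ((l2 c d * u p y + l1 d * pd (u p) c y) + (l1 c * pd (u p) d y + lamf y * pd (pd (u p) d) c y))
  - \sum_k F2 c d k (pfst p) (psnd p).

Let VetaE y' p : Dom (zu u y') -> Veta V u p y' =
  lamf y' * u p y' - \sum_k F k (pfst p) (psnd p) y'.
Proof.
move=> D; rewrite /Veta (VX D).2 ypart_zu zu_gp; congr (_ - _).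
by apply: eq_bigr => k _; rewrite /gc !zu_gp.
Qed.

Let isd_Vind e c : \forall y' \near y,
  is_derive y' (delta_mx 0 c) (Vind V u e) (pd (X e) c y').
Proof.
apply: (@filterS _ _ (nbhs_filter y) _ _ _ near_Dom2) => y' D.
apply: (isd_near _ (sd (Xs e) c y')).
apply: (@filterS _ _ (nbhs_filter y') _ _ _ D) => y'' D'.
by rewrite /Vind (VX D').1 ypart_zu.
Qed.

Let isd_Veta p c : \forall y' \near y,
  is_derive y' (delta_mx 0 c) (Veta V u p) (dE p c y').
Proof.
apply: (@filterS _ _ (nbhs_filter y) _ _ _ near_Dom2) => y' D.
have := isd_sub (isd_mul (sd lams c y') (sd (us p) c y'))
  (isd_sum (index_enum _) (fun k => isd_add
    (isd_mul (sd (us (pidx k (pfst p))) c y') (sd (Ms k (psnd p)) c y'))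
    (isd_mul (sd (us (pidx k (psnd p))) c y') (sd (Ms k (pfst p)) c y')))).
apply: isd_near.
by apply: (@filterS _ _ (nbhs_filter y') _ _ _ D) => y'' D'; rewrite VetaE.
Qed.

Let isd_dE p c d : is_derive y (delta_mx 0 c) (dE p d) (ddE p c d).
Proof.
have s1 (f : 'rV[R]_n.+1 -> R) c' : smooth_on setT f -> smooth_on setT (pd f c').
  exact: smooth_pd.
have H := (isd_sub (isd_add
    (isd_mul (sd (s1 _ d lams) c y) (sd (us p) c y))
    (isd_mul (sd lams c y) (sd (s1 _ d (us p)) c y)))
  (isd_sum (index_enum _) (fun k => isd_add
    (isd_add
      (isd_mul (sd (s1 _ d (us (pidx k (pfst p)))) c y) (sd (Ms k (psnd p)) c y))
      (isd_mul (sd (us (pidx k (pfst p))) c y) (sd (s1 _ d (Ms k (psnd p))) c y)))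
    (isd_add
      (isd_mul (sd (s1 _ d (us (pidx k (psnd p)))) c y) (sd (Ms k (pfst p)) c y))
      (isd_mul (sd (us (pidx k (psnd p))) c y) (sd (s1 _ d (Ms k (pfst p))) c y)))))).
refine (is_derive_eq H _).
by rewrite /ddE; congr (_ - _); apply: eq_bigr.
Qed.

Lemma prolong_projectable :
  prolong V u y = proj_jet J (lamf y) l1 l2 X1 X2 M0 M1 M2.
Proof.
have dX e c d : is_derive y (delta_mx 0 c) (pd (X e) d) (X2 e c d).
  exact: (sd (smooth_pd d (Xs e)) c y).
have e0 p : j0 (prolong V u y) p = j0 (proj_jet J (lamf y) l1 l2 X1 X2 M0 M1 M2) p.
  exact: VetaE.
have e1 c p := prolong_j1 us isd_Vind isd_Veta c p.
have e2 c d p := prolong_j2 us isd_Vind dX isd_Veta isd_dE c d p.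
rewrite [LHS](_ : _ = Jet (j0 (prolong V u y)) (j1 (prolong V u y)) (j2 (prolong V u y)))//.
congr Jet; first by apply/funext => p; exact: e0.
- by apply/funext => c; apply/funext => p; rewrite e1.
- by apply/funext => c; apply/funext => d; apply/funext => p; rewrite e2.
Qed.

(** Used in both directions: the right-hand side vanishes identically for the listed fields, and its
    vanishing for all first derivatives of u yields the last determining equations. *)
Lemma projectable_criterion p : (forall p, Delta J p = 0) ->
  derive1 (fun e : R => Delta (jet_axpy J e (prolong V u y)) p) 0 =
  pd lamf (@it n) y * u p y
  - \sum_k (u (pidx k (pfst p)) y * pd (Mf k (psnd p)) (@it n) y
            + u (pidx k (psnd p)) y * pd (Mf k (pfst p)) (@it n) y)
  - \sum_k pd (X (iv k)) (@it n) y * pd (u p) (iv k) y.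
Proof.
move=> JD.
have gJz : gmx J = gmat (zu u y).
  by apply/matrixP => i j; rewrite [LHS]mxE gmatE zu_gp.
have Ju : gmx J \in unitmx by rewrite gJz Dom_unit.
have pd0 c : pd (fun _ : 'rV[R]_n.+1 => 0 : R) c y = 0 := isd_pd (isd_cst _ _ _).
have Xt0 k : pd (X (@it n)) (iv k) = fun _ => 0 by apply/funext => y'; exact: Xt.
have lt0 k : pd lamf (iv k) = fun _ => 0.
  apply/funext => y'; have := @pdC R _ (X (@it n)) (@it n) (iv k) y' (Xs _).
  by rewrite Xt0 => ->; exact: isd_pd (isd_cst _ _ _).
have J2C c d p' : j2 J c d p' = j2 J d c p' := @pdC R _ (u p') d c y (us p').
have h1 k : l1 (iv k) = 0 by rewrite /l1 lt0.
have h2 i j : l2 (iv i) (iv j) = 0 by rewrite /l2 lt0 pd0.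
have h3 i j : X2 (@it n) (iv i) (iv j) = 0 by rewrite /X2 Xt0 pd0.
have h4 k i j : M1 k j (iv i) = M1 k i (iv j) := @pdC R _ (X (iv k)) (iv j) (iv i) y (Xs _).
have h5 k a i j : M2 k j (iv a) (iv i) = M2 k j (iv i) (iv a) :=
  @pdC R _ (Mf k j) (iv i) (iv a) y (Ms k j).
have MfC k i j : pd (Mf k j) (iv i) = pd (Mf k i) (iv j).
  by apply/funext => y'; exact: (@pdC R _ (X (iv k)) (iv j) (iv i) y' (Xs _)).
have h6 k a i j : M2 k j (iv a) (iv i) = M2 k i (iv a) (iv j) :=
  congr1 (fun f => pd f (iv a) y) (MfC k i j).
rewrite prolong_projectable (derive1_Delta _ Ju).
exact: (@proj_jet_Delta _ _ J (lamf y) l1 l2 X1 X2 M0 M1 M2 Ju J2C JD h1 h2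
  (fun k => Xt k y) erefl h3 (fun _ _ => erefl) (fun _ _ _ => erefl) h4 h5 h6 p).
Qed.

End ProjectableFields.

(** * Smoothness under coordinate projections and insertions *)

Section Substitution.
Context {R : realType}.

Lemma differentiable_row (V : normedModType R) k (phi : V -> 'rV[R]_k) x :
  (forall c, differentiable (fun y => phi y 0 c) x) -> differentiable phi x.
Proof.
move=> dphi; rewrite (_ : phi = \sum_c (fun y => phi y 0 c *: delta_mx 0 c)).
  by apply: differentiable_sum => c; apply: differentiableZl.
by apply/funext => y; rewrite fct_sumE -row_sum_delta.
Qed.

Lemma smooth_cst m (D : set 'rV[R]_m) (a : R) : smooth_on D (fun _ => a).
Proof.
move=> s z _; suff [b ->] : exists b : R, pds s (fun _ : 'rV[R]_m => a) = fun _ => b.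
  exact: differentiable_cst.
elim: s => [|i s [b E]] /=; first by exists a.
by exists 0; apply/funext => y; rewrite E; exact: isd_pd (isd_cst _ _ _).
Qed.

Variables (m k : nat) (D : set 'rV[R]_k) (phi : 'rV[R]_m -> 'rV[R]_k).
Variable h : 'I_m -> option 'I_k.
Hypothesis phiD : forall y, D (phi y).
Hypothesis dphi : forall y c, differentiable (fun y => phi y 0 c) y.
Hypothesis phih : forall y i c,
  is_derive y (delta_mx 0 i) (fun y => phi y 0 c) (h i == Some c)%:R.

(** [h i] names the only coordinate of [phi] that moves with the i-th variable, if there is one.
    This covers the projection [xproj] and the insertions [base] and [yemb] at once. *)
Lemma pd_subst (f : 'rV[R]_k -> R) i : smooth_on D f ->
  pd (fun y => f (phi y)) i = fun y => if h i is Some c then pd f c (phi y) else 0.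
Proof.
move=> fs; apply/funext => y; apply: isd_pd.
refine (is_derive_eq (isd_chain (smooth_diff fs (phiD y)) (phih y i)) _).
case: (h i) => [c|]; last by rewrite big1// => c _; rewrite mulr0.
rewrite (bigD1 c) //= eqxx mulr1 big1 ?addr0// => c' /negbTE cc'.
by rewrite (_ : (Some c == Some c') = (c' == c)) ?cc' ?mulr0 // eq_sym.
Qed.

Lemma smooth_subst (f : 'rV[R]_k -> R) : smooth_on D f ->
  smooth_on setT (fun y => f (phi y)).
Proof.
move=> fs s y _; suff [g [gs ->]] : exists g, smooth_on D g /\
    pds s (fun y => f (phi y)) = fun y => g (phi y).
  apply: (@differentiable_comp _ _ _ _ phi g); first exact: differentiable_row.
  exact: (smooth_diff gs (phiD y)).
elim: s => [|i s [g [gs E]]] /=; first by exists f.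
rewrite E (pd_subst i gs); case: (h i) => [c|].
  by exists (pd g c); split => //; exact: smooth_pd.
by exists (fun _ => 0); split => //; exact: smooth_cst.
Qed.

End Substitution.

Section Coordinates.
Context {R : realType} {n : nat}.
Implicit Types (i j k : 'I_n) (c d : 'I_n.+1) (p : Pidx n) (z : 'rV[R]_(Ndim n)).

Lemma iv_neq_it k : (iv k == @it n) = false.
Proof. by apply/eqP => /(congr1 val) /= kn; have := ltn_ord k; rewrite kn ltnn. Qed.

Lemma iv_eq i k : (iv i == iv k) = (i == k).
Proof. by apply/eqP/eqP => [/(congr1 val) /= /val_inj|->]. Qed.

Lemma ind_ind (P : 'I_n.+1 -> Prop) :
  (forall k, P (iv k)) -> P (@it n) -> forall c, P c.
Proof.
move=> Pi Pt c; have [cn|] := ltnP c n.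
  by have := Pi (Ordinal cn); congr P; apply: val_inj.
move=> nc; rewrite (_ : c = @it n)//; apply: val_inj => /=.
by apply/eqP; rewrite eqn_leq nc -ltnS ltn_ord.
Qed.

Lemma ecoord_l c d : ecoord R (lshift _ c : 'I_(Ndim n)) 0 (lshift _ d) = (d == c)%:R.
Proof. by rewrite mxE eqxx eq_lshift. Qed.

Lemma ecoord_lr c p : ecoord R (lshift _ c : 'I_(Ndim n)) 0 (gp p) = 0.
Proof. by rewrite mxE eqxx /gp eq_rlshift. Qed.

Lemma ecoord_rl c p : ecoord R (gp p) 0 (lshift _ c : 'I_(Ndim n)) = 0.
Proof. by rewrite mxE eqxx /gp eq_lrshift. Qed.

Lemma ecoord_r p q : ecoord R (gp p) 0 (gp q) = (q == p)%:R.
Proof. by rewrite mxE eqxx /gp eq_rshift (inj_eq enum_rank_inj). Qed.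

Variables (c1 c2 : R) (xi : 'rV[R]_n -> 'rV[R]_n).
Let W z := c1 *: X1 R n + c2 *: X2 z + Xxi xi z.

Let sum_l (F : Pidx n -> R) c :
  (\sum_p F p *: ecoord R (gp p)) 0 (lshift _ c : 'I_(Ndim n)) = 0.
Proof. by rewrite summxE big1// => p _; rewrite mxE ecoord_rl mulr0. Qed.

Let sum_r (F : Pidx n -> R) p : (\sum_q F q *: ecoord R (gp q)) 0 (gp p) = F p.
Proof.
rewrite summxE (bigD1 p) //= mxE ecoord_r eqxx mulr1 big1 ?addr0// => q /negbTE qp.
by rewrite mxE ecoord_r eq_sym qp mulr0.
Qed.

Let WE z e : W z 0 e = c1 * ecoord R (tc n) 0 e
  + c2 * (z 0 (tc n) * ecoord R (tc n) 0 e
          + (\sum_p z 0 (gp p) *: ecoord R (gp p)) 0 e)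
  + (\sum_k xi (xpart z) 0 k * ecoord R (xc k) 0 e
     - (\sum_p (\sum_k (z 0 (gc k (pfst p)) * pd (fun x => xi x 0 k) (psnd p) (xpart z)
            + z 0 (gc k (psnd p)) * pd (fun x => xi x 0 k) (pfst p) (xpart z)))
          *: ecoord R (gp p)) 0 e).
Proof.
have -> : \sum_k xi (xpart z) 0 k * ecoord R (xc k) 0 e
    = (\sum_k xi (xpart z) 0 k *: ecoord R (xc k)) 0 e.
  by rewrite summxE; apply: eq_bigr => k _; rewrite [RHS]mxE.
have addE (A B : 'rV[R]_(Ndim n)) : (A + B) 0 e = A 0 e + B 0 e by rewrite mxE.
have oppE (A : 'rV[R]_(Ndim n)) : (- A) 0 e = - A 0 e by rewrite mxE.
have scaleE a (A : 'rV[R]_(Ndim n)) : (a *: A) 0 e = a * A 0 e by rewrite mxE.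
by rewrite /W /X1 /X2 /Xxi !addE !scaleE addE scaleE oppE.
Qed.

Lemma field_t z : W z 0 (tc n) = c1 + c2 * z 0 (tc n).
Proof.
rewrite WE !sum_l ecoord_l eqxx !mulr1 big1 ?subr0 ?addr0// => k _.
by rewrite ecoord_l eq_sym iv_neq_it mulr0.
Qed.

Lemma field_x z k : W z 0 (xc k) = xi (xpart z) 0 k.
Proof.
rewrite WE !sum_l ecoord_l iv_neq_it !(mulr0, addr0, add0r, subr0).
rewrite (bigD1 k) //= ecoord_l eqxx mulr1 big1 ?addr0// => i /negbTE ik.
by rewrite ecoord_l iv_eq eq_sym ik mulr0.
Qed.

Lemma field_g z p : W z 0 (gp p) = c2 * z 0 (gp p)
  - \sum_k (z 0 (gc k (pfst p)) * pd (fun x => xi x 0 k) (psnd p) (xpart z)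
            + z 0 (gc k (psnd p)) * pd (fun x => xi x 0 k) (pfst p) (xpart z)).
Proof.
rewrite WE !sum_r ecoord_lr !(mulr0, addr0, add0r) big1 ?add0r// => k _.
by rewrite ecoord_lr mulr0.
Qed.

End Coordinates.

(** * The listed fields are symmetries *)

Section Sufficiency.
Context {R : realType} {n : nat}.
Implicit Types (i j k : 'I_n) (c d : 'I_n.+1) (p : Pidx n) (z : 'rV[R]_(Ndim n)).

Definition xproj (y : 'rV[R]_n.+1) : 'rV[R]_n := \row_k y 0 (iv k).

Definition spatial c : option 'I_n := insub (val c).

Lemma spatial_iv k : spatial (iv k) = Some k.
Proof. by rewrite /spatial /= valK. Qed.

Lemma spatial_it : spatial (@it n) = None.
Proof. by rewrite /spatial insubF //= ltnn. Qed.

Lemma isd_xproj (y : 'rV[R]_n.+1) c k :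
  is_derive y (delta_mx 0 c) (fun y => xproj y 0 k) (spatial c == Some k)%:R.
Proof.
under eq_fun do rewrite mxE.
rewrite (_ : (spatial c == Some k) = (iv k == c)); first exact: isd_coord.
move: c; apply: ind_ind => [i|]; last by rewrite spatial_it iv_neq_it.
by rewrite spatial_iv iv_eq eq_sym.
Qed.

Lemma xproj_differentiable (y : 'rV[R]_n.+1) k :
  differentiable (fun y => xproj y 0 k) y.
Proof. by under eq_fun do rewrite mxE; exact: differentiable_coord. Qed.

Lemma pd_xproj (f : 'rV[R]_n -> R) c : smooth_on setT f ->
  pd (fun y => f (xproj y)) c
  = fun y => if spatial c is Some k then pd f k (xproj y) else 0.
Proof. by move=> fs; apply: (pd_subst (D := setT)) => //; exact: isd_xproj. Qed.

Variables (c1 c2 : R) (xi : 'rV[R]_n -> 'rV[R]_n).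
Hypothesis xis : smooth_xi xi.

(** The affine function $c_1 + c_2 t$, encoded as a [quad] to inherit its smoothness and
    derivatives. *)
Let T : 'rV[R]_n.+1 -> R :=
  quad 0 c1 (fun d => c2 * (d == @it n)%:R) (fun _ _ => 0).
Let X c (y : 'rV[R]_n.+1) : R :=
  if spatial c is Some k then xi (xproj y) 0 k else T y.

Let Xi k : X (iv k) = fun y => xi (xproj y) 0 k.
Proof. by apply/funext => y; rewrite /X spatial_iv. Qed.

Let Xt : X (@it n) = T.
Proof. by apply/funext => y; rewrite /X spatial_it. Qed.

Let TE y : T y = c1 + c2 * y 0 (@it n).
Proof.
rewrite /T /quad (bigD1 (@it n)) //= big1; last first.
  by move=> d /negbTE ->; rewrite mulr0 mul0r.
rewrite eqxx mulr1 mxE subr0 addr0 big1 ?mulr0 ?addr0// => c _.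
by rewrite big1// => d _; rewrite mul0r.
Qed.

Let pdT c : pd T c = fun _ => c2 * (c == @it n)%:R.
Proof.
rewrite /T pd_quad//; apply/funext => y; rewrite /quad !big1 ?mulr0 ?addr0// => d _.
  by rewrite big1// => ? _; rewrite mul0r.
by rewrite mul0r.
Qed.

Let Xs c : smooth_on setT (X c).
Proof.
move: c; apply: ind_ind => [k|]; last by rewrite Xt; exact: quad_smooth.
rewrite Xi; exact: (@smooth_subst R _ _ setT xproj spatial (fun _ => I)
  xproj_differentiable isd_xproj (fun x => xi x 0 k) (xis k)).
Qed.

Let pd_cst0 c (a : R) y : pd (fun _ : 'rV[R]_n.+1 => a) c y = 0.
Proof. exact: isd_pd (isd_cst _ _ _). Qed.

Let pdXi k i : pd (X (iv k)) (iv i) = fun y => pd (fun x => xi x 0 k) i (xproj y).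
Proof. by rewrite Xi (pd_xproj _ (xis k)) spatial_iv. Qed.

Lemma field_is_symmetry V :
  (forall z, Dom z -> V z = c1 *: X1 R n + c2 *: X2 z + Xxi xi z) ->
  is_symmetry V.
Proof.
move=> VE u us y Dy uD p.
have xz z : xproj (ypart z) = xpart z by apply/rowP => k; rewrite !mxE.
have VX : projectable X V.
  move=> z Dz; rewrite (VE z Dz); split => [|q].
    apply: ind_ind => [k|]; first by rewrite field_x Xi xz.
    by rewrite field_t Xt TE mxE.
  rewrite field_g Xt pdT eqxx mulr1; congr (_ - _); apply: eq_bigr => k _.
  by rewrite !pdXi xz.
have X0 k y' : pd (X (@it n)) (iv k) y' = 0 by rewrite Xt pdT iv_neq_it mulr0.
rewrite (projectable_criterion VX Xs X0 us Dy p uD).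
have M0 k i : pd (pd (X (iv k)) (iv i)) (@it n) y = 0.
  by rewrite pdXi (pd_xproj _ (smooth_pd i (xis k))) spatial_it.
rewrite Xt pdT pd_cst0 mul0r !big1 ?subr0// => k _.
  by rewrite Xi (pd_xproj _ (xis k)) spatial_it mul0r.
by rewrite !M0 !mulr0 addr0.
Qed.

End Sufficiency.

(** * The determining equations *)

Section PrincipalPart.
Context {R : realType} {n : nat}.
Implicit Types (i j k l : 'I_n) (G : 'M[R]_n) (H : 'I_n -> 'I_n -> 'I_n -> 'I_n -> R).
Implicit Types (a b v : 'I_n -> R) (h : 'I_n -> 'I_n -> R).

(* The part of the Ricci tensor that is linear in H k l i j = d_k d_l g_ij. *)
Definition principal G H i j : R := 2^-1 * \sum_k \sum_l G k l *
  (H k i j l + H k j i l - H k l i j - H j i k l).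

Lemma principal_sym G H i j : (forall k l i j, H k l i j = H l k i j) ->
  (forall k l i j, H k l i j = H k l j i) -> principal G H i j = principal G H j i.
Proof.
move=> HC HC'; congr (_ * _); apply: eq_bigr => k _; apply: eq_bigr => l _.
by rewrite (HC' k l i j) (HC j i); ring.
Qed.

Lemma eq_principal G H H' i j : (forall k l i j, H k l i j = H' k l i j) ->
  principal G H i j = principal G H' i j.
Proof.
by move=> HH; congr (_ * _); apply: eq_bigr => k _; apply: eq_bigr => l _; rewrite !HH.
Qed.

Lemma principal_add G H H' i j :
  principal G (fun k l i j => H k l i j + H' k l i j) i j = principal G H i j + principal G H' i j.
Proof.
rewrite /principal -mulrDr -big_split; congr (_ * _); apply: eq_bigr => k _ /=.
by rewrite -big_split; apply: eq_bigr => l _ /=; ring.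
Qed.

Lemma principal_scale G (c : R) H i j :
  principal G (fun k l i j => c * H k l i j) i j = c * principal G H i j.
Proof.
rewrite /principal mulrCA; congr (_ * _); rewrite mulr_sumr; apply: eq_bigr => k _.
by rewrite mulr_sumr; apply: eq_bigr => l _; ring.
Qed.

Definition dot a G b : R := \sum_k \sum_l a k * G k l * b l.
Definition pairing a v : R := \sum_i a i * v i.
Definition qform v h : R := \sum_i \sum_j v i * v j * h i j.
(** The two covectors sit in the two derivative slots. For different a and b the result is not
    symmetric in these slots; only sums such as [rank1 w Z h] plus [rank1 Z w h] occur as
    Hessians. *)
Definition rank1 a b h : 'I_n -> 'I_n -> 'I_n -> 'I_n -> R :=
  fun k i j l => a k * b i * h j l.

Lemma principal_rank1 G a b h i j : principal G (rank1 a b h) i j =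
  2^-1 * (b i * dot a G (h j) + b j * dot a G (h i) - dot a G b * h i j
          - a j * b i * \sum_k \sum_l G k l * h k l).
Proof.
rewrite /principal /dot; congr (_ * _); rewrite mulr_suml !mulr_sumr -!sumrN -!big_split.
apply: eq_bigr => k _ /=; rewrite mulr_suml !mulr_sumr -!sumrN -!big_split.
by apply: eq_bigr => l _; rewrite /= /rank1; ring.
Qed.

Lemma qform_add v h h' :
  qform v (fun i j => h i j + h' i j) = qform v h + qform v h'.
Proof.
rewrite /qform -big_split; apply: eq_bigr => i _ /=.
by rewrite -big_split; apply: eq_bigr => j _ /=; ring.
Qed.

Lemma qform_scale v (c : R) h : qform v (fun i j => c * h i j) = c * qform v h.
Proof.
rewrite /qform mulr_sumr; apply: eq_bigr => i _.
by rewrite mulr_sumr; apply: eq_bigr => j _ /=; ring.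
Qed.

Lemma qform_mul v a b : qform v (fun i j => a i * b j) = pairing a v * pairing b v.
Proof.
rewrite /qform /pairing big_distrl; apply: eq_bigr => i _ /=; rewrite mulr_sumr.
by apply: eq_bigr => j _; ring.
Qed.

Lemma eq_qform v h h' : (forall i j, h i j = h' i j) -> qform v h = qform v h'.
Proof. by move=> E; apply: eq_bigr => i _; apply: eq_bigr => j _; rewrite E. Qed.

(** The hypothesis kills the trace term $a(v)\,b(v)\,\mathrm{tr}\,h$ of the symbol. *)
Lemma qform_principal_rank1 G a b h v : pairing a v * pairing b v = 0 ->
  qform v (principal G (rank1 a b h)) =
  pairing b v * pairing (fun j => dot a G (h j)) v - 2^-1 * dot a G b * qform v h.
Proof.
move=> ab; rewrite (eq_qform (h' := fun i j => 2^-1 * (b i * dot a G (h j))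
   + (2^-1 * (dot a G (h i) * b j) + (- (2^-1 * dot a G b) * h i j
     + (- (2^-1 * \sum_k \sum_l G k l * h k l)) * (b i * a j)))) v); last first.
  by move=> i j; rewrite principal_rank1; ring.
rewrite !(qform_add, qform_scale, qform_mul) [pairing b v * pairing a v]mulrC ab.
by field.
Qed.

Lemma dotC G a b : (forall k l, G k l = G l k) -> dot a G b = dot b G a.
Proof.
move=> GC; rewrite /dot exchange_big; apply: eq_bigr => k _; apply: eq_bigr => l _.
by rewrite GC; ring.
Qed.

End PrincipalPart.

(** * Differences of Ric and of its variation at equal lower order *)

Section RicciDifference.
Context {R : realType} {n : nat}.
Variables J J' K K' : jet R n.
Hypothesis J0 : forall p, j0 J p = j0 J' p.
Hypothesis J1 : forall k p, j1 J (iv k) p = j1 J' (iv k) p.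
Implicit Types i j k l : 'I_n.

Let giJJ : giJ J = giJ J'.
Proof. by congr invmx; apply/matrixP => i j; rewrite !mxE /gJ J0. Qed.

Let dgJ a i j : dg J a i j = dg J' a i j. Proof. exact: J1. Qed.

Let dgiJ a k l : dgi J a k l = dgi J' a k l.
Proof.
rewrite /dgi giJJ; congr (- _); apply: eq_bigr => b _; apply: eq_bigr => c _.
by rewrite dgJ.
Qed.

Let GamJ k i j : Gam J k i j = Gam J' k i j.
Proof. by rewrite /Gam giJJ; congr (_ * _); apply: eq_bigr => l _; rewrite !dgJ. Qed.

Lemma principal_sum (G : 'M[R]_n) (H : 'I_n -> 'I_n -> 'I_n -> 'I_n -> R) i j :
  (forall k l, G k l = G l k) ->
  \sum_k (2^-1 * \sum_l G k l * (H k i j l + H k j i l - H k l i j))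
  - \sum_k (2^-1 * \sum_l G k l * (H j i k l + H j k i l - H j l i k)) = principal G H i j.
Proof.
move=> GC; rewrite /principal -!mulr_sumr -mulrBr; congr (_ * _).
have A : \sum_k \sum_l G k l * (H j k i l - H j l i k) = 0.
  set S := \sum_k _; have : S = - S.
    rewrite {1}/S exchange_big -sumrN; apply: eq_bigr => k _; rewrite -sumrN.
    by apply: eq_bigr => l _; rewrite (GC l k); ring.
  by move/eqP; rewrite -addr_eq0 -mulr2n mulrn_eq0 /= => /eqP.
rewrite -[RHS]subr0 -[X in _ = _ - X]A -!sumrB; apply: eq_bigr => k _.
by rewrite -!sumrB; apply: eq_bigr => l _; ring.
Qed.

Lemma Ric_diff i j : Ric J i j - Ric J' i j =
  principal (giJ J) (fun a b i j => ddg J a b i j - ddg J' a b i j) i j.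
Proof.
have dG a k i' j' : dGam J a k i' j' = dGam J' a k i' j'
    + 2^-1 * \sum_l giJ J k l * (ddg J a i' j' l - ddg J' a i' j' l
       + (ddg J a j' i' l - ddg J' a j' i' l) - (ddg J a l i' j' - ddg J' a l i' j')).
  rewrite /dGam -mulrDr -big_split; congr (_ * _); apply: eq_bigr => l _ /=.
  by rewrite !dgiJ !dgJ giJJ; ring.
rewrite -principal_sum; last exact: giJ_sym.
rewrite /Ric; under eq_bigr => k _ do rewrite dG.
under [X in _ - X + _ - _]eq_bigr => k _ do rewrite dG.
rewrite !big_split /=.
set S := \sum_k \sum_l _; have -> : S = \sum_k \sum_l
    (Gam J' k k l * Gam J' l i j - Gam J' k j l * Gam J' l i k).
  by apply: eq_bigr => k _; apply: eq_bigr => l _; rewrite !GamJ.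
by ring.
Qed.

Hypothesis K0 : forall p, j0 K p = j0 K' p.
Hypothesis K1 : forall k p, j1 K (iv k) p = j1 K' (iv k) p.

Let DGJ : DG J K = DG J' K'.
Proof.
by rewrite /DG giJJ; congr (- (_ *m _ *m _)); apply/matrixP => i j; rewrite !mxE /gJ K0.
Qed.

Let dgmxJ a : dgmx J a = dgmx J' a.
Proof. by apply/matrixP => i j; rewrite !mxE dgJ. Qed.

Let dgmxK a : dgmx K a = dgmx K' a.
Proof. by apply/matrixP => i j; rewrite !mxE /dg K1. Qed.

Let DgiJ a : Ddgi J K a = Ddgi J' K' a.
Proof. by rewrite /Ddgi DGJ giJJ dgmxJ dgmxK. Qed.

Let chrJ i j l : chr J i j l = chr J' i j l. Proof. by rewrite /chr !dgJ. Qed.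
Let chrK i j l : chr K i j l = chr K' i j l. Proof. by rewrite /chr /dg !K1. Qed.

Let DGamJ k i j : DGam J K k i j = DGam J' K' k i j.
Proof.
rewrite /DGam DGJ giJJ; congr (_ * _); apply: eq_bigr => l _.
by rewrite chrJ chrK.
Qed.

(** Everything quadratic in first derivatives is common to both sides. What remains are the two
    Leibniz terms: varied inverse metric times Hessians of J, and inverse metric times Hessians of
    K. Time derivatives are unconstrained because Ric does not see them. *)
Lemma DRic_diff i j : DRic J K i j - DRic J' K' i j =
  principal (DG J K) (fun a b i j => ddg J a b i j - ddg J' a b i j) i j
  + principal (giJ J) (fun a b i j => ddg K a b i j - ddg K' a b i j) i j.
Proof.
have dG a k i' j' : DdGam J K a k i' j' = DdGam J' K' a k i' j'
    + 2^-1 * \sum_l DG J K k l * (ddg J a i' j' l - ddg J' a i' j' l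
       + (ddg J a j' i' l - ddg J' a j' i' l) - (ddg J a l i' j' - ddg J' a l i' j'))
    + 2^-1 * \sum_l giJ J k l * (ddg K a i' j' l - ddg K' a i' j' l
       + (ddg K a j' i' l - ddg K' a j' i' l) - (ddg K a l i' j' - ddg K' a l i' j')).
  rewrite /DdGam -!mulrDr -!big_split; congr (_ * _); apply: eq_bigr => l _ /=.
  by rewrite DgiJ !dgiJ chrJ chrK DGJ giJJ /dchr; ring.
have DGC k l : DG J K k l = DG J K l k.
  have -> : DG J K l k = (DG J K)^T k l by rewrite [RHS]mxE.
  suff -> : (DG J K)^T = DG J K by [].
  rewrite /DG raddfN /= !trmx_mul mulmxA.
  have -> : (giJ J)^T = giJ J by apply/matrixP => a b; rewrite [LHS]mxE giJ_sym.
  by congr (- (_ *m _ *m _)); apply/matrixP => a b; rewrite !mxE /gJ pidxC.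
rewrite -!principal_sum; [|exact: giJ_sym|exact: DGC].
rewrite /DRic; under eq_bigr => k _ do rewrite dG.
under [X in _ - X + _ - _]eq_bigr => k _ do rewrite dG.
rewrite !big_split /=.
set S := \sum_k \sum_l _; have -> : S = \sum_k \sum_l
    ((DGam J' K' k k l * Gam J' l i j + Gam J' k k l * DGam J' K' l i j)
      - (DGam J' K' k j l * Gam J' l i k + Gam J' k j l * DGam J' K' l i k)).
  by apply: eq_bigr => k _; apply: eq_bigr => l _; rewrite !GamJ !DGamJ.
by ring.
Qed.

End RicciDifference.

(** * Prolongation of an arbitrary field as a function of the 2-jet *)

Section GeneralProlongation.
Context {R : realType} {n : nat}.
Implicit Types (i j k : 'I_n) (a b c d : 'I_n.+1) (p q : Pidx n) (J : jet R n).

Section Formula.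
Variables (eta0 : Pidx n -> R) (F : 'I_(Ndim n) -> 'I_(Ndim n) -> R)
  (S : 'I_(Ndim n) -> 'I_(Ndim n) -> 'I_(Ndim n) -> R) (J : jet R n).

(** Total derivative of a function with gradient f, the derivatives of u being read from the jet;
    [tot2] is the second-order analogue. *)
Definition tot1 (f : 'I_(Ndim n) -> R) a : R :=
  f (lshift _ a) + \sum_q f (gp q) * j1 J a q.

Definition tot2 e a b : R :=
  tot1 (S e (lshift _ b)) a + \sum_q tot1 (S e (gp q)) a * j1 J b q
  + \sum_q F e (gp q) * j2 J a b q.

(* F e e' and S e e' e'' stand for the first and second partial derivatives of the
   e-th component of the field. *)
Definition gen_jet : jet R n := Jet eta0
  (fun a p => tot1 (F (gp p)) a - \sum_e tot1 (F (lshift _ e)) a * j1 J e p)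
  (fun a b p => tot2 (gp p) a b
     - \sum_e (tot2 (lshift _ e) a b * j1 J e p + tot1 (F (lshift _ e)) b * j2 J a e p
               + tot1 (F (lshift _ e)) a * j2 J b e p)).
End Formula.

Variable V : 'rV[R]_(Ndim n) -> 'rV[R]_(Ndim n).
Hypothesis Vs : smooth_vf V.

Definition vcoef (e : 'I_(Ndim n)) : 'rV[R]_(Ndim n) -> R := fun z => V z 0 e.

Definition vf_jet J (z : 'rV[R]_(Ndim n)) : jet R n :=
  gen_jet (fun p => vcoef (gp p) z) (fun e e' => pd (vcoef e) e' z)
    (fun e e' e'' => pd (pd (vcoef e) e') e'' z) J.

Lemma prolong_gen u y : (forall p, smooth_on setT (u p)) -> Dom (zu u y) ->
  prolong V u y = vf_jet (jet_of u y) (zu u y).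
Proof.
move=> us Dy.
have du p s y' : differentiable (pds s (u p)) y' by exact: (us p s y' I).
have tot (f : 'rV[R]_(Ndim n) -> R) a y' : smooth_on (@Dom R n) f -> Dom (zu u y') ->
    is_derive y' (delta_mx 0 a) (fun y => f (zu u y)) (pd f (lshift _ a) (zu u y')
     + \sum_(p : Pidx n) pd f (gp p) (zu u y') * pd (u p) a y').
  move=> fs D; apply: isd_zu; first exact: (smooth_diff fs D).
  by move=> p; exact: (du p [::]).
have near_Dom : \forall y' \near y, Dom (zu u y').
  by apply: zu_Dom_near => // p; exact: (du p [::]).
pose dF e b y' : R := pd (vcoef e) (lshift _ b) (zu u y')
  + \sum_q pd (vcoef e) (gp q) (zu u y') * pd (u q) b y'.
have D1 e b : \forall y' \near y,
    is_derive y' (delta_mx 0 b) (fun y => vcoef e (zu u y)) (dF e b y').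
  apply: (@filterS _ _ (nbhs_filter y) _ _ _ near_Dom) => y' D.
  exact: (tot (vcoef e) b y' (Vs e) D).
have D2 e a b : is_derive y (delta_mx 0 a) (dF e b)
    (tot2 (fun e e' => pd (vcoef e) e' (zu u y))
      (fun e e' e'' => pd (pd (vcoef e) e') e'' (zu u y)) (jet_of u y) e a b).
  have H := isd_add (tot _ a y (smooth_pd (lshift _ b) (Vs e)) Dy)
   (isd_sum (index_enum _) (fun q : Pidx n =>
     isd_mul (tot _ a y (smooth_pd (gp q) (Vs e)) Dy) (pd_isd a (du q [:: b] y)))).
  refine (is_derive_eq H _).
  by rewrite /tot2 big_split [LHS]addrA.
have e1 c p := prolong_j1 us (fun e b => D1 (lshift _ e) b) (fun p b => D1 (gp p) b) c p.
have e2 c d p := prolong_j2 us (fun e b => D1 (lshift _ e) b)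
  (fun e a b => D2 (lshift _ e) a b) (fun p b => D1 (gp p) b)
  (fun p a b => D2 (gp p) a b) c d p.
rewrite [LHS](_ : _ = Jet (j0 (prolong V u y)) (j1 (prolong V u y)) (j2 (prolong V u y)))//.
congr Jet.
- by apply/funext => c; apply/funext => p; rewrite e1.
- by apply/funext => c; apply/funext => d; apply/funext => p; rewrite e2.
Qed.

Lemma jet_realize (y : 'rV[R]_n.+1) J : (forall c d p, j2 J c d p = j2 J d c p) ->
  exists u : Pidx n -> 'rV[R]_n.+1 -> R,
    (forall p, smooth_on setT (u p)) /\ jet_of u y = J.
Proof.
move=> JC.
exists (fun p => quad y (j0 J p) (fun c => j1 J c p) (fun c d => j2 J c d p)).
split=> [p|]; first by apply: quad_smooth => c d; exact: JC.
rewrite /jet_of [RHS](_ : J = Jet (j0 J) (j1 J) (j2 J)); last by case: (J).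
congr Jet.
- by apply/funext => p; rewrite quad_at.
- apply/funext => c; apply/funext => p.
  rewrite pd_quad ?quad_at// => ? ?; exact: JC.
- apply/funext => c; apply/funext => d; apply/funext => p.
  rewrite pd_quad; last by move=> ? ?; exact: JC.
  by rewrite pd_quad// quad_at JC.
Qed.

Hypothesis Vsym : is_symmetry V.

(** Moves the criterion from functions to abstract jets: the quadratic polynomial realizing [J] has
    to satisfy the equation at one point only. *)
Lemma jet_criterion J (z : 'rV[R]_(Ndim n)) p : Dom z ->
  (forall p, j0 J p = z 0 (gp p)) -> (forall c d p, j2 J c d p = j2 J d c p) ->
  (forall p, Delta J p = 0) ->
  j1 (vf_jet J z) (@it n) p + 2 * DRic J (vf_jet J z) (pfst p) (psnd p) = 0.
Proof.
move=> Dz J0 JC JD.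
have [u [us uJ]] := jet_realize (ypart z) JC.
have uz : zu u (ypart z) = z.
  apply/rowP; apply: Ndim_ind => [c|q]; first by rewrite zu_ind mxE.
  by rewrite zu_gp -J0 -uJ.
have Dy : Dom (zu u (ypart z)) by rewrite uz.
have Ju : gmx J \in unitmx.
  have -> : gmx J = gmat z by apply/matrixP => i j; rewrite [LHS]mxE gmatE /gJ J0.
  exact: Dom_unit.
have := Vsym us Dy; rewrite uJ => /(_ JD p).
by rewrite (prolong_gen us Dy) uJ uz (derive1_Delta _ Ju).
Qed.

End GeneralProlongation.

(** * Free parametrization of the jets on the equation locus *)

Section TestJets.
Context {R : realType} {n : nat}.
Implicit Types (i j k a b : 'I_n) (c d e : 'I_n.+1) (p q : Pidx n).
Variable z : 'rV[R]_(Ndim n).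
Implicit Types (P W : 'I_n -> Pidx n -> R) (H : 'I_n -> 'I_n -> Pidx n -> R).

Definition base_jet P H W (r : Pidx n -> R) : jet R n := Jet
  (fun p => z 0 (gp p))
  (fun c p => if spatial c is Some k then P k p else r p)
  (fun c d p => match spatial c, spatial d with
    | Some i, Some j => H i j p
    | Some i, None => W i p
    | None, Some j => W j p
    | None, None => 0
    end).

(** Ric ignores mixed and time derivatives, so zero placeholders avoid a circular definition. *)
Definition locus_dt P H p : R :=
  - (2 * Ric (base_jet P H (fun _ _ => 0) (fun _ => 0)) (pfst p) (psnd p)).

(* The time derivatives are chosen so that the jet lies on the equation locus. *)
Definition test_jet P H W : jet R n := base_jet P H W (locus_dt P H).

Lemma test_jet1x P H W k p : j1 (test_jet P H W) (iv k) p = P k p.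
Proof. by rewrite /= spatial_iv. Qed.

Lemma test_jet1t P H W p : j1 (test_jet P H W) (@it n) p = locus_dt P H p.
Proof. by rewrite /= spatial_it. Qed.

Lemma test_jet2xx P H W i j p : j2 (test_jet P H W) (iv i) (iv j) p = H i j p.
Proof. by rewrite /= !spatial_iv. Qed.

Lemma test_jet_sym P H W : (forall i j p, H i j p = H j i p) ->
  forall c d p, j2 (test_jet P H W) c d p = j2 (test_jet P H W) d c p.
Proof. by move=> HC c d p /=; case: (spatial c) (spatial d) => [i|] [j|]. Qed.

Lemma principal_zero (G : 'M[R]_n) (H : 'I_n -> 'I_n -> 'I_n -> 'I_n -> R) i j :
  (forall a b i j, H a b i j = 0) -> principal G H i j = 0.
Proof.
by move=> H0; rewrite /principal big1 ?mulr0// => k _; rewrite big1// => l _; rewrite !H0; ring.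
Qed.

Lemma test_jet_Delta P H W p : Delta (test_jet P H W) p = 0.
Proof.
rewrite /Delta test_jet1t /locus_dt; set B := base_jet P H _ _.
suff -> : Ric (test_jet P H W) (pfst p) (psnd p) = Ric B (pfst p) (psnd p) by rewrite addNr.
apply/eqP; rewrite -subr_eq0 Ric_diff//; last by move=> k q; rewrite /= spatial_iv.
rewrite principal_zero// => a b i j.
by rewrite /ddg /= !spatial_iv subrr.
Qed.

Lemma gmx_tj P H W : gmx (test_jet P H W) = gmat z.
Proof. by apply/matrixP => i j; rewrite [LHS]mxE gmatE. Qed.

Lemma giJ_tj P H W : giJ (test_jet P H W) = invmx (gmat z).
Proof. by rewrite -(gmx_tj P H W). Qed.

Definition zero1 : 'I_n -> Pidx n -> R := fun _ _ => 0.
Definition zero2 : 'I_n -> 'I_n -> Pidx n -> R := fun _ _ _ => 0.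

Variable V : 'rV[R]_(Ndim n) -> 'rV[R]_(Ndim n).
Hypothesis Vs : smooth_vf V.
Hypothesis Vsym : is_symmetry V.
Hypothesis Dz : Dom z.

Lemma test_jet_criterion P H W p : (forall i j p, H i j p = H j i p) ->
  j1 (vf_jet V (test_jet P H W) z) (@it n) p + 2 * DRic (test_jet P H W) (vf_jet V (test_jet P H W) z) (pfst p) (psnd p) = 0.
Proof.
move=> HC; apply: jet_criterion => //; first exact: test_jet_sym.
by move=> q; exact: test_jet_Delta.
Qed.

End TestJets.

(** * The parts of the criterion linear in W and in H *)

Section AlgebraicCriterion.
Context {R : realType} {n : nat}.
Implicit Types (i j k a b : 'I_n) (c d e : 'I_n.+1) (p q : Pidx n).
Implicit Types (P W : 'I_n -> Pidx n -> R) (H : 'I_n -> 'I_n -> Pidx n -> R).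
Variables (z : 'rV[R]_(Ndim n)) (eta0 : Pidx n -> R)
  (F : 'I_(Ndim n) -> 'I_(Ndim n) -> R)
  (S : 'I_(Ndim n) -> 'I_(Ndim n) -> 'I_(Ndim n) -> R).
Let G := invmx (gmat z).
Let test_jet P H W := test_jet z P H W.
Let K P H W := gen_jet eta0 F S (test_jet P H W).
Hypothesis test_jet_crit : forall P H W p, (forall i j p, H i j p = H j i p) ->
  j1 (K P H W) (@it n) p + 2 * DRic (test_jet P H W) (K P H W) (pfst p) (psnd p) = 0.

Let zeta P (e : 'I_(Ndim n)) a : R := F e (xc a) + \sum_q F e (gp q) * P a q.

Let tot1x P H W (e : 'I_(Ndim n)) a : tot1 (test_jet P H W) (F e) (iv a) = zeta P e a.
Proof. by rewrite /tot1 /zeta; congr (_ + _); apply: eq_bigr => q _; rewrite test_jet1x. Qed.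

(** The part of the second total derivative of a component that does not contain the Hessian of
    g. *)
Let sec P (e : 'I_(Ndim n)) a b : R :=
  (S e (xc b) (xc a) + \sum_q S e (xc b) (gp q) * P a q)
  + \sum_q (S e (gp q) (xc a) + \sum_q' S e (gp q) (gp q') * P a q') * P b q.

Let tot2x P H W (e : 'I_(Ndim n)) a b : tot2 F S (test_jet P H W) e (iv a) (iv b) =
  sec P e a b + \sum_q F e (gp q) * H a b q.
Proof.
have T f : tot1 (test_jet P H W) f (iv a) = f (xc a) + \sum_q f (gp q) * P a q.
  by rewrite /tot1; congr (_ + _); apply: eq_bigr => q _; rewrite test_jet1x.
rewrite /tot2 T; congr (_ + _ + _); last by apply: eq_bigr => q _; rewrite test_jet2xx.
by apply: eq_bigr => q _; rewrite T test_jet1x.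
Qed.

Let K2x P H W a b p : j2 (K P H W) (iv a) (iv b) p =
  sec P (gp p) a b + \sum_q F (gp p) (gp q) * H a b q
  - (\sum_k ((sec P (xc k) a b + \sum_q F (xc k) (gp q) * H a b q) * P k p
              + zeta P (xc k) b * H a k p + zeta P (xc k) a * H b k p)
     + ((sec P (tc n) a b + \sum_q F (tc n) (gp q) * H a b q) * locus_dt z P H p
        + zeta P (tc n) b * W a p + zeta P (tc n) a * W b p)).
Proof.
rewrite -(tot2x P H W (gp p)) [LHS]/=; congr (_ - _).
rewrite big_ord_recr -/(@it n) [LHS]/=; congr (_ + _).
  apply: eq_bigr => k _; rewrite -/(iv k) -/(xc k).
  by rewrite tot2x !tot1x spatial_iv !spatial_iv.
by rewrite -/(tc n) tot2x !tot1x spatial_it !spatial_iv.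
Qed.

(** Difference of the criterion at [W] and at zero mixed derivatives, with [H] zero. [W] enters only
    the second-order prolongation, where it is multiplied by the total derivatives of tau. *)
Lemma mixed_criterion P W i j :
  principal G (fun a b i j => zeta P (tc n) b * W a (pidx i j)
                       + zeta P (tc n) a * W b (pidx i j)) i j = 0.
Proof.
pose Hm a b i j : R := zeta P (tc n) b * W a (pidx i j) + zeta P (tc n) a * W b (pidx i j).
rewrite -/Hm.
have LC k l : principal G Hm k l = principal G Hm l k.
  by apply: principal_sym => a b k' l'; rewrite /Hm; [rewrite addrC|rewrite (pidxC k' l')].
(* The criterion is available for ordered index pairs; symmetry extends it to all i, j. *)
rewrite -(pidx_sym i j LC); move: (pidx i j) => p.
have c1 := test_jet_crit P W p (H   := @zero2 R n) (fun _ _ _ => erefl).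
have c0 := test_jet_crit P (@zero1 R n) p (H   := @zero2 R n) (fun _ _ _ => erefl).
have D := @DRic_diff R n (test_jet P (@zero2 R n) W) (test_jet P (@zero2 R n) (@zero1 R n))
  (K P (@zero2 R n) W) (K P (@zero2 R n) (@zero1 R n)) (fun _ => erefl) (fun _ _ => erefl)
  (fun _ => erefl) (fun _ _ => erefl) (pfst p) (psnd p).
have E1 : j1 (K P (@zero2 R n) W) (@it n) p = j1 (K P (@zero2 R n) (@zero1 R n)) (@it n) p by [].
have : principal (giJ (test_jet P (@zero2 R n) W)) (fun a b i j => ddg (K P (@zero2 R n) W) a b i j
      - ddg (K P (@zero2 R n) (@zero1 R n)) a b i j) (pfst p) (psnd p) = 0.
  set A := principal _ _ _ _ in D *; have Z : A = 0.
    by apply: principal_zero => a b k l; rewrite /ddg !test_jet2xx subrr.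
  rewrite Z add0r in D; rewrite -D.
  move: c1 c0; rewrite E1 => c1 c0.
  have := c1; rewrite -[in RHS]c0 => /addrI /(mulfI (lt0r_neq0 (ltr0n _ 2))) ->.
  by rewrite subrr.
rewrite giJ_tj -/G => E2.
apply/eqP; rewrite -oppr_eq0 -mulN1r -principal_scale -E2; apply/eqP; apply: eq_principal => a b k l.
by rewrite /ddg !K2x /Hm /zero1; ring.
Qed.

Hypothesis Ftx : forall k, F (tc n) (xc k) = 0.
Hypothesis Ftg : forall q, F (tc n) (gp q) = 0.
Hypothesis Stx : forall k (e' : 'I_(Ndim n)), S (tc n) (xc k) e' = 0.
Hypothesis Stg : forall q (e' : 'I_(Ndim n)), S (tc n) (gp q) e' = 0.

(** Derivative of the characteristic $\eta_p - \xi^k P_k$ in the metric direction h, with [P] held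
    fixed. *)
Definition TT P p (h : Pidx n -> R) : R :=
  \sum_q F (gp p) (gp q) * h q - \sum_k (\sum_q F (xc k) (gp q) * h q) * P k p.

Definition mat H a b i j : R := H a b (pidx i j).

Let zeta_t P a : zeta P (tc n) a = 0.
Proof. by rewrite /zeta Ftx add0r big1// => q _; rewrite Ftg mul0r. Qed.

Let sec_t P a b : sec P (tc n) a b = 0.
Proof.
rewrite /sec Stx add0r !big1 ?addr0// => q _; last by rewrite Stx mul0r.
by rewrite Stg add0r big1 ?mul0r// => q' _; rewrite Stg mul0r.
Qed.

Let sum_t (h : Pidx n -> R) : \sum_q F (tc n) (gp q) * h q = 0.
Proof. by rewrite big1// => q _; rewrite Ftg mul0r. Qed.

Let K1x P H W a p : j1 (K P H W) (iv a) p =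
  zeta P (gp p) a - \sum_k zeta P (xc k) a * P k p.
Proof.
rewrite [LHS]/= tot1x; congr (_ - _); rewrite big_ord_recr -/(@it n) [LHS]/=.
rewrite -/(tc n) tot1x zeta_t mul0r addr0; apply: eq_bigr => k _.
by rewrite -/(iv k) -/(xc k) tot1x spatial_iv.
Qed.

Let K1t P H W p : j1 (K P H W) (@it n) p =
  F (gp p) (tc n) + \sum_q F (gp p) (gp q) * locus_dt z P H q
  - (\sum_k (F (xc k) (tc n) + \sum_q F (xc k) (gp q) * locus_dt z P H q) * P k p
     + F (tc n) (tc n) * locus_dt z P H p).
Proof.
have T f : tot1 (test_jet P H W) f (@it n) = f (tc n) + \sum_q f (gp q) * locus_dt z P H q.
  by rewrite /tot1; congr (_ + _); apply: eq_bigr => q _; rewrite test_jet1t.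
rewrite [LHS]/= T; congr (_ - _); rewrite big_ord_recr -/(@it n) [LHS]/=.
rewrite -/(tc n) T sum_t addr0 spatial_it; congr (_ + _); apply: eq_bigr => k _.
by rewrite -/(iv k) -/(xc k) T spatial_iv.
Qed.

Let locus_dt_diff P H q : locus_dt z P H q =
  locus_dt z P (@zero2 R n) q - 2 * principal G (mat H) (pfst q) (psnd q).
Proof.
rewrite /locus_dt; set B := base_jet z P H _ _; set B0 := base_jet z P _ _ _.
have D := @Ric_diff R n B B0 (fun _ => erefl) (fun k p => erefl) (pfst q) (psnd q).
have E : principal (giJ B) (fun a b i j => ddg B a b i j - ddg B0 a b i j) (pfst q) (psnd q)
    = principal G (mat H) (pfst q) (psnd q).
  have -> : giJ B = G by exact: (giJ_tj z P H (@zero1 R n)).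
  by apply: eq_principal => a b i j; rewrite /ddg /= !spatial_iv subr0.
by move: D; rewrite E => /eqP; rewrite subr_eq => /eqP ->; ring.
Qed.

(** Half the difference of the criterion at [H] and at zero. The first two terms come from $g_t =
    -2\,Ric$ inside the prolonged time derivative, the third from the variation of the inverse
    metric, the last from the second-order prolongation. *)
Lemma principal_criterion P H p : (forall i j p, H i j p = H j i p) ->
  - TT P p (fun q => principal G (mat H) (pfst q) (psnd q))
  + F (tc n) (tc n) * principal G (mat H) (pfst p) (psnd p)
  + principal (- (G *m \matrix_(i, j) eta0 (pidx i j) *m G)) (mat H) (pfst p) (psnd p)
  + principal G (fun a b i j => TT P (pidx i j) (H a b)
      - \sum_k (zeta P (xc k) b * H a k (pidx i j) + zeta P (xc k) a * H b k (pidx i j)))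
      (pfst p) (psnd p) = 0.
Proof.
move=> HC.
have c1 := test_jet_crit P (@zero1 R n) p HC.
have c0 := test_jet_crit P (@zero1 R n) p (H := @zero2 R n) (fun _ _ _ => erefl).
have e1 k q : j1 (test_jet P H (@zero1 R n)) (iv k) q
    = j1 (test_jet P (@zero2 R n) (@zero1 R n)) (iv k) q by rewrite !test_jet1x.
have e2 k q : j1 (K P H (@zero1 R n)) (iv k) q
    = j1 (K P (@zero2 R n) (@zero1 R n)) (iv k) q by rewrite !K1x.
have D := @DRic_diff R n (test_jet P H (@zero1 R n)) (test_jet P (@zero2 R n) (@zero1 R n))
  (K P H (@zero1 R n)) (K P (@zero2 R n) (@zero1 R n)) (fun _ => erefl) e1
  (fun _ => erefl) e2 (pfst p) (psnd p).
set D1 := principal (DG _ _) _ _ _ in D; set D2 := principal (giJ _) _ _ _ in D.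
have E1 : D1 = principal (- (G *m \matrix_(i, j) eta0 (pidx i j) *m G)) (mat H) (pfst p) (psnd p).
  rewrite /D1 /DG giJ_tj -/G (_ : gmx _ = \matrix_(i, j) eta0 (pidx i j)); last first.
    by apply/matrixP => i j; rewrite !mxE.
  by apply: eq_principal => a b i j; rewrite /ddg !test_jet2xx subr0.
have E2 : D2 = principal G (fun a b i j => TT P (pidx i j) (H a b)
      - \sum_k (zeta P (xc k) b * H a k (pidx i j) + zeta P (xc k) a * H b k (pidx i j)))
      (pfst p) (psnd p).
  rewrite /D2 giJ_tj -/G; apply: eq_principal => a b i j; rewrite /ddg !K2x /mat.
  rewrite !sec_t !zeta_t !sum_t /TT.
  have z2 f : \sum_q f q * (@zero2 R n) a b q = 0.
    by rewrite big1// => q _; rewrite mulr0.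
  set p' := pidx i j.
  have -> : \sum_k ((sec P (xc k) a b + \sum_q F (xc k) (gp q) * H a b q) * P k p'
         + zeta P (xc k) b * H a k p' + zeta P (xc k) a * H b k p')
    = \sum_k ((sec P (xc k) a b + \sum_q F (xc k) (gp q) * (@zero2 R n) a b q) * P k p'
         + zeta P (xc k) b * (@zero2 R n) a k p' + zeta P (xc k) a * (@zero2 R n) b k p')
      + \sum_k (\sum_q F (xc k) (gp q) * H a b q) * P k p'
      + \sum_k (zeta P (xc k) b * H a k p' + zeta P (xc k) a * H b k p').
    rewrite -!big_split; apply: eq_bigr => k _ /=.
    by rewrite z2 /zero2; ring.
  by rewrite z2; ring.
rewrite -E1 -E2 -[_ + D1 + D2]addrA -D.
have -> : DRic (test_jet P H (@zero1 R n)) (K P H (@zero1 R n)) (pfst p) (psnd p)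
    = - (2^-1 * j1 (K P H (@zero1 R n)) (@it n) p).
  by move/eqP: c1; rewrite addrC addr_eq0 => /eqP c1; rewrite -mulrN -c1; field.
have -> : DRic (test_jet P (@zero2 R n) (@zero1 R n)) (K P (@zero2 R n) (@zero1 R n)) (pfst p) (psnd p)
    = - (2^-1 * j1 (K P (@zero2 R n) (@zero1 R n)) (@it n) p).
  by move/eqP: c0; rewrite addrC addr_eq0 => /eqP c0; rewrite -mulrN -c0; field.
rewrite !K1t (locus_dt_diff P H p) /TT.
have sumr (f : Pidx n -> R) : \sum_q f q * locus_dt z P H q = \sum_q f q * locus_dt z P (@zero2 R n) q
    - 2 * \sum_q f q * principal G (mat H) (pfst q) (psnd q).
  by rewrite mulr_sumr -sumrB; apply: eq_bigr => q _; rewrite (locus_dt_diff P H q); ring.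
rewrite (sumr (fun q => F (gp p) (gp q))).
have -> : \sum_k (F (xc k) (tc n) + \sum_q F (xc k) (gp q) * locus_dt z P H q) * P k p
  = \sum_k (F (xc k) (tc n) + \sum_q F (xc k) (gp q) * locus_dt z P (@zero2 R n) q) * P k p
    - 2 * \sum_k (\sum_q F (xc k) (gp q) * principal G (mat H) (pfst q) (psnd q)) * P k p.
  rewrite mulr_sumr -sumrB; apply: eq_bigr => k _.
  by rewrite (sumr (fun q => F (xc k) (gp q))); ring.
by field.
Qed.

End AlgebraicCriterion.

(** * Linear algebra of covectors and of the dual metric *)

Section Covectors.
Context {R : realType} {n : nat}.
Implicit Types (i j k l : 'I_n) (p q : Pidx n) (v w a b : 'I_n -> R).

Definition delta i : 'I_n -> R := fun k => (k == i)%:R.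

Lemma sum_delta (f : 'I_n -> R) i : \sum_k delta i k * f k = f i.
Proof.
rewrite (bigD1 i) //= /delta eqxx mul1r big1 ?addr0// => k /negbTE ->.
by rewrite mul0r.
Qed.

Lemma qform_polar (Q : 'I_n -> 'I_n -> R) : (forall i j, Q i j = Q j i) ->
  (forall v, qform v Q = 0) -> forall i j, Q i j = 0.
Proof.
move=> QC Q0 i j.
have D k l : \sum_i' \sum_j' delta k i' * delta l j' * Q i' j' = Q k l.
  under eq_bigr => i' _ do under eq_bigr => j' _ do rewrite -mulrA.
  under eq_bigr => i' _ do rewrite -mulr_sumr sum_delta.
  exact: sum_delta.
have := Q0 (fun k => delta i k + delta j k).
have -> : qform (fun k => delta i k + delta j k) Q = qform (delta i) Q + qform (delta j) Q
    + (\sum_i' \sum_j' delta i i' * delta j j' * Q i' j'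
       + \sum_i' \sum_j' delta j i' * delta i j' * Q i' j').
  rewrite /qform -!big_split; apply: eq_bigr => i' _ /=.
  by rewrite -!big_split; apply: eq_bigr => j' _ /=; ring.
rewrite !Q0 !D (QC j i) !add0r -mulr2n => /eqP; rewrite mulrn_eq0 /=.
by move/eqP.
Qed.

(** Squares of covectors span the symmetric matrices. Evaluation at $e_i + e_j$ isolates the
    coefficient at (i, j), multiplied by 1 plus the indicator of i = j, which is nonzero. *)
Lemma pidx_polar (f : Pidx n -> R) :
  (forall w, \sum_q f q * (w (pfst q) * w (psnd q)) = 0) -> forall q, f q = 0.
Proof.
move=> f0 q.
have := f0 (fun k => delta (pfst q) k + delta (psnd q) k).
have -> : \sum_q' f q' * ((delta (pfst q) (pfst q') + delta (psnd q) (pfst q'))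
     * (delta (pfst q) (psnd q') + delta (psnd q) (psnd q')))
  = \sum_q' f q' * (delta (pfst q) (pfst q') * delta (pfst q) (psnd q'))
  + \sum_q' f q' * (delta (psnd q) (pfst q') * delta (psnd q) (psnd q'))
  + \sum_q' f q' * (delta (pfst q) (pfst q') * delta (psnd q) (psnd q')
      + delta (psnd q) (pfst q') * delta (pfst q) (psnd q')).
  by rewrite -!big_split; apply: eq_bigr => q' _ /=; ring.
rewrite !f0 !add0r (bigD1 q) //= big1 => [|q' qq']; last first.
  have lq : (pfst q <= psnd q)%N by exact: (svalP q).
  have lq' : (pfst q' <= psnd q')%N by exact: (svalP q').
  have -> : delta (pfst q) (pfst q') * delta (psnd q) (psnd q') = 0.
    rewrite /delta -natrM mulnb; case: andP => // -[/eqP e1 /eqP e2].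
    by case/eqP: qq'; rewrite -(pidxK q) -(pidxK q') e1 e2.
  have -> : delta (psnd q) (pfst q') * delta (pfst q) (psnd q') = 0.
    rewrite /delta -natrM mulnb; case: andP => // -[/eqP e1 /eqP e2].
    rewrite e1 e2 in lq'; have e : pfst q = psnd q.
      by apply: val_inj; apply/eqP; rewrite eqn_leq lq lq'.
    by case/eqP: qq'; rewrite -(pidxK q) -(pidxK q') e1 e2 e.
  by rewrite addr0 mulr0.
rewrite addr0 /delta !eqxx mulr1 => /eqP; rewrite mulf_eq0 => /orP[/eqP //|].
by rewrite paddr_eq0 ?ler01 ?mulr_ge0 ?ler0n// oner_eq0.
Qed.

(** Here dimension at least two is essential: on a line, a nonzero covector annihilates no nonzero
    vector. *)
Lemma exists_orth w : (2 <= n)%N -> exists v, (exists i, v i != 0) /\ pairing w v = 0.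
Proof.
move=> n2; have n0 : (0 < n)%N by apply: ltn_trans n2.
pose i0 := Ordinal n0; pose i1 := Ordinal n2.
have i01 : (i1 == i0) = false by [].
have P i c : pairing w (fun k => c * delta i k) = c * w i.
  rewrite /pairing -(sum_delta w i) mulr_sumr; apply: eq_bigr => k _; ring.
have [w0|w0] := eqVneq (w i0) 0.
  exists (fun k => 1 * delta i0 k); split; last by rewrite P w0 mulr0.
  by exists i0; rewrite /delta eqxx mulr1 oner_eq0.
exists (fun k => w i1 * delta i0 k + (- w i0) * delta i1 k); split.
  by exists i1; rewrite /delta eqxx i01 mulr0 add0r mulr1 oppr_eq0.
rewrite (_ : pairing _ _ = pairing w (fun k => w i1 * delta i0 k)
  + pairing w (fun k => (- w i0) * delta i1 k)); first by rewrite !P; ring.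
by rewrite /pairing -big_split; apply: eq_bigr => k _ /=; ring.
Qed.

Lemma pairing_axpy (c d : R) a b v :
  pairing (fun k => c * a k + d * b k) v = c * pairing a v + d * pairing b v.
Proof.
rewrite /pairing !mulr_sumr -big_split; apply: eq_bigr => k _ /=.
by ring.
Qed.

Lemma dot_scale a (G : 'M[R]_n) (c : R) b : dot a G (fun l => c * b l) = c * dot a G b.
Proof.
rewrite /dot mulr_sumr; apply: eq_bigr => k _; rewrite mulr_sumr.
by apply: eq_bigr => l _; ring.
Qed.

Variable z : 'rV[R]_(Ndim n).
Hypothesis Dz : Dom z.
Let g := gmat z.
Let G := invmx g.

(** Lowering of an index, used to write every covector w in terms of a vector. *)
Definition flat v : 'I_n -> R := fun i => \sum_j g i j * v j.

Let gC i j : g i j = g j i. Proof. by rewrite -{1}[g]gmat_sym mxE. Qed.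

Lemma qform_gmat_gt0 v : (exists i, v i != 0) -> 0 < qform v g.
Proof.
move=> [i vi]; have /DomP := Dz; move=> /(_ (\row_k v k)).
have v0 : \row_k v k != 0 by apply/rV0Pn; exists i; rewrite mxE.
move=> /(_ v0); congr (0 < _); rewrite /qf /qform.
by apply: eq_bigr => k _; apply: eq_bigr => l _; rewrite !mxE; ring.
Qed.

Lemma pairing_flat v w : pairing (flat v) w = pairing (flat w) v.
Proof.
rewrite /pairing /flat; under eq_bigr => i _ do rewrite mulr_suml.
rewrite exchange_big; apply: eq_bigr => i _ /=.
by rewrite mulr_suml; apply: eq_bigr => j _; rewrite (gC j i); ring.
Qed.

Lemma pairing_flat_ctr v : pairing (flat v) v = qform v g.
Proof.
rewrite /pairing /flat /qform; apply: eq_bigr => i _; rewrite mulr_suml.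
by apply: eq_bigr => j _; ring.
Qed.

Let vec v : 'cV[R]_n := \col_i v i.

Lemma flat_onto w : exists v, forall i, w i = flat v i.
Proof.
exists (fun i => (G *m vec w) i 0) => i.
have /colP/(_ i) : g *m (G *m vec w) = vec w by rewrite mulmxA mulmxV ?mul1mx// Dom_unit.
by rewrite [RHS]mxE mxE.
Qed.

Lemma dot_flat (A : 'M[R]_n) v b : dot (flat v) A b = \sum_i v i * (g *m A *m vec b) i 0.
Proof.
rewrite /dot /flat; under eq_bigr => k _ do under eq_bigr => l _ do rewrite !mulr_suml.
under eq_bigr => k _ do rewrite exchange_big.
rewrite exchange_big; apply: eq_bigr => i _ /=.
rewrite -mulmxA [(g *m _) i 0]mxE mulr_sumr.
apply: eq_bigr => k _; rewrite [(A *m _) k 0]mxE !mulr_sumr; apply: eq_bigr => l _.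
by rewrite [vec b l 0]mxE (gC k i); ring.
Qed.

Lemma dot_flat_G v b : dot (flat v) G b = pairing b v.
Proof.
rewrite dot_flat mulmxV ?Dom_unit// mul1mx /pairing; apply: eq_bigr => i _.
by rewrite mxE mulrC.
Qed.

(** The matrix $-GAG$ is the variation of the inverse metric when g varies by A; lowered indices
    turn it back into A. *)
Lemma dot_flat_flat (A : 'M[R]_n) v :
  dot (flat v) (- (G *m A *m G)) (flat v) = - qform v A.
Proof.
rewrite dot_flat /qform -sumrN; apply: eq_bigr => i _.
have -> : vec (flat v) = g *m vec v.
  apply/colP => k; rewrite [LHS]mxE [RHS]mxE; apply: eq_bigr => l _.
  by rewrite [vec v l 0]mxE.
rewrite mulmxN mulNmx !mulmxA mulmxV ?Dom_unit// mul1mx -(mulmxA A) mulVmx ?Dom_unit//.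
rewrite mulmx1 [X in _ * X]mxE mulrN; congr (- _).
rewrite [(A *m _) i 0]mxE mulr_sumr.
by apply: eq_bigr => j _; rewrite [vec v j 0]mxE; ring.
Qed.

Lemma dot_G_eq0 w : dot w G w = 0 -> forall i, w i = 0.
Proof.
have [v wv] := flat_onto w; have -> : w = flat v by apply/funext.
rewrite dot_flat_G pairing_flat_ctr => v0 i.
have vz j : v j = 0.
  apply/eqP; apply: contraT => vj.
  by have := @qform_gmat_gt0 v (ex_intro _ j vj); rewrite v0 ltxx.
by rewrite /flat big1// => j _; rewrite vz mulr0.
Qed.

End Covectors.

(** * Solving the determining equations at one point *)

Section DeterminingEquations.
Context {R : realType} {n : nat}.
Hypothesis n2 : (2 <= n)%N.
Implicit Types (i j k : 'I_n) (p q : Pidx n) (v w : 'I_n -> R).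
Implicit Types (P W : 'I_n -> Pidx n -> R) (H : 'I_n -> 'I_n -> Pidx n -> R).
Variables (z : 'rV[R]_(Ndim n)) (eta0 : Pidx n -> R)
  (F : 'I_(Ndim n) -> 'I_(Ndim n) -> R)
  (S : 'I_(Ndim n) -> 'I_(Ndim n) -> 'I_(Ndim n) -> R).
Hypothesis Dz : Dom z.
Hypothesis test_jet_crit : forall P H W p, (forall i j p, H i j p = H j i p) ->
  j1 (gen_jet eta0 F S (test_jet z P H W)) (@it n) p
  + 2 * DRic (test_jet z P H W) (gen_jet eta0 F S (test_jet z P H W)) (pfst p) (psnd p) = 0.
Let g := gmat z.
Let G := invmx g.
Let GC k l : G k l = G l k := giJ_sym (test_jet z (@zero1 R n) (@zero2 R n) (@zero1 R n)) k l.

Lemma tau_total P a : F (tc n) (xc a) + \sum_q F (tc n) (gp q) * P a q = 0.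
Proof.
pose Z a := F (tc n) (xc a) + \sum_q F (tc n) (gp q) * P a q.
rewrite -/(Z a); apply: (dot_G_eq0 Dz).
have [v [v0 Zv]] := exists_orth Z n2.
have L0 i j : principal G (rank1 Z Z g) i j = 0.
  (* For W equal to Z times g the two symmetrized terms coincide, giving twice [rank1 Z Z g]. *)
  have := mixed_criterion test_jet_crit P (fun a q => Z a * z 0 (gp q)) i j.
  rewrite -/g -/G => E; apply: (mulfI (lt0r_neq0 (ltr0n R 2))).
  rewrite mulr0 -E -principal_scale; apply: eq_principal => k l i' j'.
  by rewrite /rank1 /g gmatE -!/(Z _); ring.
have := @qform_principal_rank1 R n G Z Z g v; rewrite Zv mul0r => /(_ erefl).
rewrite (eq_qform v (h' := fun _ _ => 0)); last by move=> i j; exact: L0.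
have -> : qform v (fun _ _ => 0) = 0.
  by rewrite /qform big1// => i _; rewrite big1// => j _; rewrite mulr0.
rewrite mul0r add0r => /esym/eqP; rewrite oppr_eq0 mulf_eq0.
rewrite (gt_eqF (qform_gmat_gt0 Dz v0)) orbF mulf_eq0 invr_eq0 pnatr_eq0 /=.
by move/eqP.
Qed.

(** The total derivative of tau vanishes for every [P]: zero [P] isolates the x-derivative, and
    indicator values of [P] then give [tau_g]. *)
Lemma tau_x a : F (tc n) (xc a) = 0.
Proof.
have := tau_total (@zero1 R n) a; rewrite big1 ?addr0// => q _.
by rewrite mulr0.
Qed.

Lemma tau_g q : F (tc n) (gp q) = 0.
Proof.
have n0 : (0 < n)%N by apply: ltn_trans n2.
have := tau_total (fun _ q' => (q' == q)%:R) (Ordinal n0).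
rewrite tau_x add0r (bigD1 q) //= eqxx mulr1 big1 ?addr0// => q' /negbTE ->.
by rewrite mulr0.
Qed.

Hypothesis Stx : forall k (e' : 'I_(Ndim n)), S (tc n) (xc k) e' = 0.
Hypothesis Stg : forall q (e' : 'I_(Ndim n)), S (tc n) (gp q) e' = 0.

Let TTF P p (h : Pidx n -> R) := TT F P p h.

Let TT_scale P p c (h : Pidx n -> R) : TTF P p (fun q => c * h q) = c * TTF P p h.
Proof.
rewrite /TTF /TT mulrBr !mulr_sumr; congr (_ - _).
  by apply: eq_bigr => q _; ring.
apply: eq_bigr => k _; rewrite mulrA; congr (_ * _); rewrite mulr_sumr.
by apply: eq_bigr => q _; ring.
Qed.

Section RankOneHessian.
Variables (P : 'I_n -> Pidx n -> R) (w : 'I_n -> R) (h : 'I_n -> 'I_n -> R).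
Hypothesis hC : forall i j, h i j = h j i.
Let hq q := h (pfst q) (psnd q).
Let T i j := TTF P (pidx i j) hq.
Let Z a := \sum_k (F (xc k) (xc a) + \sum_q F (xc k) (gp q) * P a q) * w k.
Variable (lam : R).
Hypothesis hLA : forall i j, principal G (rank1 w w h) i j = lam * h i j.

(** The eigenvector hypothesis turns [TT] applied to the symbol of h into [lam] times [T]. The
    covector [Z] is the total derivative of xi paired with w. *)
Lemma rank1_criterion i j :
  - (lam * T i j) + F (tc n) (tc n) * (lam * h i j)
  + principal (- (G *m \matrix_(i, j) eta0 (pidx i j) *m G)) (rank1 w w h) i j
  + principal G (fun a b i j => w a * w b * T i j - (Z b * w a + Z a * w b) * h i j) i j = 0.
Proof.
pose H a b q := w a * w b * hq q.
have HC a b q : H a b q = H b a q by rewrite /H (mulrC (w a)).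
have matE a b k l : mat H a b k l = rank1 w w h a b k l.
  by rewrite /mat /H /rank1 /hq (pidx_sym k l hC).
have TC k l : T k l = T l k by rewrite /T pidxC.
set D := - (G *m _ *m G).
have DC k l : D k l = D l k.
  rewrite -[D in RHS]trmxK [RHS]mxE; congr (fun_of_matrix _ k l).
  rewrite /D raddfN /= !trmx_mul mulmxA.
  have -> : G^T = G by apply/matrixP => x y; rewrite mxE GC.
  by congr (- (_ *m _ *m _)); apply/matrixP => x y; rewrite !mxE pidxC.
pose L k l := - (lam * T k l) + F (tc n) (tc n) * (lam * h k l)
  + principal D (rank1 w w h) k l
  + principal G (fun a b i j => w a * w b * T i j - (Z b * w a + Z a * w b) * h i j) k l.
have LC k l : L k l = L l k.
  rewrite /L (TC k l) (hC k l); congr (_ + _ + _).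
    by apply: principal_sym => a b x y; rewrite /rank1; [ring|rewrite (hC x y)].
  by apply: principal_sym => a b x y; [ring|rewrite (hC x y) (TC x y)].
rewrite -/(L i j) -(pidx_sym i j LC).
rewrite -(principal_criterion test_jet_crit tau_x tau_g Stx Stg P (pidx i j) HC).
move: (pidx i j) => p; rewrite /L; congr (_ + _ + _ + _).
- congr (- _); rewrite /T pidxK -TT_scale /TTF; congr (TT F P p _).
  by apply/funext => q; rewrite -hLA; apply: eq_principal => a b k l; rewrite matE.
- by rewrite -hLA; congr (_ * _); apply: eq_principal => a b k l; rewrite matE.
- by apply: eq_principal => a b k l; rewrite matE.
- apply: eq_principal => a b k l; rewrite /H; congr (_ - _).
    by rewrite -/(TTF P (pidx k l) _) TT_scale /T.
  rewrite /Z mulrDl !mulr_suml -big_split; apply: eq_bigr => m _ /=.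
  by rewrite /hq (pidx_sym k l hC); ring.
Qed.

Variable v : 'I_n -> R.
Hypothesis vw : pairing w v = 0.
Hypothesis hw : pairing (fun j => dot w G (h j)) v = 0.

(* Since w(v) = 0, contracting twice with v only leaves the terms -|w|^2 h/2 of the
   symbol. *)
Lemma contracted_criterion :
  - (lam * qform v T) + F (tc n) (tc n) * (lam * qform v h)
  - 2^-1 * dot w (- (G *m \matrix_(i, j) eta0 (pidx i j) *m G)) w * qform v h
  - 2^-1 * dot w G w * qform v T + dot w G Z * qform v h = 0.
Proof.
set D := - (G *m _ *m G).
have vw1 b : pairing w v * pairing b v = 0 by rewrite vw mul0r.
have vw2 b : pairing b v * pairing w v = 0 by rewrite vw mulr0.
have e1 := qform_principal_rank1 D h (vw1 w).
have e2 := qform_principal_rank1 G T (vw1 w).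
have e3 := qform_principal_rank1 G h (vw1 Z).
have e4 := qform_principal_rank1 G h (vw2 Z).
rewrite vw mul0r add0r in e1; rewrite vw mul0r add0r in e2.
rewrite hw mulr0 add0r in e3; rewrite vw mul0r add0r in e4.
have c0 : qform v (fun _ _ => 0) = 0.
  by rewrite /qform big1// => i _; rewrite big1// => j _; rewrite mulr0.
have E i j : (- lam) * T i j + (F (tc n) (tc n) * lam * h i j
   + (principal D (rank1 w w h) i j + (principal G (rank1 w w T) i j
   + ((-1) * principal G (rank1 w Z h) i j + (-1) * principal G (rank1 Z w h) i j)))) = 0.
  rewrite -(rank1_criterion i j) -/D.
  have -> : principal G (fun a b i j => w a * w b * T i j - (Z b * w a + Z a * w b) * h i j) i j
     = principal G (rank1 w w T) i j
     + ((-1) * principal G (rank1 w Z h) i j + (-1) * principal G (rank1 Z w h) i j).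
    by rewrite -!principal_scale -!principal_add; apply: eq_principal => a b k l; rewrite /rank1; ring.
  by ring.
move: e1 e2 e3 e4 E; move: (principal D (rank1 w w h)) (principal G (rank1 w w T))
  (principal G (rank1 w Z h)) (principal G (rank1 Z w h)) => f1 f2 f3 f4 e1.
generalize T => T0 e2 e3 e4 E.
have := eq_qform v E; rewrite c0 !(qform_add, qform_scale) e1 e2 e3 e4 (dotC Z w GC) => E0.
by rewrite -[RHS]E0; field.
Qed.

End RankOneHessian.
Let zero_or_not w : (forall i, w i = 0) \/ exists i, w i != 0.
Proof.
have [/existsP|/existsPn w0] := boolP [exists i, w i != 0]; first by right.
by left=> i; apply/eqP; apply: contraT => wi; have := w0 i; rewrite wi.
Qed.

(** Raising [P] by g in the slot k changes [TT] by $-s\,g$, where s is the derivative of $\xi^k$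
    along [hq]; since g(v, v) > 0, this forces s = 0. *)
Let qform_TT v (hq : Pidx n -> R) k : (forall P, qform v (fun i j => TT F P (pidx i j) hq) = 0) ->
  (exists i, v i != 0) -> \sum_q F (xc k) (gp q) * hq q = 0.
Proof.
move=> T0 v0; set s := \sum_q _.
have := T0 (fun k' q => (k' == k)%:R * z 0 (gp q)).
have E i j : TT F (fun k' q => (k' == k)%:R * z 0 (gp q)) (pidx i j) hq
    = TT F (@zero1 R n) (pidx i j) hq + (- s) * g i j.
  rewrite /TT (bigD1 k) //= eqxx mul1r -/s [X in _ - (_ + X)]big1; last first.
    by move=> k' /negbTE ->; rewrite mul0r mulr0.
  rewrite [X in _ = _ - X + _]big1; last by move=> k' _; rewrite mulr0.
  by rewrite /g gmatE; ring.
rewrite (eq_qform v E) qform_add qform_scale T0 add0r mulNr => /eqP.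
rewrite oppr_eq0 mulf_eq0 (gt_eqF (qform_gmat_gt0 Dz v0)) orbF.
by move/eqP.
Qed.

Lemma xi_g k q : F (xc k) (gp q) = 0.
Proof.
move: q; apply: (pidx_polar (f := fun q => F (xc k) (gp q))) => w.
have [w0|w0] := zero_or_not w.
  by rewrite big1// => q _; rewrite w0 mul0r mulr0.
have [v [v0 vw]] := exists_orth w n2.
pose h i j := w i * w j.
have hC i j : h i j = h j i by rewrite /h mulrC.
have hLA i j : principal G (rank1 w w h) i j = 0 * h i j.
  rewrite mul0r /principal big1 ?mulr0// => k' _; rewrite big1// => l _.
  by rewrite /rank1 /h; ring.
have hw : pairing (fun j => dot w G (h j)) v = 0.
  rewrite /pairing; under eq_bigr => j _ do rewrite dot_scale mulrAC.
  by rewrite -mulr_suml -/(pairing w v) vw mul0r.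
have hv : qform v h = 0 by rewrite qform_mul vw mul0r.
refine (@qform_TT v (fun q => h (pfst q) (psnd q)) k _ v0) => P.
have := contracted_criterion P hC hLA vw hw.
(* With eigenvalue 0 and h(v, v) = 0, only $-\frac12|w|^2\, T(v,v)$ is left. *)
rewrite hv !(mulr0, mul0r, subr0, addr0, oppr0, add0r) => /eqP.
rewrite oppr_eq0 mulf_eq0 mulf_eq0 invr_eq0 pnatr_eq0 /= => /orP[/eqP wG|/eqP //].
by have [i] := w0; rewrite (dot_G_eq0 Dz wG) eqxx.
Qed.

Lemma eta_formula i j : eta0 (pidx i j) = F (tc n) (tc n) * g i j
  - \sum_k (g k i * F (xc k) (xc j) + g k j * F (xc k) (xc i)).
Proof.
pose M i j := \sum_k (g k i * F (xc k) (xc j) + g k j * F (xc k) (xc i)).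
pose E : 'M[R]_n := \matrix_(i, j) eta0 (pidx i j).
(* The defect of the claimed formula. By polarization it is enough that Q(p, p) = 0, and the
   criterion with w = g p gives exactly this value. *)
pose Q i j := E i j + ((- F (tc n) (tc n)) * g i j + M i j).
have gC k l : g k l = g l k by rewrite -{1}[g]gmat_sym mxE.
have MC k l : M k l = M l k by apply: eq_bigr => m _; rewrite addrC.
suff : Q i j = 0.
  by rewrite /Q /E mxE => /eqP; rewrite addr_eq0 => /eqP ->; rewrite /M; ring.
move: i j; apply: qform_polar => [k l|p].
  by rewrite /Q [E k l]mxE [E l k]mxE (pidxC k l) (gC k l) (MC k l).
have [p0|p0] := zero_or_not p.
  by rewrite /qform big1// => i _; rewrite big1// => j _; rewrite p0 !mul0r.
pose w := flat z p.
have [v [v0 vw]] := exists_orth w n2.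
pose vb := flat z v.
pose al := qform p g; pose be := qform v g.
have al0 : 0 < al := qform_gmat_gt0 Dz p0.
have be0 : 0 < be := qform_gmat_gt0 Dz v0.
(* For w = g p and g(p, v) = 0, h is an eigenvector of the symbol at w with
   eigenvalue -|w|^2/2, so that the derivative of eta along h cancels out. *)
pose h i j := al * (vb i * vb j) + be * (w i * w j).
have hC i j : h i j = h j i by rewrite /h; ring.
have vbp : pairing vb p = 0 by rewrite /vb pairing_flat.
have wp : pairing w p = al := pairing_flat_ctr z p.
have wh j : dot w G (h j) = be * al * w j.
  rewrite /w (dot_flat_G Dz) (_ : pairing (h j) p = al * vb j * pairing vb p + be * w j * pairing w p).
    by rewrite vbp wp -/w; ring.
  rewrite -pairing_axpy; apply: eq_bigr => k _; congr (_ * _).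
  by rewrite /h -!mulrA.
have wGw : dot w G w = al by rewrite /w (dot_flat_G Dz) -/w wp.
have trh : \sum_k \sum_l G k l * h k l = 2 * al * be.
  have -> : \sum_k \sum_l G k l * h k l = al * dot vb G vb + be * dot w G w.
    rewrite /dot !mulr_sumr -big_split; apply: eq_bigr => k _ /=.
    by rewrite !mulr_sumr -big_split; apply: eq_bigr => l _ /=; rewrite /h; ring.
  by rewrite wGw /vb (dot_flat_G Dz) pairing_flat_ctr -/be; ring.
(* The weights [al] and [be] in h are balanced so that the trace term $2\,al\,be\,w_i w_j$ cancels
   the two divergence terms. *)
have hLA i j : principal G (rank1 w w h) i j = (- (2^-1 * al)) * h i j.
  by rewrite principal_rank1 !wh wGw trh /h; field.
have hw : pairing (fun j => dot w G (h j)) v = 0.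
  rewrite /pairing; under eq_bigr => j _ do rewrite wh -mulrA.
  by rewrite -mulr_sumr -/(pairing w v) vw mulr0.
have hv : qform v h = al * (be * be).
  by rewrite qform_add !qform_scale !qform_mul vw /vb pairing_flat_ctr -/be mul0r mulr0 addr0.
pose Z a := \sum_k F (xc k) (xc a) * w k.
have := contracted_criterion (@zero1 R n) hC hLA vw hw.
set T := qform v _; rewrite -/E hv wGw.
have -> : dot w (- (G *m E *m G)) w = - qform p E by rewrite /w (dot_flat_flat Dz).
have -> : dot w G (fun a => \sum_k (F (xc k) (xc a)
     + \sum_q F (xc k) (gp q) * (@zero1 R n) a q) * w k) = pairing Z p.
  rewrite /w (dot_flat_G Dz) -/w; apply: eq_bigr => a _; congr (_ * _).
  by apply: eq_bigr => k _; rewrite big1 ?addr0// => q _; rewrite mulr0.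
move=> C.
pose Fx k a := F (xc k) (xc a).
have qformM : qform p M = 2 * pairing Z p.
  have e1 : qform p M = \sum_k (pairing (g k) p * pairing (Fx k) p
      + pairing (Fx k) p * pairing (g k) p).
    under eq_bigr => k _ do rewrite -!qform_mul -qform_add.
    rewrite /qform [RHS]exchange_big /=; apply: eq_bigr => i _.
    rewrite [RHS]exchange_big /=; apply: eq_bigr => j _.
    by rewrite /M mulr_sumr; apply: eq_bigr => k _; rewrite /Fx; ring.
  have e2 : pairing Z p = \sum_k w k * pairing (Fx k) p.
    rewrite /pairing; under eq_bigr => a _ do rewrite mulr_suml.
    rewrite exchange_big; apply: eq_bigr => k _; rewrite /= mulr_sumr.
    by apply: eq_bigr => a _; rewrite /Fx; ring.
  rewrite e1 e2 mulr_sumr; apply: eq_bigr => k _.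
  by rewrite (_ : pairing (g k) p = w k)//; ring.
rewrite /Q !(qform_add, qform_scale) qformM -/al.
have ab0 : al * (be * be) != 0 by rewrite !mulf_neq0 ?gt_eqF.
apply: (mulfI ab0); apply: (mulfI (lt0r_neq0 (ltr0n R 2))); rewrite !mulr0.
(* The [T] terms cancel and [C] becomes half of [al * (be * be)] times Q(p, p); the doubled goal is
   therefore four times [C]. *)
by move: C; set a := qform p _; set b := pairing Z p => C; rewrite -(mulr0 4) -C; field.
Qed.

End DeterminingEquations.

(** * Every symmetry has the listed form *)

Section Necessity.
Context {R : realType} {n : nat}.
Hypothesis n2 : (2 <= n)%N.
Implicit Types (i j k : 'I_n) (c d : 'I_n.+1) (p q : Pidx n) (z : 'rV[R]_(Ndim n)).
Variable V : 'rV[R]_(Ndim n) -> 'rV[R]_(Ndim n).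
Hypothesis Vs : smooth_vf V.
Hypothesis Vsym : is_symmetry V.

Let test_jet_crit z (Dz : Dom z) P H W p := @test_jet_criterion R n z V Vs Vsym Dz P H W p.

Lemma pd_tau_x z k : Dom z -> pd (vcoef V (tc n)) (xc k) z = 0.
Proof. by move=> Dz; exact: (tau_x n2 Dz (test_jet_crit Dz)). Qed.

Lemma pd_tau_g z q : Dom z -> pd (vcoef V (tc n)) (gp q) z = 0.
Proof. by move=> Dz; exact: (tau_g n2 Dz (test_jet_crit Dz)). Qed.

Let pd_zero m (f : 'rV[R]_m -> R) e x : (\forall y \near x, f y = 0) -> pd f e x = 0.
Proof.
by move=> f0; rewrite (pd_near (g := fun _ => 0) e f0); exact: isd_pd (isd_cst _ _ _).
Qed.

(** Because [Dom] is open, the vanishing of a first derivative of tau can be differentiated again;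
    this supplies the second-order hypotheses of [xi_g] and [eta_formula]. *)
Let pd2_tau_x z (Dz : Dom z) k e : pd (pd (vcoef V (tc n)) (xc k)) e z = 0.
Proof.
apply: pd_zero; apply: (@filterS _ _ (nbhs_filter z) _ _ _ (Dom_open Dz)) => z'.
exact: pd_tau_x.
Qed.

Let pd2_tau_g z (Dz : Dom z) q e : pd (pd (vcoef V (tc n)) (gp q)) e z = 0.
Proof.
apply: pd_zero; apply: (@filterS _ _ (nbhs_filter z) _ _ _ (Dom_open Dz)) => z'.
exact: pd_tau_g.
Qed.

Lemma pd_xi_g z k q : Dom z -> pd (vcoef V (xc k)) (gp q) z = 0.
Proof.
move=> Dz; exact: (xi_g n2 Dz (test_jet_crit Dz) (pd2_tau_x Dz) (pd2_tau_g Dz)).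
Qed.

Lemma eta_eq z p : Dom z -> V z 0 (gp p) =
  pd (vcoef V (tc n)) (tc n) z * z 0 (gp p)
  - \sum_k (z 0 (gc k (pfst p)) * pd (vcoef V (xc k)) (xc (psnd p)) z
            + z 0 (gc k (psnd p)) * pd (vcoef V (xc k)) (xc (pfst p)) z).
Proof.
move=> Dz.
have := eta_formula n2 Dz (test_jet_crit Dz) (pd2_tau_x Dz) (pd2_tau_g Dz) (pfst p) (psnd p).
rewrite pidxK gmatE pidxK => E; apply: (etrans E); congr (_ - _).
by apply: eq_bigr => k _; rewrite !gmatE.
Qed.

(** The Euclidean metric placed over each (x, t), serving as reference point for the dependence on
    g. *)
Definition base (y : 'rV[R]_n.+1) : 'rV[R]_(Ndim n) :=
  zu (fun p _ => (pfst p == psnd p)%:R) y.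

Lemma base_Dom y : Dom (base y).
Proof.
have gE : gmat (base y) = 1%:M.
  apply/matrixP => i j; rewrite gmatE zu_gp mxE.
  by rewrite (pidx_sym (S := fun i j : 'I_n => (i == j)%:R))// => k l; rewrite eq_sym.
apply/DomP => v /rV0Pn[i vi]; rewrite gE /qf.
rewrite (_ : \sum_i _ = \sum_i v 0 i ^+ 2).
  rewrite (bigD1 i) //= ltr_wpDr ?exprn_even_gt0// sumr_ge0// => k _.
  exact: sqr_ge0.
apply: eq_bigr => k _; rewrite (bigD1 k) //= !mxE eqxx mulr1 big1 ?addr0//.
by move=> l lk; rewrite mxE eq_sym (negbTE lk) mulr0 mul0r.
Qed.

Definition red c : 'rV[R]_n.+1 -> R := fun y => V (base y) 0 (lshift _ c).

Let base_diff (y : 'rV[R]_n.+1) e : differentiable (fun y => base y 0 e) y.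
Proof.
move: e; apply: Ndim_ind => [c|p].
  by under eq_fun do rewrite zu_ind; exact: differentiable_coord.
by under eq_fun do rewrite zu_gp; exact: differentiable_cst.
Qed.

Let isd_base (y : 'rV[R]_n.+1) c e : is_derive y (delta_mx 0 c) (fun y => base y 0 e)
  (Some (lshift (mdim n) c : 'I_(Ndim n)) == Some e)%:R.
Proof.
move: e; apply: Ndim_ind => [d|p].
  under eq_fun do rewrite zu_ind.
  rewrite (_ : (_ == _) = (d == c)); first exact: isd_coord.
  by rewrite (inj_eq Some_inj) eq_lshift eq_sym.
under eq_fun do rewrite zu_gp.
by rewrite (inj_eq Some_inj) /gp eq_lrshift mulr0n; exact: isd_cst.
Qed.

Lemma red_smooth c : smooth_on setT (red c).
Proof.
exact: (@smooth_subst R _ _ (@Dom R n) base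
  (fun c => Some (lshift (mdim n) c : 'I_(Ndim n))) base_Dom base_diff isd_base
  (vcoef V (lshift _ c)) (Vs _)).
Qed.

Lemma pd_red c d y : pd (red c) d y = pd (vcoef V (lshift _ c)) (lshift _ d) (base y).
Proof.
by have := @pd_subst R _ _ (@Dom R n) base
  (fun c => Some (lshift (mdim n) c : 'I_(Ndim n))) base_Dom isd_base
  (vcoef V (lshift _ c)) d (Vs _) => ->.
Qed.

(** z and its reference point differ only in metric coordinates. The segment between them stays in
    [Dom], where tau and xi have zero derivative in these directions. *)
Lemma V_red z c : Dom z -> V z 0 (lshift _ c) = red c (ypart z).
Proof.
move=> Dz; pose b := base (ypart z).
have Db : Dom b := base_Dom _.
have Ds (s : R) : 0 <= s <= 1 -> Dom (s *: (z - b) + b) by exact: Dom_convex.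
apply: (@eq_on_segment _ _ (vcoef V (lshift _ c)) b z) => s s01.
  exact: (smooth_diff (Vs _) (Ds s s01)).
have zb d : (z - b) 0 (lshift _ d) = 0.
  have -> : (z - b) 0 (lshift _ d) = z 0 (lshift _ d) - b 0 (lshift _ d).
    by rewrite [LHS]mxE [(- b) _ _]mxE.
  by rewrite zu_ind mxE subrr.
rewrite sum_gp [X in X + _]big1 ?add0r => [|d _]; last first.
  by apply/eqP; rewrite mulf_eq0; apply/orP; right; apply/eqP; exact: zb.
rewrite big1// => p _; move: (Ds s s01) => {}Ds.
move: c; apply: ind_ind => [k|]; first by rewrite (pd_xi_g k p Ds) mul0r.
by rewrite (pd_tau_g p Ds) mul0r.
Qed.

Lemma pd_V_red z c d : Dom z ->
  pd (vcoef V (lshift _ c)) (lshift _ d) z = pd (red c) d (ypart z).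
Proof.
move=> Dz.
rewrite (pd_near (g := fun z => red c (ypart z))); last first.
  apply: (@filterS _ _ (nbhs_filter z) _ _ _ (Dom_open Dz)) => z' D'.
  exact: V_red.
have D c' : is_derive z (delta_mx 0 (lshift _ d : 'I_(Ndim n)))
    (fun z => ypart z 0 c') (c' == d)%:R.
  under eq_fun do rewrite mxE.
  rewrite -(eq_lshift (mdim n)); exact: isd_coord.
have H := isd_chain (smooth_diff (red_smooth c) I) D.
rewrite (isd_pd H) (bigD1 d) //= eqxx mulr1 big1 ?addr0// => c' /negbTE ->.
by rewrite mulr0.
Qed.

Lemma V_projectable : projectable red V.
Proof.
move=> z Dz; split=> [c|p]; first exact: V_red.
rewrite (eta_eq p Dz) (pd_V_red _ _ Dz); congr (_ - _).
by apply: eq_bigr => k _; rewrite !(pd_V_red _ _ Dz).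
Qed.

Lemma pd_red_t k y : pd (red (@it n)) (iv k) y = 0.
Proof. by rewrite pd_red; exact: (pd_tau_x k (base_Dom y)). Qed.

(** The first derivatives [P] of the metric remain free at the Euclidean point, so the coefficients
    of this affine expression in [P] can be separated. *)
Lemma residual_equation (P : 'I_n -> Pidx n -> R) y p :
  pd (pd (red (@it n)) (@it n)) (@it n) y * (pfst p == psnd p)%:R
  - \sum_k ((base y) 0 (gc k (pfst p)) * pd (pd (red (iv k)) (iv (psnd p))) (@it n) y
            + (base y) 0 (gc k (psnd p)) * pd (pd (red (iv k)) (iv (pfst p))) (@it n) y)
  - \sum_k pd (red (iv k)) (@it n) y * P k p = 0.
Proof.
pose J := test_jet (base y) P (@zero2 R n) (@zero1 R n).
have [u [us uJ]] := jet_realize y (test_jet_sym (base y) P (@zero1 R n)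
  (H := @zero2 R n) (fun _ _ _ => erefl)).
have u0 q : u q y = base y 0 (gp q).
  by have := congr1 (fun K => j0 K q) uJ.
have u1 k q : pd (u q) (iv k) y = P k q.
  by have := congr1 (fun K => j1 K (iv k) q) uJ; rewrite test_jet1x.
have uz : zu u y = base y.
  by apply/rowP; apply: Ndim_ind => [c|q]; rewrite ?zu_ind // zu_gp u0.
have Dy : Dom (zu u y) by rewrite uz; exact: base_Dom.
have JD q : Delta (jet_of u y) q = 0 by rewrite uJ test_jet_Delta.
have := Vsym us Dy JD p.
rewrite (projectable_criterion V_projectable red_smooth pd_red_t us Dy p JD).
rewrite u0 zu_gp => E; rewrite -[RHS]E; congr (_ - _ - _).
  by apply: eq_bigr => k _; rewrite !u0.
by apply: eq_bigr => k _; rewrite u1.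
Qed.

Let n0 : (0 < n)%N. Proof. exact: ltn_trans n2. Qed.
Let i0 : 'I_n := Ordinal n0.

(** Compare [P] equal to the indicator of k with zero [P]. *)
Lemma xi_t k y : pd (red (iv k)) (@it n) y = 0.
Proof.
have E0 := residual_equation (@zero1 R n) y (pidx i0 i0).
have E1 := residual_equation (fun k' _ => (k' == k)%:R) y (pidx i0 i0).
rewrite [X in _ - X = _]big1 in E0; last by move=> ? _; rewrite mulr0.
rewrite subr0 in E0; rewrite E0 (bigD1 k) //= eqxx mulr1 big1 in E1; last first.
  by move=> k' /negbTE ->; rewrite mulr0.
by move/eqP: E1; rewrite addr0 sub0r oppr_eq0 => /eqP.
Qed.

Lemma pd_cst0 m (e : 'I_m) (x : 'rV[R]_m) : pd (fun _ => 0 : R) e x = 0.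
Proof. exact: isd_pd (isd_cst _ _ _). Qed.

(** Zero [P] and a diagonal index pair: the middle sum involves mixed derivatives of xi, which
    vanish by Schwarz and [xi_t]. *)
Lemma tau_tt y : pd (pd (red (@it n)) (@it n)) (@it n) y = 0.
Proof.
have M k i : pd (pd (red (iv k)) (iv i)) (@it n) y = 0.
  rewrite (@pdC R _ (red (iv k)) (iv i) (@it n) y (red_smooth _)).
  have -> : pd (red (iv k)) (@it n) = fun _ => 0 by apply/funext => y'; exact: xi_t.
  exact: pd_cst0.
have E0 := residual_equation (@zero1 R n) y (pidx i0 i0).
have pp : pfst (pidx i0 i0) == psnd (pidx i0 i0).
  by rewrite (pidx_sym (S := fun i j => i == j)) ?eqxx// => k l; rewrite eq_sym.
rewrite pp mulr1 [X in _ - X - _]big1 in E0; last first.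
  by move=> k _; rewrite !M !mulr0 addr0.
rewrite [X in _ - X = _]big1 in E0; last by move=> ? _; rewrite mulr0.
by rewrite !subr0 in E0.
Qed.

Lemma eq_pd0 m (f : 'rV[R]_m -> R) (x y : 'rV[R]_m) : smooth_on setT f ->
  (forall e w, (y - x) 0 e != 0 -> pd f e w = 0) -> f y = f x.
Proof.
move=> fs f0; apply: eq_on_segment => s _; first exact: (smooth_diff fs I).
rewrite big1// => e _; have [->|ne] := eqVneq ((y - x) 0 e) 0; first by rewrite mulr0.
by rewrite f0// mul0r.
Qed.

Let c2 := pd (red (@it n)) (@it n) 0.
Let c1 := red (@it n) 0.

Let tau_t y : pd (red (@it n)) (@it n) y = c2.
Proof.
apply: (eq_pd0 (smooth_pd (@it n) (red_smooth (@it n)))) => e w _.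
move: e; apply: ind_ind => [k|]; last exact: tau_tt.
rewrite (@pdC R _ (red (@it n)) (@it n) (iv k) w (red_smooth _)).
have -> : pd (red (@it n)) (iv k) = fun _ => 0 by apply/funext => y'; exact: pd_red_t.
exact: pd_cst0.
Qed.

Let tau_affine y : red (@it n) y = c1 + c2 * y 0 (@it n).
Proof.
have fd w : differentiable (fun w : 'rV[R]_n.+1 => red (@it n) w - c2 * w 0 (@it n)) w.
  apply: differentiableB; first exact: (smooth_diff (red_smooth _) I).
  by apply: differentiableM; [exact: differentiable_cst|exact: differentiable_coord].
have f0 e w : pd (fun w : 'rV[R]_n.+1 => red (@it n) w - c2 * w 0 (@it n)) e w = 0.
  have dX := pd_isd e (smooth_diff (red_smooth (@it n)) (I : setT w)).
  rewrite (isd_pd (isd_sub dX (isd_cmul c2 (isd_coord e (@it n) w)))).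
  move: e {dX}; apply: ind_ind => [k|]; last by rewrite tau_t eqxx mulr1 subrr.
  by rewrite pd_red_t eq_sym iv_neq_it mulr0 subrr.
have := @eq_on_segment _ _ (fun w : 'rV[R]_n.+1 => red (@it n) w - c2 * w 0 (@it n)) 0 y
  (fun s _ => fd _) (fun s _ => _).
move=> /(_ (ltac:(by move=> s; rewrite big1// => e _; rewrite f0 mul0r))).
by rewrite [(0 : 'rV_ _) 0 _]mxE mulr0 subr0 => /eqP; rewrite subr_eq => /eqP ->.
Qed.

Definition yemb (x : 'rV[R]_n) : 'rV[R]_n.+1 :=
  \row_c if spatial c is Some k then x 0 k else 0.

Let isd_yemb (x : 'rV[R]_n) i c :
  is_derive x (delta_mx 0 i) (fun x => yemb x 0 c) (Some (iv i) == Some c)%:R.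
Proof.
under eq_fun do rewrite mxE.
rewrite (inj_eq Some_inj); move: c; apply: ind_ind => [k|].
  by rewrite spatial_iv iv_eq eq_sym; exact: isd_coord.
by rewrite spatial_it iv_neq_it mulr0n; exact: isd_cst.
Qed.

Let yemb_diff (x : 'rV[R]_n) c : differentiable (fun x => yemb x 0 c) x.
Proof.
under eq_fun do rewrite mxE.
by case: (spatial c) => [k|]; [exact: differentiable_coord|exact: differentiable_cst].
Qed.

(** The spatial components at time 0; by [xi_t] the choice of time is immaterial. *)
Let xi (x : 'rV[R]_n) : 'rV[R]_n := \row_k red (iv k) (yemb x).

Let xiE k : (fun x => xi x 0 k) = fun x => red (iv k) (yemb x).
Proof. by apply/funext => x; rewrite mxE. Qed.

Let xi_smooth : smooth_xi xi.
Proof.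
move=> k; rewrite xiE.
exact: (@smooth_subst R _ _ setT yemb (fun i => Some (iv i)) (fun _ => I) yemb_diff
  isd_yemb (red (iv k)) (red_smooth _)).
Qed.

Let red_xi k : red (iv k) = fun y => xi (xproj y) 0 k.
Proof.
apply/funext => y; rewrite mxE; apply: (eq_pd0 (red_smooth (iv k))) => e w.
move: e; apply: ind_ind => [j|_]; last exact: xi_t.
suff -> : (y - yemb (xproj y)) 0 (iv j) = 0 by rewrite eqxx.
by rewrite !mxE spatial_iv mxE subrr.
Qed.

Lemma symmetry_form : exists (c1 c2 : R) (xi : 'rV[R]_n -> 'rV[R]_n),
  smooth_xi xi /\
  forall z, Dom z -> V z = c1 *: X1 R n + c2 *: X2 z + Xxi xi z.
Proof.
exists c1, c2, xi; split=> // z Dz.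
have xz : xproj (ypart z) = xpart z by apply/rowP => k; rewrite !mxE.
have [VX VE] := V_projectable Dz.
apply/rowP; apply: Ndim_ind => [|p].
  apply: ind_ind => [k|]; first by rewrite field_x VX red_xi xz.
  by rewrite field_t VX tau_affine mxE.
rewrite field_g VE tau_t; congr (_ - _).
have pdX k i : pd (red (iv k)) (iv i) (ypart z) = pd (fun x => xi x 0 k) i (xpart z).
  by rewrite red_xi (pd_xproj _ (xi_smooth k)) spatial_iv xz.
by apply: eq_bigr => k _; rewrite !pdX.
Qed.

End Necessity.

Theorem theorem1 (R : realType) (n : nat) (hn : (2 <= n)%N)
  (V : 'rV[R]_(Ndim n) -> 'rV[R]_(Ndim n)) (hV : smooth_vf V) :
  is_symmetry V <->
  exists (c1 c2 : R) (xi : 'rV[R]_n -> 'rV[R]_n),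
    smooth_xi xi /\
    forall z : 'rV[R]_(Ndim n), Dom z ->
      V z = c1 *: X1 R n + c2 *: X2 z + Xxi xi z.
Proof.
split=> [|[c1 [c2 [xi [xis VE]]]]]; first exact: symmetry_form.
exact: (field_is_symmetry xis VE).
Qed.
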